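(* Let $n\ge 1$, let $G\subseteq\mathbb{R}^n$ be a nonempty open set of finite volume which is monophase with inradius $g\in(0,\infty)$ and coefficients $\kappa_0,\dots,\kappa_{n-1}\in\mathbb{R}$, and put $\kappa_n:=-\mathrm{Vol}(G)$. Let $\{r_1,\dots,r_J\}$ be a ratio list with $0<r_j<1$ for all $j$, whose similarity dimension $D$ satisfies $n-1<D<n$. Let $(G_k)_{k\in\mathbb{N}}$ be a self-similar spray in $\mathbb{R}^n$ generated by $G$ with this ratio list, let $V_{\cup G_k}(\varepsilon)$ denote the volume of the inner $\varepsilon$-tube of $\bigcup_k G_k$, and let $f(\varepsilon):=V_{\cup G_k}(\varepsilon)/\varepsilon^n$. Let $\mathfrak{D}$ be the set of zeros in $\mathbb{C}$ of the function $1-\sum_{j=1}^{J} r_j^{s}$. Then for all $0<\varepsilon<g$, $$f(\varepsilon)=\sum_{\omega\in\mathfrak{D}\cup\{0,1,\dots,n-1\}}\mathrm{res}\left(\frac{\sum_{i=0}^{n}\kappa_i\,\frac{g^{s-i}}{s-i}}{1-\sum_{j=1}^{J} r_j^{s}}\,\varepsilon^{-s}\,;\ \omega\right),$$ i.e. $$V_{\cup G_k}(\varepsilon)=\sum_{\omega\in\mathfrak{D}\cup\{0,1,\dots,n-1\}}\mathrm{res}\left(\varepsilon^{n-s}\,\frac{\sum_{i=0}^{n}\kappa_i\,\frac{g^{s-i}}{s-i}}{1-\sum_{j=1}^{J} r_j^{s}}\,;\ \omega\right),$$ where $\mathrm{res}(h(s);\omega)$ is the residue at $s=\omega$ of the meromorphic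 function $h$.
   Context: Inner tube: for an open set $U\subseteq\mathbb{R}^n$ and $\varepsilon>0$, the inner $\varepsilon$-tube of $U$ is the set of points of $U$ whose distance to the boundary of $U$ is less than $\varepsilon$; its volume ($n$-dimensional Lebesgue measure) is denoted $V_U(\varepsilon)$. The inradius $g$ of $G$ is the supremum of the radii of the balls contained in $G$. Monophase: $G$ is monophase with coefficients $\kappa_0,\dots,\kappa_{n-1}$ if $V_G(\varepsilon)=\sum_{i=0}^{n-1}\kappa_i\,\varepsilon^{n-i}$ for $0<\varepsilon<g$ and $V_G(\varepsilon)=\mathrm{Vol}(G)$ for $\varepsilon\ge g$. Self-similar spray: a ratio list $\{r_1,\dots,r_J\}$ is a finite list (repetitions allowed) of numbers $0<r_j<1$. The associated scaling sequence $(\lambda_k)_{k\in\mathbb{N}}$ is an enumeration of the products $r_{w_1}r_{w_2}\cdots r_{w_l}$ over all finite words $w_1w_2\cdots w_l$ ($l\ge 0$) in the alphabet $\{1,\dots,J\}$, one term for each word (so equal values coming from different words are listed with multiplicity, and the empty word gives $1$): $1, r_1,\dots,r_J, r_1r_1, r_1r_2,\dots, r_1r_J, r_2r_1,\dots$. A self-similar spray generated by $G$ with this ratio list is a collection $(G_k)_{k\in\mathbb{N}}$ of pairwise disjoint subsets of $\mathbb{R}^n$ such that $G_k$ is a copy of $G$ scaled by $\lambda_k$ (the image of $G$ under a similarity of $\mathbb{R}^n$ with ratio $\lambda_k$). Similarity dimension: the unique real number $D$ with $r_1^D+\cdots+r_J^D=1$. For $r>0$ and $s\in\mathbb{C}$,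 $r^s=e^{s\log r}$. The elements of $\mathfrak{D}$ are called the complex dimensions; $\mathfrak{D}\cup\{0,1,\dots,n-1\}$ is a union of sets, so each point contributes exactly one residue. *)

(* Defs.v *)
From HB Require Import structures.
From mathcomp Require Import all_boot all_order all_algebra complex.
From mathcomp Require Import all_classical all_reals all_analysis.

Set Implicit Arguments.
Unset Strict Implicit.
Unset Printing Implicit Defensive.

Import Order.TTheory GRing.Theory Num.Theory.
Import numFieldNormedType.Exports.

Local Open Scope classical_set_scope.
Local Open Scope ring_scope.
Local Open Scope complex_scope.

Section EuclideanSpace.
Context {R : realType} {n : nat}.
Implicit Types (x y : 'rV[R]_n) (A U : set 'rV[R]_n).

(* The library norm on row vectors is the sup norm; tubes, balls and
   similarities are Euclidean.  The topology of ['rV[R]_n] is the usual one. *)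
Definition edist x y : R := Num.sqrt (\sum_(i < n) (x 0 i - y 0 i) ^+ 2).

Definition edist_set x A : \bar R := ereal_inf [set (edist x y)%:E | y in A].

Definition bdry A : set 'rV[R]_n := closure A `\` interior A.

Definition similarity (lam : R) (phi : 'rV[R]_n -> 'rV[R]_n) : Prop :=
  forall x y, edist (phi x) (phi y) = lam * edist x y.

Definition inradius A : \bar R :=
  ereal_sup [set rho%:E | rho in
    [set rho : R | 0 < rho /\ exists x, [set y | edist x y < rho] `<=` A]].

(* n-dimensional Lebesgue (outer) measure, through countable covers by open
   boxes with sides [a i, b i].  It is only applied to open sets below. *)
Definition box (a b : 'rV[R]_n) : set 'rV[R]_n :=
  [set x | forall i, a 0 i < x 0 i < b 0 i].

Definition box_volume (a b : 'rV[R]_n) : R := \prod_(i < n) (b 0 i - a 0 i).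

Definition box_cover A (a b : nat -> 'rV[R]_n) : Prop :=
  (forall k i, a k 0 i <= b k 0 i) /\ A `<=` \bigcup_k box (a k) (b k).

Definition volume A : \bar R :=
  ereal_inf [set v | exists a b : nat -> 'rV[R]_n, box_cover A a b /\
    v = (\sum_(0 <= k <oo) (box_volume (a k) (b k))%:E)%E].

Definition inner_tube U (eps : R) : set 'rV[R]_n :=
  [set x | U x /\ (edist_set x (bdry U) < eps%:E)%E].

Definition tube_volume U (eps : R) : \bar R := volume (inner_tube U eps).

Definition monophase (G : set 'rV[R]_n) (g : R) (kappa : nat -> R) : Prop :=
  (forall eps, 0 < eps < g ->
     tube_volume G eps = (\sum_(i < n) kappa i * eps ^+ (n - i))%:E) /\
  (forall eps, g <= eps -> tube_volume G eps = volume G).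

End EuclideanSpace.

Section Spray.
Context {R : realType} {J : nat}.
Variable r : 'I_J -> R.

(* One term for each finite word, in any order. *)
Definition scaling_sequence (lam : nat -> R) : Prop :=
  exists2 w : nat -> seq 'I_J, bijective w &
    forall k, lam k = \prod_(j <- w k) r j.

Definition self_similar_spray {n : nat} (G : set 'rV[R]_n)
    (Gs : nat -> set 'rV[R]_n) : Prop :=
  exists lam : nat -> R,
    [/\ scaling_sequence lam,
        trivIset setT Gs &
        forall k, exists2 phi, similarity (lam k) phi & Gs k = phi @` G].

End Spray.

Section ComplexAnalysis.
Context {R : realType}.
Implicit Types (s z w c : R[i]) (h : R[i] -> R[i]) (A : set R[i]).

Definition cexp z : R[i] :=
  (expR (complex.Re z))%:C * (cos (complex.Im z) +i* sin (complex.Im z)).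

(* rho ^ s, for rho > 0 *)
Definition cpow (rho : R) s : R[i] := cexp (s * (ln rho)%:C).

(* c is the coefficient of 1 / (z - w) in a Laurent expansion
   \sum_k a_k (z - w)^(k - m - 1) of h on a punctured neighbourhood of w. *)
Definition is_residue h w c : Prop :=
  exists (m : nat) (a : nat -> R[i]),
    (\forall z \near (w : R[i]^o)^',
       (series (fun k => a k * (z - w) ^+ k / (z - w) ^+ m.+1) : nat -> R[i]^o)
         @ \oo --> (h z : R[i]^o)) /\
    c = a m.

Definition residue h w : R[i] := xget 0 [set c | is_residue h w c].

Definition strip (T : R) : set R[i] := [set s | `|complex.Im s| < T].

(* The infinite sum of F over A, as the limit of its finite partial sums over
   the strips |Im s| < tau_k. *)
Definition strip_sum (tau : nat -> R) A (F : R[i] -> R[i]) (S : R[i]) : Prop :=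
  (forall k, finite_set (A `&` strip (tau k))) /\
  ((fun k => \sum_(w \in A `&` strip (tau k)) F w) : nat -> R[i]^o)
    @ \oo --> (S : R[i]^o).

End ComplexAnalysis.

Section ComplexDimensions.
Context {R : realType} {J : nat}.
Variable r : 'I_J -> R.

Definition moran (s : R[i]) : R[i] := 1 - \sum_(j < J) cpow (r j) s.

Definition complex_dimensions : set R[i] := [set s | moran s = 0].

(* Heights tau_k -> +oo at which the infinite sum over the complex dimensions
   may be truncated: [moran] is bounded away from 0 on the lines
   Im s = tau_k, uniformly in k (hence also on Im s = - tau_k, as
   [moran] commutes with conjugation). *)
Definition admissible_heights (tau : nat -> R) : Prop :=
  tau @ \oo --> +oo /\
  exists2 c : R, 0 < c &
    forall (k : nat) (x : R), c%:C <= `|moran (x +i* tau k)|.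

(* The numerator \sum_(i <= n) kappa_i g^(s - i) / (s - i) over [moran s]. *)
Definition spray_zeta (n : nat) (kappa : nat -> R) (g : R) (s : R[i]) : R[i] :=
  (\sum_(i < n.+1) (kappa i)%:C * (cpow g (s - i%:R) / (s - i%:R))) / moran s.

Definition tube_poles (n : nat) : set R[i] :=
  complex_dimensions `|` [set i%:R | i in [set i : nat | (i < n)%N]].

End ComplexDimensions.

(* Main.v *)
Require Import Defs.
From HB Require Import structures.
From mathcomp Require Import all_boot all_order all_algebra complex.
From mathcomp Require Import all_classical all_reals all_analysis.
From mathcomp Require Import ring lra.

Set Implicit Arguments.
Unset Strict Implicit.
Unset Printing Implicit Defensive.

Import Order.TTheory GRing.Theory Num.Theory.
Import numFieldNormedType.Exports.

Local Open Scope classical_set_scope.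
Local Open Scope ring_scope.
Local Open Scope complex_scope.

(** The tube volume is reduced to a function of one real variable that solves
    a renewal equation, and the residue formula solves the same equation.

    Geometry. A tube of a disjoint union of open sets is the union of the tubes
    ([inner_tube_bigcup]), and a similarity of ratio [lam] carries the tube of
    width [eps / lam] to the tube of width [eps] and multiplies the volume of an
    open set by [lam ^+ n] ([volume_similarity]).  With [v] the tube volume of
    the generator and [r_w] the product of the ratios along the word [w], the
    tube volume of the spray is therefore [V x], the sum over all words of
    [r_w ^+ n * v (x / r_w)] ([tube_volume_spray]).  Splitting off the first
    letter gives [V x = v x + \sum_j r_j ^+ n * V (x / r_j)] ([word_sum_rec]).
    When [x >= g] every tube fills its copy of the generator, and [V x] is a
    geometric sum ([word_sum_large]).  So [f x = V x / x ^+ n] is explicit for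
    [x > g] and satisfies
    [f x = \sum_(i < n) kappa i / x ^+ i + \sum_j f (x / r_j)] for [x <= g].

    Decay. Volume is continuous from below, hence the tube polynomial takes the
    value [volume G] at [g] ([monophase_at_inradius]).  Equivalently the sum of
    the [kappa i / g ^+ i] over [i <= n] is zero: the terms of order [1 / s] in
    the numerator of the zeta function cancel, and it decays like [1 / |s|^2]
    on vertical lines ([zeta_num_bound]).

    Analysis. Let [D < c < n] and let [h_x s] be the zeta function times
    [x^(-s)].  The integral of [h_x (c + i t)] over all real [t] is [2 pi f x]
    ([vertical_limit_spray]).  If [x > g], the line moves off to the right and
    crosses only the pole [n].  If [x <= g], then [h_x] is the numerator times
    [x^(-s)] plus the sum of the [h_(x / r_j)]; the line moves to the left for
    the first term and crosses [0, ..., n - 1].  Each division by a ratio brings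
    [x] closer to [g], so an induction concludes.  For the residue sum the line
    of [h_x] itself moves to the left, between the heights [- tau_k] and [tau_k]
    ([strip_sum_spray]): on the horizontal edges the denominator is bounded
    below because the heights are admissible, far to the left because the
    smallest ratio dominates ([moran_left]), and the error is of order
    [1 / tau_k].

    Admissible heights exist because [moran] is bounded away from zero on some
    horizontal line ([exists_zero_free_line]) and because simultaneous
    Diophantine approximation gives arbitrarily large almost periods of all the
    [r_j^(i t)] ([cis_pigeonhole]).

    Contour integrals. An integral along a segment is the increment of an
    antiderivative.  A power series has a primitive on a disc, subdivision
    glues local primitives over a rectangle ([prim_rect]), and the increments
    of a primitive around the boundary cancel.  The residue theorem
    ([oint_residues]) follows by subtracting the principal parts one at a time;
    only [1 / (z - w)] contributes, and its integral is computed with the real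
    logarithm and arctangent. *)

(** * Norms of complex numbers and subdivision arguments *)

(** The norm as a real number; the library norm of a complex number is itself
    a complex number. *)
Notation nm := Normc.normc.

Section ComplexNorm.
Context {R : realType}.
Implicit Types (x y z w p q u : R[i]) (A U : set R[i]) (f h F Phi : R[i] -> R[i]).

Lemma normE z : `|z| = (nm z)%:C. Proof. by []. Qed.

Lemma nm_ge0 z : 0 <= nm z. Proof. by case: z => a b; rewrite sqrtr_ge0. Qed.

Lemma nm0 : nm (0 : R[i]) = 0. Proof. exact: Normc.normc0. Qed.

Lemma nm1 : nm (1 : R[i]) = 1. Proof. exact: Normc.normc1. Qed.

Lemma nmM x y : nm (x * y) = nm x * nm y. Proof. exact: Normc.normcM. Qed.

Lemma nmV x : nm x^-1 = (nm x)^-1. Proof. exact: Normc.normcV. Qed.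

Lemma nmN x : nm (- x) = nm x. Proof. exact: normcN. Qed.

Lemma nmD x y : nm (x + y) <= nm x + nm y. Proof. exact: le_normcD. Qed.

Lemma nmB x y : nm (x - y) <= nm x + nm y.
Proof. by rewrite -(nmN y); apply: nmD. Qed.

Lemma nm_dist x y : nm (x - y) = nm (y - x).
Proof. by rewrite -nmN opprB. Qed.

Lemma nm_tri x y z : nm (x - z) <= nm (x - y) + nm (y - z).
Proof.
rewrite (_ : x - z = (x - y) + (y - z)); first exact: nmD.
by rewrite addrA subrK.
Qed.

Lemma nm_tri2 x y : nm x - nm y <= nm (x - y).
Proof. by rewrite lerBlDr; have := nmD (x - y) y; rewrite subrK. Qed.

Lemma nm_eq0 x : (nm x == 0) = (x == 0).
Proof. by apply/eqP/eqP => [/Normc.eq0_normc//|->]; rewrite nm0. Qed.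

Lemma nm_gt0 x : (0 < nm x) = (x != 0).
Proof. by rewrite lt_def nm_eq0 nm_ge0 andbT. Qed.

Lemma nmX x n : nm (x ^+ n) = nm x ^+ n.
Proof. by elim: n => [|n ih]; rewrite ?expr0 ?nm1// !exprS nmM ih. Qed.

Lemma nmR (a : R) : nm a%:C = `|a|.
Proof. by rewrite /= expr0n/= addr0 sqrtr_sqr. Qed.

Lemma nm_nat n : nm (n%:R : R[i]) = n%:R.
Proof. by rewrite -(rmorph_nat (real_complex R)) nmR ger0_norm. Qed.

Lemma nm_sum (I : Type) (r : seq I) (P : pred I) (F : I -> R[i]) :
  nm (\sum_(i <- r | P i) F i) <= \sum_(i <- r | P i) nm (F i).
Proof.
elim/big_rec2: _ => [|i a b _ ih]; first by rewrite nm0.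
by rewrite (le_trans (nmD _ _))// lerD2l.
Qed.

Lemma nm_Re z : `|complex.Re z| <= nm z.
Proof.
case: z => a b /=; rewrite -sqrtr_sqr ler_wsqrtr//.
by rewrite lerDl sqr_ge0.
Qed.

Lemma nm_Im z : `|complex.Im z| <= nm z.
Proof.
case: z => a b /=; rewrite -sqrtr_sqr ler_wsqrtr//.
by rewrite lerDr sqr_ge0.
Qed.

Lemma nm_ReIm z : nm z <= `|complex.Re z| + `|complex.Im z|.
Proof.
case: z => a b; have -> : a +i* b = a%:C + 'i * b%:C by simpc.
rewrite (le_trans (nmD _ _))// nmM !nmR.
suff -> : nm ('i : R[i]) = 1 by rewrite mul1r; simpc.
by rewrite /= expr0n/= add0r expr1n sqrtr1.
Qed.

Lemma nmi : nm ('i : R[i]) = 1.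
Proof. by rewrite /= expr0n/= add0r expr1n sqrtr1. Qed.

Lemma eq_nm_le x y : (forall e : R, 0 < e -> nm (x - y) <= e) -> x = y.
Proof.
move=> h; apply/eqP; rewrite -subr_eq0 -nm_eq0 eq_le nm_ge0 andbT.
by apply/ler_addgt0Pr => e e0; rewrite add0r h.
Qed.

End ComplexNorm.

Section Cousin.
Context {R : realType}.

(** A property of intervals that holds for short intervals around each point
    and is stable under concatenation propagates from [a] to the supremum of
    the points reached, and beyond it. This replaces compactness of [a, b] in
    every subdivision argument below. *)
Lemma cousin (Q : R -> R -> Prop) (a b : R) : a <= b ->
  (forall x y z, a <= x -> x <= y -> y <= z -> z <= b -> Q x y -> Q y z ->
     Q x z) ->
  (forall p, a <= p <= b -> exists2 d, 0 < d & forall x y, a <= x -> x <= p ->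
     p <= y -> y <= b -> y - x < d -> Q x y) ->
  Q a b.
Proof.
move=> ab glue loc.
pose S := [set t | a <= t <= b /\ Q a t].
have Sa : S a.
  split; first by rewrite lexx.
  by have [|d d0] := loc a; [rewrite lexx|apply=> //; rewrite subrr].
have Sb : has_ubound S by exists b => t [/andP[]].
have hs : has_sup S by split=> //; exists a.
have sa : a <= sup S by apply: ub_le_sup.
have sb : sup S <= b by apply: ge_sup => [|t [/andP[]]//]; exists a.
have [|d d0 hd] := loc (sup S); first by rewrite sa sb.
have [|t St tlt] := @sup_adherent R S (d / 2) _ hs; first by rewrite divr_gt0.
have tS : t <= sup S by apply: ub_le_sup.
case: St => /andP[at_ tb] Qt.
pose u := Num.min b (sup S + d / 4).
have ub : u <= b by rewrite /u ge_min lexx.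
have us : u <= sup S + d / 4 by rewrite /u ge_min lexx orbT.
have su : sup S <= u by rewrite /u le_min sb/=; lra.
have Qu : Q a u.
  by apply: (glue a t u) => //; [lra|apply: hd => //; lra].
have [<- //|ub'] : u = b \/ u < b.
  by move: ub; rewrite le_eqVlt => /orP[/eqP|]; [left|right].
have : u <= sup S by apply: ub_le_sup => //; split=> //; rewrite ub andbT; lra.
have -> : u = sup S + d / 4.
  by move: ub'; rewrite /u /Num.min; case: ifP => //; rewrite ltxx.
lra.
Qed.

(** Subdivision of a rectangle: the one-dimensional principle is applied to
    the horizontal side, and its local hypothesis comes from a second
    application to the vertical side. *)
Lemma cousin2 (Q : R -> R -> R -> R -> Prop) (x0 x1 y0 y1 : R) :
  x0 <= x1 -> y0 <= y1 ->
  (forall a b c y y', x0 <= a -> a <= b -> b <= c -> c <= x1 -> y0 <= y ->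
     y <= y' -> y' <= y1 -> Q a b y y' -> Q b c y y' -> Q a c y y') ->
  (forall x x' a b c, x0 <= x -> x <= x' -> x' <= x1 -> y0 <= a -> a <= b ->
     b <= c -> c <= y1 -> Q x x' a b -> Q x x' b c -> Q x x' a c) ->
  (forall p q, x0 <= p <= x1 -> y0 <= q <= y1 -> exists2 d, 0 < d &
     forall a b c e, x0 <= a -> a <= p -> p <= b -> b <= x1 -> b - a < d ->
       y0 <= c -> c <= q -> q <= e -> e <= y1 -> e - c < d -> Q a b c e) ->
  Q x0 x1 y0 y1.
Proof.
move=> x01 y01 hx hy loc.
pose Q1 a b := Q a b y0 y1.
apply: (@cousin Q1) => // [a b c ? ? ? ?|p pin]; first by apply: hx.
pose Q2 c e := exists2 d, 0 < d & forall a b, x0 <= a -> a <= p -> p <= b ->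
  b <= x1 -> b - a < d -> Q a b c e.
apply: (@cousin Q2) => // [a b c ? ? ? ?|q qin].
  move=> [d d0 hd] [d' d'0 hd']; exists (Num.min d d').
    by rewrite lt_min d0.
  move=> x x' ? ? ? ?; rewrite lt_min => /andP[? ?].
  by apply: (hy x x' a b c) => //; [lra|exact: hd|exact: hd'].
have [d d0 hd] := loc p q pin qin; exists d => // c e ? ? ? ? ?.
by exists d => // a b ? ? ? ? ?; apply: hd.
Qed.

End Cousin.

(** * Primitives along segments and on rectangles *)

Section Primitives.
Context {R : realType}.
Implicit Types (x y z w p q u c : R[i]) (S T : set R[i]) (h Phi Psi : R[i] -> R[i])
  (a b : R) (f F G : R -> R[i]).

(** The derivative is taken within [S], so that primitives make sense on a
    closed rectangle or a segment. *)
Definition prim S Phi h := forall p, S p -> forall e : R, 0 < e ->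
  exists2 d : R, 0 < d & forall z, S z -> nm (z - p) < d ->
    nm (Phi z - Phi p - h p * (z - p)) <= e * nm (z - p).

Definition rprim (a b : R) (F f : R -> R[i]) := forall t, a <= t <= b ->
  forall e : R, 0 < e ->
  exists2 d : R, 0 < d & forall s, a <= s <= b -> `|s - t| < d ->
    nm (F s - F t - f t * (s - t)%:C) <= e * `|s - t|.

(** The integral of a complex function of a real variable as the increment of
    an antiderivative; the value is unique by [is_int_unique]. *)
Definition is_int (f : R -> R[i]) (a b : R) (v : R[i]) :=
  exists2 F, rprim a b F f & v = F b - F a.

Lemma prim_sub S T Phi h : S `<=` T -> prim T Phi h -> prim S Phi h.
Proof.
move=> ST hT p Sp e e0; have [d d0 hd] := hT p (ST _ Sp) e e0.
by exists d => // z /ST; exact: hd.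
Qed.

Lemma prim_eq S Phi h h' : (forall z, S z -> h z = h' z) ->
  prim S Phi h -> prim S Phi h'.
Proof. by move=> hh' H p Sp e e0; rewrite -hh'//; exact: H. Qed.

Lemma primD S Phi h Phi' h' : prim S Phi h -> prim S Phi' h' ->
  prim S (fun z => Phi z + Phi' z) (fun z => h z + h' z).
Proof.
move=> H H' p Sp e e0.
have e20 : 0 < e / 2 by rewrite divr_gt0.
have [d d0 hd] := H p Sp _ e20; have [d' d'0 hd'] := H' p Sp _ e20.
exists (Num.min d d'); first by rewrite lt_min d0.
move=> z Sz; rewrite lt_min => /andP[zd zd'].
have -> : Phi z + Phi' z - (Phi p + Phi' p) - (h p + h' p) * (z - p) =
  (Phi z - Phi p - h p * (z - p)) + (Phi' z - Phi' p - h' p * (z - p)) by ring.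
have := nmD (Phi z - Phi p - h p * (z - p)) (Phi' z - Phi' p - h' p * (z - p)).
have := hd z Sz zd; have := hd' z Sz zd'; lra.
Qed.

Lemma primZ S Phi h c : prim S Phi h ->
  prim S (fun z => c * Phi z) (fun z => c * h z).
Proof.
move=> H p Sp e e0.
have c0 : 0 < nm c + 1 by have := nm_ge0 c; lra.
have e20 : 0 < e / (nm c + 1) by rewrite divr_gt0.
have [d d0 hd] := H p Sp _ e20.
exists d => // z Sz zd.
have -> : c * Phi z - c * Phi p - c * h p * (z - p) =
  c * (Phi z - Phi p - h p * (z - p)) by ring.
rewrite nmM (le_trans (ler_wpM2l (nm_ge0 _) (hd z Sz zd)))//.
rewrite mulrA ler_wpM2r ?nm_ge0// mulrA ler_pdivrMr//.
by have := nm_ge0 c; nra.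
Qed.

Lemma prim_addc S Phi h c : prim S Phi h -> prim S (fun z => Phi z + c) h.
Proof.
move=> H p Sp e e0; have [d d0 hd] := H p Sp e e0; exists d => // z Sz zd.
by rewrite [X in X - _](_ : _ = Phi z - Phi p); [exact: hd|ring].
Qed.

(** Two closed sets can be glued: near a point of only one of them the other
    set is absent. *)
Lemma prim_glue S T Phi Psi h : prim S Phi h -> prim T Psi h ->
  (forall z, S z -> T z -> Phi z = Psi z) ->
  (forall p, ~ S p -> exists2 d, 0 < d & forall z, nm (z - p) < d -> ~ S z) ->
  (forall p, ~ T p -> exists2 d, 0 < d & forall z, nm (z - p) < d -> ~ T z) ->
  prim (S `|` T) (fun z => if `[< S z >] then Phi z else Psi z) h.
Proof.
move=> HS HT E oS oT.
have pos (U : set R[i]) Om : prim U Om h ->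
    (forall p, ~ U p -> exists2 d, 0 < d & forall z, nm (z - p) < d -> ~ U z) ->
    forall p (e : R), 0 < e -> exists2 d, 0 < d &
      forall z, U z -> nm (z - p) < d ->
        U p /\ nm (Om z - Om p - h p * (z - p)) <= e * nm (z - p).
  move=> HU oU p e e0; case: (pselect (U p)) => Up.
    by have [d d0 hd] := HU p Up e e0; exists d => // z Uz zd; split=> //; exact: hd.
  by have [d d0 hd] := oU p Up; exists d => // z Uz zd; have := hd z zd.
move=> p STp e e0.
have [d d0 hd] := pos _ _ HS oS p e e0.
have [d' d'0 hd'] := pos _ _ HT oT p e e0.
exists (Num.min d d'); first by rewrite lt_min d0.
move=> z STz; rewrite lt_min => /andP[zd zd'].
case: asboolP => Sz.
  by have [Sp ?] := hd z Sz zd; case: asboolP.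
have Tz : T z by case: STz.
have [Tp ?] := hd' z Tz zd'; case: asboolP => // Sp.
by rewrite (E p).
Qed.

Lemma rprim_eq a b F f f' : (forall t, a <= t <= b -> f t = f' t) ->
  rprim a b F f -> rprim a b F f'.
Proof. by move=> ff' H p Sp e e0; rewrite -ff'//; exact: H. Qed.

Lemma rprimD a b F f F' f' : rprim a b F f -> rprim a b F' f' ->
  rprim a b (fun t => F t + F' t) (fun t => f t + f' t).
Proof.
move=> H H' p Sp e e0.
have e20 : 0 < e / 2 by rewrite divr_gt0.
have [d d0 hd] := H p Sp _ e20; have [d' d'0 hd'] := H' p Sp _ e20.
exists (Num.min d d'); first by rewrite lt_min d0.
move=> z Sz; rewrite lt_min => /andP[zd zd'].
have -> : F z + F' z - (F p + F' p) - (f p + f' p) * (z - p)%:C =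
  (F z - F p - f p * (z - p)%:C) + (F' z - F' p - f' p * (z - p)%:C) by ring.
have := nmD (F z - F p - f p * (z - p)%:C) (F' z - F' p - f' p * (z - p)%:C).
have := hd z Sz zd; have := hd' z Sz zd'; lra.
Qed.

Lemma rprimZ a b F f c : rprim a b F f ->
  rprim a b (fun t => c * F t) (fun t => c * f t).
Proof.
move=> H p Sp e e0.
have c0 : 0 < nm c + 1 by have := nm_ge0 c; lra.
have e20 : 0 < e / (nm c + 1) by rewrite divr_gt0.
have [d d0 hd] := H p Sp _ e20.
exists d => // z Sz zd.
have -> : c * F z - c * F p - c * f p * (z - p)%:C =
  c * (F z - F p - f p * (z - p)%:C) by ring.
rewrite nmM (le_trans (ler_wpM2l (nm_ge0 _) (hd z Sz zd)))//.
rewrite mulrA ler_wpM2r// mulrA ler_pdivrMr//.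
by have := nm_ge0 c; nra.
Qed.

Lemma prim_rprim S Phi h p u a b : prim S Phi h ->
  (forall t, a <= t <= b -> S (p + t%:C * u)) ->
  rprim a b (fun t => Phi (p + t%:C * u)) (fun t => h (p + t%:C * u) * u).
Proof.
move=> H hS t tab e e0.
have c0 : 0 < nm u + 1 by have := nm_ge0 u; lra.
have e20 : 0 < e / (nm u + 1) by rewrite divr_gt0.
have [d d0 hd] := H _ (hS t tab) _ e20.
exists (d / (nm u + 1)); first by rewrite divr_gt0.
move=> s sab st.
have E : p + s%:C * u - (p + t%:C * u) = (s - t)%:C * u by rewrite rmorphB/=; ring.
have nE : nm ((s - t)%:C * u) = `|s - t| * nm u by rewrite nmM nmR.
have := hd _ (hS s sab).
rewrite E nE.
rewrite (_ : h (p + t%:C * u) * u * (s - t)%:C =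
  h (p + t%:C * u) * ((s - t)%:C * u)); last by ring.
move=> /(_ _)/le_trans -> //.
  move: st; rewrite ltr_pdivlMr//; apply: le_lt_trans.
  by rewrite ler_wpM2l// lerDl.
rewrite (_ : _ * _ = e * `|s - t| * (nm u / (nm u + 1))); last by ring.
rewrite ler_piMr ?mulr_ge0 ?(ltW e0)// ler_pdivrMr//; lra.
Qed.

Lemma derive_estimate (B : R -> R) (t b' : R) : is_derive t 1 B b' ->
  forall e : R, 0 < e -> exists2 d, 0 < d & forall s, `|s - t| < d ->
    `|B s - B t - b' * (s - t)| <= e * `|s - t|.
Proof.
move=> [dB <-] e e0.
move/cvgrPdist_le: dB => /(_ e e0)[d /= d0 hd].
exists d => // s std.
have [->|st] := eqVneq s t; first by rewrite !subrr mulr0 subrr !normr0 mulr0.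
have := hd (s - t); rewrite /= sub0r normrN subr_eq0 => /(_ std st).
rewrite /derive (_ : (s - t) *: 1 + t = s); last first.
  by rewrite [_ *: _]mulr1 subrK.
set D := lim _ => h.
have st0 : s - t != 0 by rewrite subr_eq0.
rewrite -[X in X <= _]normrN.
have -> : - (B s - B t - D * (s - t)) = (D - (s - t)^-1 * (B s - B t)) * (s - t).
  by field.
by rewrite normrM ler_wpM2r.
Qed.

(** Mean value inequality, by subdivision: on a short interval around [p] the
    increment of [F] is at most [nm (f p)] times its length up to [e], and
    that of [B] is at least [b' p] times the length up to [e]. *)
Lemma rprim_mvi a b F f (B b' : R -> R) : a <= b -> rprim a b F f ->
  (forall t, a <= t <= b -> is_derive t 1 B (b' t)) ->
  (forall t, a <= t <= b -> nm (f t) <= b' t) ->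
  nm (F b - F a) <= B b - B a.
Proof.
move=> ab HF HB fb.
suff H (e : R) : 0 < e -> nm (F b - F a) <= B b - B a + e * (b - a).
  apply/ler_addgt0Pr => e e0.
  have c0 : 0 < b - a + 1 by lra.
  rewrite (le_trans (H (e / (b - a + 1)) _))//; first by rewrite divr_gt0.
  rewrite lerD2l mulrAC ler_pdivrMr// ler_wpM2l ?ltW//; lra.
move=> e0.
pose Q (x y : R) := nm (F y - F x) <= B y - B x + e * (y - x).
apply: (@cousin R Q) => // [x y z _ _ _ _|p pab]; rewrite /Q.
  by have := nm_tri (F z) (F y) (F x); lra.
have e20 : 0 < e / 2 by rewrite divr_gt0.
have [d d0 hd] := HF p pab _ e20.
have [d' d'0 hd'] := derive_estimate (HB p pab) e20.
exists (Num.min d d'); first by rewrite lt_min d0.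
move=> x y ax xp py yb; rewrite lt_min => /andP[xyd xyd'].
have x1 : `|x - p| = p - x by rewrite distrC ger0_norm// subr_ge0.
have y1 : `|y - p| = y - p by rewrite ger0_norm// subr_ge0.
have Hx := hd x; have Hy := hd y; have Bx := hd' x; have By := hd' y.
rewrite x1 in Hx Bx; rewrite y1 in Hy By.
have [xI yI] : a <= x <= b /\ a <= y <= b by split; apply/andP; split; lra.
have [xd yd] : p - x < d /\ y - p < d by split; lra.
have [xd' yd'] : p - x < d' /\ y - p < d' by split; lra.
move: Hx Hy Bx By => /(_ xI xd) Hx /(_ yI yd) Hy /(_ xd') Bx /(_ yd') By.
have bp := fb p pab.
have Px : nm (F p - F x) <= nm (f p) * (p - x) + e / 2 * (p - x).
  rewrite nm_dist; have := nm_tri2 (F x - F p) (f p * (x - p)%:C).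
  by rewrite nmM nmR x1; lra.
have Py : nm (F y - F p) <= nm (f p) * (y - p) + e / 2 * (y - p).
  have := nm_tri2 (F y - F p) (f p * (y - p)%:C).
  by rewrite nmM nmR y1; lra.
move: Bx By; rewrite !ler_norml => /andP[_ Bx] /andP[By _].
have := nm_tri (F y) (F p) (F x).
nra.
Qed.

Lemma rprim_const a b F f : a <= b -> rprim a b F f ->
  (forall t, a <= t <= b -> f t = 0) -> F b = F a.
Proof.
move=> ab HF f0; apply/eqP; rewrite -subr_eq0 -nm_eq0 eq_le nm_ge0 andbT.
have := @rprim_mvi a b F f (fun=> 0) (fun=> 0) ab HF; rewrite subrr; apply.
by move=> t /f0 ->; rewrite nm0.
Qed.

Lemma is_int_unique f a b v v' : a <= b -> is_int f a b v -> is_int f a b v' ->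
  v = v'.
Proof.
move=> ab [F HF ->] [G HG ->].
have H := rprim_const ab (rprimD HF (rprimZ (-1) HG)).
apply/eqP; rewrite -subr_eq0; apply/eqP.
have -> : F b - F a - (G b - G a) = (F b + -1 * G b) - (F a + -1 * G a) by ring.
by rewrite H ?subrr// => t _; ring.
Qed.

Lemma is_intD f g a b v w : is_int f a b v -> is_int g a b w ->
  is_int (fun t => f t + g t) a b (v + w).
Proof.
move=> [F HF ->] [G HG ->]; exists (fun t => F t + G t); first exact: rprimD.
ring.
Qed.

Lemma is_intZ f a b v c : is_int f a b v -> is_int (fun t => c * f t) a b (c * v).
Proof.
move=> [F HF ->]; exists (fun t => c * F t); first exact: rprimZ.
ring.
Qed.

Lemma is_int_eq f g a b v : (forall t, a <= t <= b -> f t = g t) ->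
  is_int f a b v -> is_int g a b v.
Proof. by move=> fg [F HF ->]; exists F => //; exact: rprim_eq HF. Qed.

Lemma is_int0 a b : is_int (fun=> 0) a b 0.
Proof.
exists (fun=> 0); last by rewrite subrr.
move=> t _ e e0; exists 1 => // s _ _.
by rewrite mul0r !subr0 nm0 mulr_ge0// ltW.
Qed.

Lemma is_int_bound f a b v (B b' : R -> R) : a <= b -> is_int f a b v ->
  (forall t, a <= t <= b -> is_derive t 1 B (b' t)) ->
  (forall t, a <= t <= b -> nm (f t) <= b' t) ->
  nm v <= B b - B a.
Proof. by move=> ab [F HF ->]; exact: rprim_mvi. Qed.

Lemma is_int_bound_const f a b v M : a <= b -> is_int f a b v ->
  (forall t, a <= t <= b -> nm (f t) <= M) -> nm v <= M * (b - a).
Proof.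
move=> ab Hf fM.
have := @is_int_bound f a b v (fun t => M * t) (fun=> M) ab Hf.
rewrite mulrBr; apply=> // t _.
by apply: is_derive_eq; rewrite scaler1 ?mulr1 ?scaler0 ?add0r//.
Qed.

Definition locprim h p := exists2 rho : R, 0 < rho &
  exists Phi, prim [set z | nm (z - p) < rho] Phi h.

Definition rect (x0 x1 y0 y1 : R) : set R[i] :=
  [set z | x0 <= complex.Re z <= x1 /\ y0 <= complex.Im z <= y1].

Lemma rect_closed (x0 x1 y0 y1 : R) p : ~ rect x0 x1 y0 y1 p ->
  exists2 d, 0 < d & forall z, nm (z - p) < d -> ~ rect x0 x1 y0 y1 z.
Proof.
move=> np.
have far (a : R) (g : R[i] -> R) : (forall z, `|g z - g p| <= nm (z - p)) ->
    0 < a -> (forall z, rect x0 x1 y0 y1 z -> a <= `|g z - g p|) ->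
    exists2 d, 0 < d & forall z, nm (z - p) < d -> ~ rect x0 x1 y0 y1 z.
  by move=> hg a0 ha; exists a => // z zp /ha; have := hg z; lra.
have hRe z : `|complex.Re z - complex.Re p| <= nm (z - p).
  by have := nm_Re (z - p); case: (z) (p) => [? ?] [? ?].
have hIm z : `|complex.Im z - complex.Im p| <= nm (z - p).
  by have := nm_Im (z - p); case: (z) (p) => [? ?] [? ?].
have [h|h] := ltP (complex.Re p) x0.
  refine (far (x0 - complex.Re p) _ hRe _ _); first by lra.
  move=> z [/andP[? ?] _]; rewrite ger0_norm; lra.
have [h'|h'] := ltP x1 (complex.Re p).
  refine (far (complex.Re p - x1) _ hRe _ _); first by lra.
  move=> z [/andP[? ?] _]; rewrite distrC ger0_norm; lra.
have [k|k] := ltP (complex.Im p) y0.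
  refine (far (y0 - complex.Im p) _ hIm _ _); first by lra.
  move=> z [_ /andP[? ?]]; rewrite ger0_norm; lra.
have [k'|k'] := ltP y1 (complex.Im p).
  refine (far (complex.Im p - y1) _ hIm _ _); first by lra.
  move=> z [_ /andP[? ?]]; rewrite distrC ger0_norm; lra.
by exfalso; apply: np; split; apply/andP.
Qed.

(** The difference of the two primitives has derivative zero along the
    segment. *)
Lemma prim_segment_const S Phi Psi h p u a b : prim S Phi h -> prim S Psi h ->
  a <= b -> (forall t, a <= t <= b -> S (p + t%:C * u)) ->
  Phi (p + b%:C * u) - Psi (p + b%:C * u) = Phi (p + a%:C * u) - Psi (p + a%:C * u).
Proof.
move=> H1 H2 ab hS.
have H := primD H1 (primZ (-1) H2).
have := rprim_const ab (prim_rprim H hS).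
rewrite !mulN1r => -> // t _.
by rewrite mulN1r subrr mul0r.
Qed.

(** The primitives on two adjacent rectangles differ by a constant on the
    common side; correcting one of them by this constant makes them agree
    there, and they glue. *)
Lemma prim_rect h (x0 x1 y0 y1 : R) : x0 <= x1 -> y0 <= y1 ->
  (forall p, rect x0 x1 y0 y1 p -> locprim h p) ->
  exists Phi, prim (rect x0 x1 y0 y1) Phi h.
Proof.
move=> x01 y01 L.
pose Q (a b c d : R) := exists Phi, prim (rect a b c d) Phi h.
apply: (@cousin2 R Q) => //.
- move=> a b c y y' _ ab bc _ _ yy' _ [Phi HPhi] [Psi HPsi].
  pose p0 := b +i* y; pose K := Phi p0 - Psi p0.
  have E z : rect a b y y' z -> rect b c y y' z -> Phi z = Psi z + K.
    case: z => s t [/= s1 t1] [/= s2 t2].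
    have sb : s = b by apply/eqP; rewrite eq_le; lra.
    pose S := rect b b y y'.
    have S1 : S `<=` rect a b y y' by move=> z [/= ? ?]; split=> //; lra.
    have S2 : S `<=` rect b c y y' by move=> z [/= ? ?]; split=> //; lra.
    have := @prim_segment_const S Phi Psi h (b%:C) 'i y t.
    have Ez (r : R) : b%:C + r%:C * 'i = b +i* r by simpc.
    rewrite !Ez sb => H.
    rewrite -[Phi _](subrK (Psi (b +i* t))) H; first by rewrite addrC.
    + exact: prim_sub HPhi.
    + exact: prim_sub HPsi.
    + by case/andP: t1.
    + by move=> r ?; rewrite Ez; split=> /=; lra.
  exists (fun z => if `[< rect a b y y' z >] then Phi z else Psi z + K).
  apply: (@prim_sub _ (rect a b y y' `|` rect b c y y')).
    move=> z [? ?]; have [?|?] := leP (complex.Re z) b; [left|right]; split=> //; lra.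
  apply: prim_glue => //; first exact: prim_addc.
    by move=> p; exact: rect_closed.
  by move=> p; exact: rect_closed.
- move=> x x' a b c _ xx' _ _ ab bc _ [Phi HPhi] [Psi HPsi].
  pose p0 := x +i* b; pose K := Phi p0 - Psi p0.
  have E z : rect x x' a b z -> rect x x' b c z -> Phi z = Psi z + K.
    case: z => s t [/= s1 t1] [/= s2 t2].
    have tb : t = b by apply/eqP; rewrite eq_le; lra.
    pose S := rect x x' b b.
    have S1 : S `<=` rect x x' a b by move=> z [/= ? ?]; split=> //; lra.
    have S2 : S `<=` rect x x' b c by move=> z [/= ? ?]; split=> //; lra.
    have := @prim_segment_const S Phi Psi h (0 +i* b) 1 x s.
    have Ez (r : R) : (0 +i* b) + r%:C * 1 = r +i* b by simpc.
    rewrite !Ez tb => H.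
    rewrite -[Phi _](subrK (Psi (s +i* b))) H; first by rewrite addrC.
    + exact: prim_sub HPhi.
    + exact: prim_sub HPsi.
    + by case/andP: s1.
    + by move=> r ?; rewrite Ez; split=> /=; lra.
  exists (fun z => if `[< rect x x' a b z >] then Phi z else Psi z + K).
  apply: (@prim_sub _ (rect x x' a b `|` rect x x' b c)).
    move=> z [? ?]; have [?|?] := leP (complex.Im z) b; [left|right]; split=> //; lra.
  apply: prim_glue => //; first exact: prim_addc.
    by move=> p; exact: rect_closed.
  by move=> p; exact: rect_closed.
- move=> p q pin qin.
  have [|rho rho0 [Phi HPhi]] := L (p +i* q); first by split.
  exists (rho / 2); first by rewrite divr_gt0.
  move=> a b c e ? ? ? ? ? ? ? ? ? ?; exists Phi.
  apply: prim_sub HPhi => z [/andP[? ?] /andP[? ?]].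
  have := nm_ReIm (z - (p +i* q)).
  rewrite !raddfB /= => /le_lt_trans; apply.
  rewrite [ltRHS](splitr rho).
  by apply: ltrD; rewrite ltr_norml; apply/andP; split; lra.
Qed.

End Primitives.

(** * Power series with explicit rates of convergence *)

Section PowerSeries.
Context {R : realType}.
Implicit Types (x y z w p u v c : R[i]) (f g h Phi : R[i] -> R[i])
  (a b : nat -> R[i]) (q M e : R).

Lemma half_geo n : \sum_(k < n) (2^-1 : R) ^+ k = 2 - 2 * 2^-1 ^+ n.
Proof.
elim: n => [|n ih]; first by rewrite big_ord0 expr0 mulr1 subrr.
by rewrite big_ord_recr/= ih exprS; field.
Qed.

Lemma half_small e : 0 < e -> exists N, forall n, (N <= n)%N -> 2^-1 ^+ n <= e.
Proof.
move=> e0.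
have h1 : `|2^-1 : R| < 1 by rewrite ger0_norm ?invr_ge0// invf_lt1// ltr1n.
have /cvgrPdist_le/(_ e e0)[N _ hN] := cvg_expr h1.
exists N => n Nn; have := hN n Nn; rewrite sub0r normrN ger0_norm//.
Qed.

Lemma half_eq0 (A B : R) : 0 <= A -> (forall n : nat, A <= B * 2^-1 ^+ n) -> A = 0.
Proof.
move=> A0 H; apply/eqP; rewrite eq_le A0 andbT; apply/ler_addgt0Pr => e e0.
rewrite add0r.
have B0 : 0 <= B by have := H 0%N; rewrite expr0 mulr1; lra.
have B1 : 0 < B + 1 by lra.
have [|N hN] := @half_small (e / (B + 1)); first by rewrite divr_gt0.
rewrite (le_trans (H N))// (le_trans (ler_wpM2l B0 (hN N (leqnn _))))//.
by rewrite mulrA ler_pdivrMr// mulrC ler_wpM2l ?(ltW e0)// lerDl.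
Qed.

Definition psum a u (n : nat) : R[i] := \sum_(k < n) a k * u ^+ k.

(** Power series expansion of [f] at [w] with an explicit rate: on the disc of
    radius [1 / (2 q)] the [k]-th term is at most [M / 2 ^+ k], which gives
    the error of the partial sums. All errors are thus geometric and uniform
    on the disc. *)
Definition ps a w f q M := [/\ 0 < q, 0 <= M, forall k, nm (a k) <= M * q ^+ k
  & forall z, nm (z - w) <= (2 * q)^-1 -> forall n,
      nm (psum a (z - w) n - f z) <= 2 * M * 2^-1 ^+ n].

Lemma term_bound a u q M k : 0 < q -> 0 <= M -> (forall k, nm (a k) <= M * q ^+ k) ->
  nm u <= (2 * q)^-1 -> nm (a k * u ^+ k) <= M * 2^-1 ^+ k.
Proof.
move=> q0 M0 aM uq; rewrite nmM nmX.
rewrite (le_trans (ler_pM (nm_ge0 _) _ (aM k) (lerXn2r k _ _ uq)))//.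
- by rewrite exprn_ge0// nm_ge0.
- by rewrite nnegrE nm_ge0.
- by rewrite nnegrE invr_ge0 mulr_ge0// ltW.
by rewrite -mulrA -exprMn invfM mulrCA divff ?gt_eqF// mulr1.
Qed.

Lemma psum_cauchy a u q M n m : 0 < q -> 0 <= M ->
  (forall k, nm (a k) <= M * q ^+ k) -> nm u <= (2 * q)^-1 ->
  nm (psum a u (n + m) - psum a u n) <= 2 * M * 2^-1 ^+ n.
Proof.
move=> q0 M0 aM uq; rewrite /psum big_split_ord/= [X in nm (X - _)]addrC addrK.
rewrite (le_trans (nm_sum _ _ _))//.
rewrite (@le_trans _ _ (\sum_(i < m) M * 2^-1 ^+ n * 2^-1 ^+ i))//.
  apply: ler_sum => i _; rewrite -mulrA -exprD.
  exact: term_bound q0 M0 aM uq.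
rewrite -mulr_sumr half_geo -[leRHS]mulrA [leRHS]mulrC.
rewrite ler_wpM2l ?mulr_ge0 ?exprn_ge0 ?invr_ge0//.
by rewrite gerBl mulr_ge0 ?exprn_ge0 ?invr_ge0.
Qed.

(** Pointwise convergence with the coefficient bound already gives the rate,
    since the tails of the partial sums are geometric. *)
Lemma ps_of_cvg a w f q M : 0 < q -> 0 <= M ->
  (forall k, nm (a k) <= M * q ^+ k) ->
  (forall z, nm (z - w) <= (2 * q)^-1 -> forall e, 0 < e ->
     exists N, forall n, (N <= n)%N -> nm (psum a (z - w) n - f z) <= e) ->
  ps a w f q M.
Proof.
move=> q0 M0 aM H; split=> // z zq n.
apply/ler_addgt0Pr => e e0.
have [N hN] := H z zq e e0.
have := hN (n + N)%N (leq_addl _ _).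
have := psum_cauchy n N q0 M0 aM zq.
rewrite [X in X <= _ -> _]nm_dist.
have := nm_tri (psum a (z - w) n) (psum a (z - w) (n + N)) (f z); lra.
Qed.

Lemma ps_cvg a w f q M z e : ps a w f q M -> nm (z - w) <= (2 * q)^-1 -> 0 < e ->
  exists N, forall n, (N <= n)%N -> nm (psum a (z - w) n - f z) <= e.
Proof.
move=> [q0 M0 aM H] zq e0.
have M1 : 0 < 2 * M + 1 by lra.
have [|N hN] := @half_small (e / (2 * M + 1)); first by rewrite divr_gt0.
exists N => n Nn; rewrite (le_trans (H z zq n))//.
rewrite (le_trans (ler_wpM2l _ (hN n Nn))) ?mulr_ge0//.
by rewrite mulrA ler_pdivrMr// mulrC ler_wpM2l ?(ltW e0)//; lra.
Qed.

Lemma ps_widen a w f q M q' M' : ps a w f q M -> q <= q' -> M <= M' ->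
  ps a w f q' M'.
Proof.
move=> [q0 M0 aM H] qq MM; split; [exact: lt_le_trans qq|exact: le_trans MM| |].
  move=> k; rewrite (le_trans (aM k))// ler_pM ?exprn_ge0 ?(ltW q0)//.
  by rewrite lerXn2r// nnegrE ltW// (lt_le_trans q0).
move=> z zq n; rewrite (le_trans (H z _ n))//.
  rewrite (le_trans zq)// lef_pV2 ?posrE ?mulr_gt0//; last by rewrite (lt_le_trans q0).
  by rewrite ler_pM2l.
by rewrite ler_wpM2r ?exprn_ge0 ?invr_ge0// ler_pM2l.
Qed.

(** A larger [q] shrinks the disc until it lies where the two functions agree. *)
Lemma ps_near a w f g q M rho : ps a w f q M -> 0 < rho ->
  (forall z, nm (z - w) < rho -> f z = g z) -> exists q', ps a w g q' M.
Proof.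
move=> P rho0 fg; have [q0 M0 aM H] := P.
exists (Num.max q rho^-1).
have qm : q <= Num.max q rho^-1 by rewrite le_max lexx.
have rm : rho^-1 <= Num.max q rho^-1 by rewrite le_max lexx orbT.
have [q'0 _ aM' H'] := ps_widen P qm (lexx M).
split=> // z zq n; rewrite -fg ?H'//.
rewrite (le_lt_trans zq)// invf_plt ?posrE ?mulr_gt0//.
rewrite (le_lt_trans rm)// ltr_pMl// ltr1n//.
Qed.

Lemma ps_center a w f q M : ps a w f q M -> f w = a 0%N.
Proof.
move=> [q0 M0 aM H]; apply/eqP; rewrite eq_sym -subr_eq0 -nm_eq0; apply/eqP.
apply: (@half_eq0 _ (2 * M)) => [|n]; first exact: nm_ge0.
have := H w _ n.+1; rewrite subrr nm0 invr_ge0 mulr_ge0 ?(ltW q0)//.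
rewrite /psum big_ord_recl expr0 mulr1 big1 ?addr0.
  move=> /(_ isT)/le_trans; apply; rewrite ler_wpM2l ?mulr_ge0//.
  by rewrite exprS ler_piMl ?exprn_ge0 ?invr_ge0// invf_le1// ler1n.
by move=> i _; rewrite exprS mul0r mulr0.
Qed.

(** Completeness of [R], applied to the real and to the imaginary part of the
    partial sums. *)
Lemma ps_exists a w q M : 0 < q -> 0 <= M -> (forall k, nm (a k) <= M * q ^+ k) ->
  exists f, ps a w f q M.
Proof.
move=> q0 M0 aM.
have lim (g : R[i] -> R) : (forall z, `|g z| <= nm z) ->
    {morph g : x y / x + y} -> g 0 = 0 ->
    forall z, nm (z - w) <= (2 * q)^-1 -> exists l : R, forall e, 0 < e ->
     exists N, forall n, (N <= n)%N -> `|g (psum a (z - w) n) - l| <= e.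
  move=> gn gD g0 z zq.
  pose t k := g (a k * (z - w) ^+ k).
  have cv : cvgn (series t).
    apply: normed_cvg.
    apply: (@series_le_cvg _ _ (fun k => M * 2^-1 ^+ k)) => [n|n|n|].
    - by rewrite normr_ge0.
    - by rewrite mulr_ge0 ?exprn_ge0 ?invr_ge0.
    - by rewrite (le_trans (gn _))// (term_bound n q0).
    by apply: is_cvg_geometric_series; rewrite ger0_norm; lra.
  exists (limn (series t)) => e e0.
  have /cvgrPdist_le/(_ e e0)[N _ hN] := cv.
  exists N => n Nn; rewrite distrC; have := hN n Nn.
  rewrite /series/= big_mkord /psum.
  rewrite (_ : g _ = \sum_(k < n) t k)//.
  by rewrite (big_morph g gD g0).
have /choice[fr hr] : forall z, exists l : R, nm (z - w) <= (2 * q)^-1 -> forall e, 0 < e ->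
     exists N, forall n, (N <= n)%N -> `|complex.Re (psum a (z - w) n) - l| <= e.
  move=> z; have [zq|] := leP (nm (z - w)) (2 * q)^-1; last by exists 0.
  have [|||l hl] := lim (@complex.Re R) _ _ _ z zq; last by exists l.
  - exact: nm_Re.
  - by move=> [? ?] [? ?].
  - by [].
have /choice[fi hi] : forall z, exists l : R, nm (z - w) <= (2 * q)^-1 -> forall e, 0 < e ->
     exists N, forall n, (N <= n)%N -> `|complex.Im (psum a (z - w) n) - l| <= e.
  move=> z; have [zq|] := leP (nm (z - w)) (2 * q)^-1; last by exists 0.
  have [|||l hl] := lim (@complex.Im R) _ _ _ z zq; last by exists l.
  - exact: nm_Im.
  - by move=> [? ?] [? ?].
  - by [].
exists (fun z => fr z +i* fi z).
apply: ps_of_cvg => // z zq e e0.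
have e20 : 0 < e / 2 by rewrite divr_gt0.
have [N hN] := hr z zq _ e20; have [N' hN'] := hi z zq _ e20.
exists (maxn N N') => n; rewrite geq_max => /andP[/hN Hr /hN' Hi].
rewrite (le_trans (nm_ReIm _))// [leRHS]splitr.
by case: (psum _ _ _) Hr Hi => s t /= Hr Hi; rewrite lerD.
Qed.

Lemma ps_cst c w : ps (fun k => if k == 0%N then c else 0) w (fun=> c) 1 (nm c).
Proof.
apply: ps_of_cvg => // [|k|z zq e e0]; first exact: nm_ge0.
  by rewrite expr1n mulr1; case: eqP; rewrite ?nm0 ?nm_ge0.
exists 1%N => -[//|n] _; rewrite /psum big_ord_recl/= expr0 mulr1 big1 ?addr0.
  by rewrite subrr nm0 ltW.
by move=> i _; rewrite mul0r.
Qed.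

Lemma ps_id w : ps (fun k => if k == 0%N then w else (k == 1%N)%:R) w id 1 (nm w + 1).
Proof.
apply: ps_of_cvg => // [|k|z zq e e0]; first by rewrite addr_ge0 ?nm_ge0.
  rewrite expr1n mulr1; case: eqP => _; first by rewrite lerDl.
  by rewrite nm_nat; case: eqP => _; rewrite ?lerDr ?nm_ge0// addr_ge0 ?nm_ge0.
exists 2%N => -[//|[//|n]] _; rewrite /psum !big_ord_recl/=.
rewrite big1; last by move=> i _; rewrite mul0r.
by rewrite [X in nm X](_ : _ = 0) ?nm0 ?ltW//; ring.
Qed.

Lemma psumD a b u n : psum (fun k => a k + b k) u n = psum a u n + psum b u n.
Proof. by rewrite /psum -big_split; apply: eq_bigr => i _; rewrite mulrDl. Qed.

Lemma psumZ c b u n : psum (fun k => c * b k) u n = c * psum b u n.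
Proof. by rewrite /psum mulr_sumr; apply: eq_bigr => i _; rewrite mulrA. Qed.

Lemma psD a b w f g q M M' : ps a w f q M -> ps b w g q M' ->
  ps (fun k => a k + b k) w (fun z => f z + g z) q (M + M').
Proof.
move=> [q0 M0 aM H] [_ M'0 bM H']; split=> // [|k|z zq n]; first by rewrite addr_ge0.
  by rewrite (le_trans (nmD _ _))// mulrDl lerD.
rewrite psumD opprD addrACA (le_trans (nmD _ _))//.
by rewrite mulrDr mulrDl lerD ?H ?H'.
Qed.

Lemma psZ c a w f q M : ps a w f q M ->
  ps (fun k => c * a k) w (fun z => c * f z) q (nm c * M).
Proof.
move=> [q0 M0 aM H]; split=> // [|k|z zq n]; first by rewrite mulr_ge0 ?nm_ge0.
  by rewrite nmM -mulrA ler_wpM2l ?nm_ge0.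
by rewrite psumZ -mulrBr nmM mulrCA -mulrA ler_wpM2l ?nm_ge0// H.
Qed.

Lemma leq_succ_exp2 k : k.+1%:R <= (2 : R) ^+ k.
Proof.
elim: k => [|k ih]; first by rewrite expr0.
rewrite exprS; have : (1 : R) <= 2 ^+ k by rewrite exprn_ege1// ler1n.
by rewrite -(addn1 k.+1) natrD; lra.
Qed.

Definition conv a b k : R[i] := \sum_(i < k.+1) a i * b (k - i)%N.

Lemma conv_bound a b q M M' k : (forall k, nm (a k) <= M * q ^+ k) ->
  (forall k, nm (b k) <= M' * q ^+ k) -> 0 <= M -> 0 <= M' ->
  nm (conv a b k) <= M * M' * (k.+1%:R * q ^+ k).
Proof.
move=> aM bM M0 M'0; rewrite (le_trans (nm_sum _ _ _))//.
rewrite (@le_trans _ _ (\sum_(i < k.+1) M * M' * q ^+ k))//; last first.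
  by rewrite sumr_const card_ord -mulr_natl; lra.
apply: ler_sum => i _; rewrite nmM.
rewrite (le_trans (ler_pM (nm_ge0 _) (nm_ge0 _) (aM i) (bM _)))//.
by rewrite mulrACA -exprD subnKC// -ltnS.
Qed.

(** As polynomials the two sides have the same coefficients below order [n];
    the coefficients above are convolutions of truncated sequences, hence
    small on the disc of radius [1 / (4 q)]. *)
Lemma psum_conv a b u q M M' n : 0 < q -> 0 <= M -> 0 <= M' ->
  (forall k, nm (a k) <= M * q ^+ k) -> (forall k, nm (b k) <= M' * q ^+ k) ->
  nm u <= (4 * q)^-1 ->
  nm (psum a u n * psum b u n - psum (conv a b) u n) <= 2 * M * M' * 2^-1 ^+ n.
Proof.
move=> q0 M0 M'0 aM bM uq.
have uq1 : nm u * q <= 2^-1 * 2^-1.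
  by move: uq; rewrite -(ler_pM2r q0) invfM mulfVK ?gt_eqF//; lra.
pose A := \poly_(i < n) a i; pose B := \poly_(i < n) b i.
have EA : psum a u n = A.[u] by rewrite horner_poly.
have EB : psum b u n = B.[u] by rewrite horner_poly.
have szAB : (size (A * B)%R <= n + n)%N.
  rewrite (leq_trans (size_polyMleq _ _))// (leq_trans (leq_pred _))//.
  by rewrite leq_add// size_poly.
pose a' i := coefp i A; pose b' i := coefp i B.
have a'M k : nm (a' k) <= M * q ^+ k.
  rewrite /a' /= coef_poly; case: ifP => // _; rewrite nm0 mulr_ge0// exprn_ge0// ltW//.
have b'M k : nm (b' k) <= M' * q ^+ k.
  rewrite /b' /= coef_poly; case: ifP => // _; rewrite nm0 mulr_ge0// exprn_ge0// ltW//.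
rewrite EA EB -hornerM (horner_coef_wide _ szAB) /psum big_split_ord/=.
rewrite (eq_bigr (fun k : 'I_n => conv a b k * u ^+ k)); last first.
  move=> k _; rewrite coefM /conv; congr (_ * _); apply: eq_bigr => i _.
  rewrite !coef_poly (leq_ltn_trans _ (ltn_ord k)) ?(leq_ltn_trans (leq_subr _ _))//.
  by rewrite -ltnS.
rewrite [X in nm (X - _)]addrC addrK (le_trans (nm_sum _ _ _))//.
rewrite (@le_trans _ _ (\sum_(i < n) M * M' * 2^-1 ^+ n * 2^-1 ^+ i))//; last first.
  rewrite -mulr_sumr half_geo -!mulrA [leRHS]mulrC !mulrA.
  rewrite ler_wpM2l ?mulr_ge0 ?exprn_ge0 ?invr_ge0//.
  by rewrite gerBl mulr_ge0 ?exprn_ge0 ?invr_ge0.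
apply: ler_sum => i _; rewrite -mulrA -exprD nmM nmX coefM.
rewrite (le_trans (ler_wpM2r (exprn_ge0 _ (nm_ge0 _)) (conv_bound _ a'M b'M M0 M'0)))//.
rewrite -!mulrA ler_wpM2l// ler_wpM2l// -exprMn [q * _]mulrC.
rewrite (le_trans (ler_pM _ _ (leq_succ_exp2 _) (lerXn2r _ _ _ uq1)))//.
- by rewrite exprn_ge0// mulr_ge0 ?nm_ge0// ltW.
- by rewrite nnegrE mulr_ge0 ?nm_ge0// ltW.
- by rewrite nnegrE; lra.
by rewrite -exprMn mulrA divff// mul1r.
Qed.

Lemma cvg_mul_estimate (s t : nat -> R[i]) (x y : R[i]) :
  (forall e, 0 < e -> exists N, forall n, (N <= n)%N -> nm (s n - x) <= e) ->
  (forall e, 0 < e -> exists N, forall n, (N <= n)%N -> nm (t n - y) <= e) ->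
  (forall e, 0 < e -> exists N, forall n, (N <= n)%N -> nm (s n * t n - x * y) <= e).
Proof.
move=> hs ht e e0.
have y0 := nm_ge0 y; have x0 := nm_ge0 x.
pose d := Num.min 1 (e / (nm x + nm y + 1)).
have d0 : 0 < d by rewrite lt_min ltr01 divr_gt0//; lra.
have [d1 d2] : d <= 1 /\ d * (nm x + nm y + 1) <= e.
  split; first by rewrite ge_min lexx.
  by rewrite -ler_pdivlMr ?ge_min ?lexx ?orbT//; lra.
have [N hN] := hs d d0; have [N' hN'] := ht d d0.
exists (maxn N N') => n; rewrite geq_max => /andP[/hN Hs /hN' Ht].
have -> : s n * t n - x * y = (s n - x) * (t n - y) + (s n - x) * y + x * (t n - y).
  by ring.
rewrite (le_trans (nmD _ _))// (le_trans (lerD (nmD _ _) (lexx _)))// !nmM.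
have := nm_ge0 (s n - x); have := nm_ge0 (t n - y); nra.
Qed.

(** The rate doubles because a convolution of order [k] has [k + 1] terms, at
    most [2 ^+ k]. *)
Lemma psM a b w f g q M M' : ps a w f q M -> ps b w g q M' ->
  ps (conv a b) w (fun z => f z * g z) (2 * q) (M * M').
Proof.
move=> P P'; have [q0 M0 aM H] := P; have [_ M'0 bM H'] := P'.
apply: ps_of_cvg => [||k|z zq e e0]; rewrite ?mulr_gt0 ?mulr_ge0//.
  rewrite (le_trans (conv_bound _ aM bM M0 M'0))// ler_wpM2l ?mulr_ge0//.
  by rewrite exprMn ler_wpM2r ?exprn_ge0 ?(ltW q0)// leq_succ_exp2.
have zq' : nm (z - w) <= (2 * q)^-1.
  rewrite (le_trans zq)// lef_pV2 ?posrE ?mulr_gt0// ler_pM2l//; lra.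
have e20 : 0 < e / 2 by rewrite divr_gt0.
have [N hN] := cvg_mul_estimate (fun e => ps_cvg P zq' (e := e))
  (fun e => ps_cvg P' zq' (e := e)) e20.
have MM : 0 < 2 * M * M' + 1 by have := mulr_ge0 M0 M'0; lra.
have [|N' hN'] := @half_small (e / 2 / (2 * M * M' + 1)); first by rewrite divr_gt0.
exists (maxn N N') => n; rewrite geq_max => /andP[/hN Hs /hN' Ht].
have zq4 : nm (z - w) <= (4 * q)^-1.
  by rewrite (le_trans zq)// mulrA (_ : 2 * 2 = 4 :> R) //; ring.
have K := psum_conv n q0 M0 M'0 aM bM zq4; rewrite nm_dist in K.
have := nm_tri (psum (conv a b) (z - w) n) (psum a (z - w) n * psum b (z - w) n)
  (f z * g z).
have K2 : 2 * M * M' * 2^-1 ^+ n <= e / 2.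
  rewrite (le_trans (ler_wpM2l _ Ht)) ?mulr_ge0//.
  rewrite mulrA ler_pdivrMr// mulrC ler_wpM2l ?(ltW e20)//; lra.
lra.
Qed.

Section Inverse.
Variable a : nat -> R[i].

Fixpoint inv_coefs n : seq R[i] :=
  if n is m.+1 then
    let s := inv_coefs m in
    rcons s ((a 0)^-1 * ((m == 0)%:R - \sum_(i < m) a i.+1 * seq.nth 0 s (m - i.+1)))
  else [::].

(** Coefficients of the reciprocal series, determined recursively by the
    requirement that the convolution with [a] be [1, 0, 0, ...] ([conv_inv]). *)
Definition inv_coef k := seq.nth 0 (inv_coefs k.+1) k.

Lemma size_inv_coefs n : size (inv_coefs n) = n.
Proof. by elim: n => //= n ih; rewrite size_rcons ih. Qed.

Lemma nth_inv_coefs n k : (k < n)%N -> seq.nth 0 (inv_coefs n) k = inv_coef k.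
Proof.
elim: n => // n ih; rewrite ltnS leq_eqVlt => /orP[/eqP->//|kn] /=.
by rewrite nth_rcons size_inv_coefs kn ih.
Qed.

Lemma inv_coefE k : inv_coef k =
  (a 0)^-1 * ((k == 0)%:R - \sum_(i < k) a i.+1 * inv_coef (k - i.+1)).
Proof.
rewrite /inv_coef /= nth_rcons size_inv_coefs ltnn eqxx.
congr (_ * (_ - _)); apply: eq_bigr => i _; rewrite nth_inv_coefs//.
by rewrite ltn_subrL/= (leq_ltn_trans _ (ltn_ord i)).
Qed.

Lemma conv_inv k : a 0 != 0 -> conv a inv_coef k = (k == 0)%:R.
Proof.
move=> a0; rewrite /conv big_ord_recl subn0 inv_coefE mulrA divff// mul1r.
by rewrite subrK.
Qed.

(** Strong induction: the recursion for the next coefficient is a geometric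
    sum in [q] and [Q], of total at most [Q ^+ k.+1 * q / (Q - q)], and [Q] is
    chosen so that [M / nm (a 0) * q <= Q - q]. *)
Lemma inv_bound q M : 0 < q -> 0 <= M -> (forall k, nm (a k) <= M * q ^+ k) ->
  a 0 != 0 -> forall Q, q * (1 + M / nm (a 0)) <= Q ->
  forall k, nm (inv_coef k) <= (nm (a 0))^-1 * Q ^+ k.
Proof.
move=> q0 M0 aM a0 Q hQ k.
have n0 : 0 < nm (a 0) by rewrite nm_gt0.
have qQ : q <= Q by rewrite (le_trans _ hQ)// ler_peMr ?(ltW q0)// lerDl divr_ge0// ltW.
have Q0 : 0 < Q by exact: lt_le_trans qQ.
elim/ltn_ind: k => k ih; rewrite inv_coefE nmM nmV ler_wpM2l ?invr_ge0 ?nm_ge0//.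
case: k ih => [|k] ih; first by rewrite big_ord0 subr0 expr0 nm_nat.
rewrite sub0r nmN (le_trans (nm_sum _ _ _))//.
pose S m := \sum_(i < m) q ^+ i.+1 * Q ^+ (m - i.+1).
have SE m : (Q - q) * S m = q * Q ^+ m - q * q ^+ m.
  elim: m => [|m SE]; first by rewrite /S big_ord0 mulr0 !expr0 subrr.
  rewrite /S big_ord_recr/= subnn expr0 mulr1.
  rewrite (eq_bigr (fun i : 'I_m => Q * (q ^+ i.+1 * Q ^+ (m - i.+1)))); last first.
    by move=> i _; rewrite ?subSS -(subnSK (ltn_ord i)) [Q ^+ _.+1]exprS mulrCA.
  by rewrite -mulr_sumr mulrDr mulrCA -/(S m) SE !exprS; ring.
rewrite (@le_trans _ _ (M / nm (a 0) * S k.+1))//.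
  rewrite mulr_sumr; apply: ler_sum => i _; rewrite nmM.
  rewrite (le_trans (ler_pM (nm_ge0 _) (nm_ge0 _) (aM _) (ih _ _)))//.
    by rewrite ltn_subrL.
  by rewrite mulrACA.
have S0 : 0 <= S k.+1.
  by apply: sumr_ge0 => i _; rewrite mulr_ge0 ?exprn_ge0 ?(ltW Q0) ?(ltW q0).
have [M1|M1] := eqVneq M 0; first by rewrite M1 !mul0r; apply/exprn_ge0/ltW.
have Mp : 0 < M / nm (a 0) by rewrite divr_gt0// lt_def M1.
have : M / nm (a 0) * q <= Q - q by lra.
move=> /(ler_wpM2r S0); rewrite SE => K.
have q1 : 0 <= q * q ^+ k.+1 by rewrite mulr_ge0 ?exprn_ge0 ?(ltW q0).
rewrite -(ler_pM2l q0); lra.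
Qed.

End Inverse.

(** The partial sums of the reciprocal series are bounded and their products
    with [f z] tend to 1 geometrically; in particular [f z] does not vanish on
    the disc. *)
Lemma psV a w f q M : ps a w f q M -> f w != 0 ->
  exists b q' M', ps b w (fun z => (f z)^-1) q' M'.
Proof.
move=> P fw; have [q0 M0 aM H] := P; have a0 : a 0%N != 0 by rewrite -(ps_center P).
have n0 : 0 < nm (a 0%N) by rewrite nm_gt0.
have [Q hQ] : exists Q, q * (1 + M / nm (a 0%N)) <= Q.
  by exists (q * (1 + M / nm (a 0%N))).
pose B := (nm (a 0%N))^-1.
have B0 : 0 <= B by rewrite invr_ge0 nm_ge0.
have bB := inv_bound q0 M0 aM a0 hQ.
have qQ : q <= Q.
  by rewrite (le_trans _ hQ)// ler_peMr ?(ltW q0)// lerDl divr_ge0// ltW.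
have Q0 : 0 < Q by exact: lt_le_trans qQ.
have [_ _ aM' H'] := ps_widen P qQ (lexx M).
exists (inv_coef a), (2 * Q), B.
apply: ps_of_cvg => // [|k|z zq e e0]; first by rewrite mulr_gt0.
  rewrite (le_trans (bB k))// ler_wpM2l//.
  by apply: lerXn2r; [rewrite nnegrE ltW|rewrite nnegrE ltW// mulr_gt0|lra].
have zq' : nm (z - w) <= (2 * Q)^-1.
  rewrite (le_trans zq)// lef_pV2 ?posrE ?mulr_gt0// ler_pM2l//; lra.
have zq4 : nm (z - w) <= (4 * Q)^-1.
  by rewrite (le_trans zq)// mulrA (_ : 2 * 2 = 4 :> R) //; ring.
set s := psum a (z - w); set t := psum (inv_coef a) (z - w).
have tB n : nm (t n) <= 2 * B.
  have := psum_cauchy 0 n Q0 B0 bB zq'.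
  by rewrite add0n {2}/psum big_ord0 subr0 expr0 mulr1.
have one n : (0 < n)%N -> psum (conv a (inv_coef a)) (z - w) n = 1.
  case: n => // n _; rewrite /psum big_ord_recl conv_inv// expr0 mulr1 big1 ?addr0//.
  by move=> i _; rewrite conv_inv// mul0r.
pose K := 4 * M * B.
have K0 : 0 <= K by rewrite !mulr_ge0.
have est n : (0 < n)%N -> nm (f z * t n - 1) <= 2 * K * 2^-1 ^+ n.
  move=> n1; have := psum_conv n Q0 M0 B0 aM' bB zq4; rewrite one//.
  have := H' z zq' n; rewrite -/s -/t => e1 e2.
  have -> : f z * t n - 1 = (f z - s n) * t n + (s n * t n - 1) by ring.
  rewrite (le_trans (nmD _ _))// nmM nm_dist.
  have := ler_pM (nm_ge0 _) (nm_ge0 _) e1 (tB n).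
  have : 0 <= M * B * 2^-1 ^+ n by rewrite !mulr_ge0// exprn_ge0 ?invr_ge0.
  rewrite /K; move: e2; lra.
have fz : f z != 0.
  apply/eqP => fz0; have : 1 = 0 :> R; last by move/eqP; rewrite oner_eq0.
  apply: (@half_eq0 _ (2 * K)) => // n.
  have := est n.+1 isT; rewrite fz0 mul0r sub0r nmN nm1 exprS.
  have : 0 <= K * 2^-1 ^+ n by rewrite !mulr_ge0// exprn_ge0 ?invr_ge0.
  lra.
have fz0 : 0 < nm (f z) by rewrite nm_gt0.
have K1 : 0 < 2 * K + 1 by lra.
have [|N hN] := @half_small (e * nm (f z) / (2 * K + 1)).
  by rewrite divr_gt0// mulr_gt0.
exists N.+1 => n Nn.
rewrite -(ler_pM2r fz0) -nmM mulrBl mulVf// mulrC.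
rewrite (le_trans (est n (leq_trans _ Nn)))//.
rewrite (le_trans (ler_wpM2l _ (hN n (ltnW Nn)))) ?mulr_ge0//.
rewrite mulrA ler_pdivrMr// mulrC ler_wpM2l ?mulr_ge0 ?(ltW e0) ?(ltW fz0)//; lra.
Qed.

End PowerSeries.

(** * The complex exponential *)

Section ComplexExp.
Context {R : realType}.
Implicit Types (x y z w : R[i]) (e : R).

Lemma cexpE z : cexp z = (expR (complex.Re z))%:C * (cos (complex.Im z) +i* sin (complex.Im z)).
Proof. by []. Qed.

Lemma cexpD x y : cexp (x + y) = cexp x * cexp y.
Proof.
case: x y => [a b] [c d]; rewrite /cexp /= expRD cosD sinD.
rewrite (_ : (cos b * cos d - sin b * sin d) +i* (sin b * cos d + cos b * sin d) =
  (cos b +i* sin b) * (cos d +i* sin d)); first by rewrite rmorphM/=; ring.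
by simpc; congr (_ +i* _); ring.
Qed.

Lemma nm_cexp z : nm (cexp z) = expR (complex.Re z).
Proof.
rewrite /cexp nmM nmR ger0_norm ?expR_ge0//= cos2Dsin2 sqrtr1 mulr1//.
Qed.

Lemma cexp_real (x : R) : cexp x%:C = (expR x)%:C.
Proof. by rewrite /cexp /= cos0 sin0 mulr1. Qed.

Lemma cexp0 : cexp (0 : R[i]) = 1.
Proof. by rewrite (_ : 0 = (0 : R)%:C)// cexp_real expR0. Qed.

Lemma cexp_neq0 z : cexp z != 0.
Proof. by rewrite -nm_gt0 nm_cexp expR_gt0. Qed.

Lemma cexp_conj z : cexp (conjc z) = conjc (cexp z).
Proof.
case: z => a b; rewrite /cexp /= cosN sinN; simpc.
by [].
Qed.

Lemma series_expR_cvg (a : R) e : 0 < e -> exists N, forall n, (N <= n)%N ->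
  `|\sum_(k < n) exp_coeff a k - expR a| <= e.
Proof.
move=> e0; have := @is_cvg_series_exp_coeff R a.
move=> /cvgrPdist_le/(_ e e0)[N _ hN]; exists N => n Nn; rewrite distrC.
by have := hN n Nn; rewrite /expR /series/= big_mkord.
Qed.

Lemma series_cos_cvg (a : R) e : 0 < e -> exists N, forall n, (N <= n)%N ->
  `|\sum_(k < n) cos_coeff a k - cos a| <= e.
Proof.
move=> e0; have := @is_cvg_series_cos_coeff R a.
move=> /cvgrPdist_le/(_ e e0)[N _ hN]; exists N => n Nn; rewrite distrC.
by have := hN n Nn; rewrite cos.unlock /series/= big_mkord.
Qed.

Lemma series_sin_cvg (a : R) e : 0 < e -> exists N, forall n, (N <= n)%N ->
  `|\sum_(k < n) sin_coeff a k - sin a| <= e.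
Proof.
move=> e0; have := @is_cvg_series_sin_coeff R a.
move=> /cvgrPdist_le/(_ e e0)[N _ hN]; exists N => n Nn; rewrite distrC.
by have := hN n Nn; rewrite sin.unlock /series/= big_mkord.
Qed.

Lemma imX (b : R) k : ('i * b%:C) ^+ k =
  (((~~ odd k)%:R * (-1) ^+ k./2 * b ^+ k) +i* ((odd k)%:R * (-1) ^+ k.-1./2 * b ^+ k)) :> R[i].
Proof.
have E2 m : ('i * b%:C) ^+ m.*2 = ((-1) ^+ m * b ^+ m.*2)%:C :> R[i].
  rewrite -mul2n !exprM (_ : ('i * b%:C) ^+ 2 = (- b ^+ 2)%:C); last first.
    by rewrite expr2 [b ^+ 2]expr2; simpc.
  by rewrite -exprNn rmorphXn.
rewrite -{1}(odd_double_half k); case: (boolP (odd k)) => ok /=; last first.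
  rewrite add0n E2 mul1r !mul0r; congr (_ * _ +i* _).
  by rewrite -{2}(odd_double_half k) (negbTE ok).
rewrite add1n exprS E2 !mul0r mul1r.
have ek : k = (k./2).*2.+1 by rewrite -{1}(odd_double_half k) ok.
rewrite {3 4}ek /= doubleK exprS; simpc; congr (_ +i* _).
by rewrite mulrCA.
Qed.

Lemma series_cis_cvg (b : R) e : 0 < e -> exists N, forall n, (N <= n)%N ->
  nm (\sum_(k < n) ('i * b%:C) ^+ k / k`!%:R - (cos b +i* sin b)) <= e.
Proof.
move=> e0; have e20 : 0 < e / 2 by rewrite divr_gt0.
have [N hN] := series_cos_cvg b e20; have [N' hN'] := series_sin_cvg b e20.
exists (maxn N N') => n; rewrite geq_max => /andP[/hN Hr /hN' Hi].
have -> : \sum_(k < n) ('i * b%:C) ^+ k / k`!%:R =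
    (\sum_(k < n) cos_coeff b k) +i* (\sum_(k < n) sin_coeff b k) :> R[i].
  elim: (n) => [|m ih]; first by rewrite !big_ord0.
  rewrite !big_ord_recr/= ih imX -(rmorph_nat (real_complex R)) -fmorphV.
  by simpc; congr (_ +i* _).
by rewrite (le_trans (nm_ReIm _))// [leRHS]splitr /= lerD.
Qed.

(** A single term of the exponential series of [4 * `|a|] is at most its sum. *)
Lemma exp_term_bound (a : R) k : `|a| ^+ k / k`!%:R <= expR (4 * `|a|) * 4^-1 ^+ k.
Proof.
have a4 : 0 <= 4 * `|a| by rewrite mulr_ge0.
suff H : (4 * `|a|) ^+ k / k`!%:R <= expR (4 * `|a|).
  rewrite -ler_pdivrMr ?exprn_gt0 ?invr_gt0// -exprVn invrK.
  by rewrite mulrAC -exprMn mulrC [_ * 4]mulrC mulrC.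
apply/ler_addgt0Pr => e e0.
have [N hN] := series_expR_cvg (4 * `|a|) e0.
have := hN (N + k.+1)%N (leq_addr _ _); rewrite ler_distl => /andP[_].
apply: le_trans.
have kN : (k < N + k.+1)%N by rewrite addnS ltnS leq_addl.
rewrite (bigD1 (Ordinal kN))//= lerDl sumr_ge0// => i _.
exact: exp_coeff_ge0.
Qed.

(** The series of the real exponential and of [cos + i sin] are multiplied; by
    the binomial theorem the Cauchy product of the two is the exponential
    series of [s + i t]. *)
Lemma series_cexp_cvg z e : 0 < e -> exists N, forall n, (N <= n)%N ->
  nm (psum (fun k => (k`!%:R)^-1) z n - cexp z) <= e.
Proof.
move=> e0.
case: z => s t.
pose a k : R[i] := (s ^+ k / k`!%:R)%:C.
pose b k : R[i] := ('i * t%:C) ^+ k / k`!%:R.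
have aM k : nm (a k) <= expR (4 * `|s|) * 4^-1 ^+ k.
  by rewrite nmR normrM normfV normrX normr_nat exp_term_bound.
have bM k : nm (b k) <= expR (4 * `|t|) * 4^-1 ^+ k.
  by rewrite nmM nmX nmM nmi nmR mul1r nmV nm_nat exp_term_bound.
have e20 : 0 < e / 2 by rewrite divr_gt0.
have hs e' : 0 < e' -> exists N, forall n, (N <= n)%N ->
    nm (psum a 1 n - (expR s)%:C) <= e'.
  move=> e'0; have [N hN] := series_expR_cvg s e'0; exists N => n /hN.
  rewrite /psum (_ : \sum_(k < n) _ = (\sum_(k < n) exp_coeff s k)%:C).
    by rewrite -rmorphB nmR.
  by rewrite rmorph_sum; apply: eq_bigr => i _; rewrite expr1n mulr1.
have ht e' : 0 < e' -> exists N, forall n, (N <= n)%N ->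
    nm (psum b 1 n - (cos t +i* sin t)) <= e'.
  move=> e'0; have [N hN] := series_cis_cvg t e'0; exists N => n /hN.
  by rewrite /psum; under [X in _ -> nm (X - _) <= _]eq_bigr do rewrite expr1n mulr1.
have [N hN] := cvg_mul_estimate hs ht e20.
pose M := expR (4 * `|s|); pose M' := expR (4 * `|t|).
have [M0 M'0] : 0 <= M /\ 0 <= M' by rewrite !expR_ge0.
have u1 : nm (1 : R[i]) <= (4 * 4^-1)^-1 by rewrite nm1 divff// invr1.
have MM : 0 < 2 * M * M' + 1 by have := mulr_ge0 M0 M'0; lra.
have [|N' hN'] := @half_small R (e / 2 / (2 * M * M' + 1)); first by rewrite divr_gt0.
exists (maxn N N') => n; rewrite geq_max => /andP[/hN Hs /hN' Ht].
have q40 : 0 < (4^-1 : R) by rewrite invr_gt0.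
have K := psum_conv n q40 M0 M'0 aM bM u1; rewrite nm_dist in K.
have K2 : 2 * M * M' * 2^-1 ^+ n <= e / 2.
  rewrite (le_trans (ler_wpM2l _ Ht)) ?mulr_ge0//.
  rewrite mulrA ler_pdivrMr// mulrC ler_wpM2l ?(ltW e20)//; lra.
have E : psum (fun k => (k`!%:R)^-1) (s +i* t) n = psum (conv a b) 1 n.
  apply: eq_bigr => k _; rewrite expr1n mulr1 /conv.
  have -> : s +i* t = s%:C + 'i * t%:C by simpc.
  rewrite addrC exprDn mulr_sumr; apply: eq_bigr => i _; rewrite /a /b.
  have ik : (i <= k)%N by rewrite -ltnS.
  rewrite rmorphM fmorphV rmorph_nat rmorphXn/=.
  have f0 m : (m`!%:R : R[i]) != 0 by rewrite pnatr_eq0 -lt0n fact_gt0.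
  have B : ('C(k, i)%:R : R[i]) = k`!%:R / (i`!%:R * (k - i)`!%:R).
    by rewrite -(bin_fact ik) !natrM mulfK ?mulf_neq0.
  rewrite -[_ *+ 'C(k, i)]mulr_natr B; field.
  by rewrite !f0.
rewrite E.
have := nm_tri (psum (conv a b) 1 n) (psum a 1 n * psum b 1 n) (cexp (s +i* t)).
by move: Hs; rewrite cexpE /=; lra.
Qed.

Lemma ps_cexp (L : R[i]) w :
  ps (fun k => cexp (w * L) * (L ^+ k / k`!%:R)) w (fun z => cexp (z * L))
    (nm L + 1) (nm (cexp (w * L))).
Proof.
have n0 := nm_ge0 L.
apply: ps_of_cvg => [||k|z zq e e0]; first by lra.
- exact: nm_ge0.
- rewrite nmM ler_wpM2l ?nm_ge0// nmM nmX nmV nm_nat.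
  rewrite (@le_trans _ _ (nm L ^+ k))//; last by apply: lerXn2r; rewrite ?nnegrE; lra.
  rewrite ler_pdivrMr ?ltr0n ?fact_gt0// ler_peMr ?exprn_ge0// ler1n fact_gt0//.
have c0 : 0 < nm (cexp (w * L)) by rewrite nm_cexp expR_gt0.
have e'0 : 0 < e / nm (cexp (w * L)) by rewrite divr_gt0.
have [N hN] := series_cexp_cvg ((z - w) * L) e'0.
exists N => n /hN; rewrite ler_pdivlMr// mulrC -nmM => H.
rewrite (le_trans _ H)// mulrBr -cexpD.
rewrite (_ : w * L + (z - w) * L = z * L); last by ring.
rewrite /psum mulr_sumr (eq_bigr (fun k : 'I_n => cexp (w * L) * (k`!%:R^-1 * ((z - w) * L) ^+ k)))//.
by move=> k _; rewrite exprMn; ring.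
Qed.

End ComplexExp.

(** * Analytic functions *)

Section Analytic.
Context {R : realType}.
Implicit Types (x y z w p u v c : R[i]) (f g h F Phi : R[i] -> R[i])
  (a b : nat -> R[i]) (q M e rho : R).

Definition analytic f w := exists a q M, ps a w f q M.

Lemma analytic_near f g w rho : 0 < rho ->
  (forall z, nm (z - w) < rho -> f z = g z) -> analytic f w -> analytic g w.
Proof.
move=> rho0 fg [a [q [M P]]]; have [q' P'] := ps_near P rho0 fg.
by exists a, q', M.
Qed.

Lemma analytic_ext f g w : f =1 g -> analytic f w -> analytic g w.
Proof. by move=> fg; apply: (@analytic_near _ _ _ 1) => // z _; exact: fg. Qed.

Lemma analytic_cst c w : analytic (fun=> c) w.
Proof. by do 3 eexists; exact: ps_cst. Qed.

Lemma analytic_id w : analytic id w.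
Proof. by do 3 eexists; exact: ps_id. Qed.

Lemma analytic_cexp L w : analytic (fun z => cexp (z * L)) w.
Proof. by do 3 eexists; exact: ps_cexp. Qed.

Lemma analyticD f g w : analytic f w -> analytic g w ->
  analytic (fun z => f z + g z) w.
Proof.
move=> [a [q [M P]]] [b [q' [M' P']]].
have P1 := @ps_widen _ _ _ _ _ _ (Num.max q q') M P ltac:(by rewrite le_max lexx) (lexx _).
have P2 := @ps_widen _ _ _ _ _ _ (Num.max q q') M' P' ltac:(by rewrite le_max lexx orbT) (lexx _).
by do 3 eexists; exact: psD P1 P2.
Qed.

Lemma analyticM f g w : analytic f w -> analytic g w ->
  analytic (fun z => f z * g z) w.
Proof.
move=> [a [q [M P]]] [b [q' [M' P']]].
have P1 := @ps_widen _ _ _ _ _ _ (Num.max q q') M P ltac:(by rewrite le_max lexx) (lexx _).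
have P2 := @ps_widen _ _ _ _ _ _ (Num.max q q') M' P' ltac:(by rewrite le_max lexx orbT) (lexx _).
by do 3 eexists; exact: psM P1 P2.
Qed.

Lemma analyticN f w : analytic f w -> analytic (fun z => - f z) w.
Proof.
move=> Af; apply: analytic_ext (analyticM (analytic_cst (-1) w) Af) => z.
by rewrite mulN1r.
Qed.

Lemma analyticB f g w : analytic f w -> analytic g w ->
  analytic (fun z => f z - g z) w.
Proof. by move=> Af /analyticN; exact: analyticD. Qed.

Lemma analyticX f w n : analytic f w -> analytic (fun z => f z ^+ n) w.
Proof.
move=> Af; elim: n => [|n ih].
  by apply: analytic_ext (analytic_cst 1 w) => z; rewrite expr0.
by apply: analytic_ext (analyticM Af ih) => z; rewrite exprS.
Qed.

Lemma analytic_sum (I : Type) (r : seq I) (F : I -> R[i] -> R[i]) w :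
  (forall i, analytic (F i) w) -> analytic (fun z => \sum_(i <- r) F i z) w.
Proof.
move=> AF; elim: r => [|i r ih].
  by apply: analytic_ext (analytic_cst 0 w) => z; rewrite big_nil.
by apply: analytic_ext (analyticD (AF i) ih) => z; rewrite big_cons.
Qed.

Lemma analyticV f w : analytic f w -> f w != 0 -> analytic (fun z => (f z)^-1) w.
Proof. by move=> [a [q [M P]]] fw; exact: psV P fw. Qed.

(** The quotient by [(z - w) ^+ m] of the remainder of order [m] extends over
    [w] as the series of the remaining coefficients. *)
Lemma ps_shift a w f q M m : ps a w f q M ->
  ps (fun k => a (k + m)%N) w
    (fun z => if z == w then a m else (f z - psum a (z - w) m) / (z - w) ^+ m)
    q (M * q ^+ m).
Proof.
move=> P; have [q0 M0 aM H] := P.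
apply: ps_of_cvg => // [||z zq e e0].
- by rewrite mulr_ge0// exprn_ge0// ltW.
- by move=> k; rewrite -mulrA -exprD addnC.
have [->|zw] := eqVneq z w.
  exists 1%N => -[//|n] _; rewrite /psum big_ord_recl/= expr0 mulr1 add0n big1.
    by rewrite addr0 subrr nm0 ltW.
  by move=> i _; rewrite subrr exprS mul0r mulr0.
have u0 : (z - w) ^+ m != 0 by rewrite expf_neq0// subr_eq0.
have nu0 : 0 < nm ((z - w) ^+ m) by rewrite nm_gt0.
have e'0 : 0 < e * nm ((z - w) ^+ m) by rewrite mulr_gt0.
have [N hN] := ps_cvg P zq e'0.
exists N => n Nn; rewrite -(ler_pM2r nu0) -nmM mulrBl mulfVK//.
have := hN (m + n)%N (leq_trans Nn (leq_addl _ _)).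
rewrite {1}/psum big_split_ord/= -/(psum a (z - w) m).
rewrite (_ : psum _ _ n * _ = \sum_(i < n) a (m + i)%N * (z - w) ^+ (m + i)).
  by rewrite opprB addrA [_ + psum _ _ _]addrC.
rewrite /psum mulr_suml; apply: eq_bigr => i _.
by rewrite -mulrA -exprD addnC.
Qed.

Lemma ps_lipschitz a w f q M z : ps a w f q M -> nm (z - w) <= (2 * q)^-1 ->
  nm (f z - a 0%N) <= 2 * M * q * nm (z - w).
Proof.
move=> P zq; have [->|zw] := eqVneq z w.
  by rewrite (ps_center P) !subrr nm0 mulr0.
have [_ _ _ /(_ z zq 0%N)] := ps_shift 1 P.
rewrite (negbTE zw) {1}/psum big_ord0 sub0r nmN expr0 mulr1 expr1.
have u0 : 0 < nm (z - w) by rewrite nm_gt0 subr_eq0.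
rewrite nmM nmV ler_pdivrMr// mulrA.
by rewrite /psum big_ord1 expr0 mulr1.
Qed.

Lemma analytic_lip f w : analytic f w -> exists2 rho, 0 < rho & exists2 K, 0 < K &
  forall z, nm (z - w) < rho -> nm (f z - f w) <= K * nm (z - w).
Proof.
move=> [a [q [M P]]]; have [q0 M0 _ _] := P.
exists (2 * q)^-1; first by rewrite invr_gt0 mulr_gt0.
exists (2 * M * q + 1); first by rewrite ltr_wpDl// !mulr_ge0// ltW.
move=> z /ltW zq; rewrite (ps_center P) (le_trans (ps_lipschitz P zq))//.
by rewrite ler_wpM2r ?nm_ge0// lerDl.
Qed.

Lemma analytic_neq0 f w : analytic f w -> f w != 0 ->
  exists2 rho, 0 < rho & forall z, nm (z - w) < rho -> f z != 0.
Proof.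
move=> /analytic_lip[rho rho0 [K K0 H]] fw.
have fw0 : 0 < nm (f w) by rewrite nm_gt0.
exists (Num.min rho (nm (f w) / K)); first by rewrite lt_min rho0 divr_gt0.
move=> z; rewrite lt_min => /andP[zr]; rewrite ltr_pdivlMr// => zK.
apply/eqP => fz; have := H z zr; rewrite fz sub0r nmN; lra.
Qed.

(** By continuity the constant coefficient is a limit of values at points
    other than [w], hence zero; after division by [z - w] the same applies to
    the next one. *)
Lemma ps_punctured0 a w f q M rho : ps a w f q M -> 0 < rho ->
  (forall z, z != w -> nm (z - w) < rho -> f z = 0) -> forall k, a k = 0.
Proof.
move=> P rho0 f0.
have base b g q' M' : ps b w g q' M' ->
    (forall z, z != w -> nm (z - w) < rho -> g z = 0) -> b 0%N = 0.
  move=> P' g0; have [q0 M0 _ _] := P'.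
  apply: eq_nm_le => e e0; rewrite subr0.
  pose K := 2 * M' * q' + 1.
  have K0 : 0 < K by rewrite ltr_wpDl// !mulr_ge0// ltW.
  pose d := Num.min (Num.min (2 * q')^-1 (rho / 2)) (e / K).
  have d0 : 0 < d by rewrite !lt_min invr_gt0 !divr_gt0// !mulr_gt0.
  have nz : nm (w + d%:C - w) = d by rewrite addrC addKr nmR gtr0_norm.
  have := @ps_lipschitz b w g q' M' (w + d%:C) P'; rewrite nz.
  rewrite {1}/d !ge_min lexx/= => /(_ isT).
  rewrite g0 ?nz; last 2 first.
  - by rewrite -subr_eq0 -nm_eq0 nz gt_eqF.
  - rewrite (@le_lt_trans _ _ (rho / 2))//; last by lra.
    by rewrite /d !ge_min lexx orbT.
  rewrite sub0r nmN => /le_trans; apply.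
  have dK : d * K <= e by rewrite -ler_pdivlMr// /d ge_min lexx orbT.
  by rewrite (le_trans _ dK)// mulrC ler_wpM2l ?(ltW d0)// lerDl.
move=> k; elim/ltn_ind: k => k ih.
have P' := ps_shift k P.
apply: (base _ _ _ _ P') => z zw zr; rewrite (negbTE zw) f0//.
rewrite /psum big1 ?subrr ?mul0r// => i _; rewrite ih ?mul0r//.
Qed.

(** Second-order Taylor bound for monomials; summed against the coefficients,
    it shows that the termwise antiderivative of a power series is a
    primitive. *)
Lemma pow_diff2 u v rho n : 0 <= rho -> nm u <= rho -> nm v <= rho ->
  nm (u ^+ n.+2 - v ^+ n.+2 - n.+2%:R * v ^+ n.+1 * (u - v)) <=
  n.+1%:R ^+ 2 * rho ^+ n * nm (u - v) ^+ 2.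
Proof.
move=> r0 ur vr; elim: n => [|n ih].
  rewrite !expr1n expr1 expr0 !mul1r -nmX.
  by rewrite (_ : _ - _ - _ = (u - v) ^+ 2) //; ring.
have vn : nm (v ^+ n.+1) <= rho ^+ n.+1.
  by rewrite nmX; apply: lerXn2r; rewrite ?nnegrE ?nm_ge0.
have -> : u ^+ n.+3 - v ^+ n.+3 - n.+3%:R * v ^+ n.+2 * (u - v) =
    u * (u ^+ n.+2 - v ^+ n.+2 - n.+2%:R * v ^+ n.+1 * (u - v))
    + n.+2%:R * v ^+ n.+1 * (u - v) ^+ 2.
  by rewrite !exprS -(addn1 n.+2) natrD; ring.
rewrite (le_trans (nmD _ _))// (nmM u) (nmM _ ((u - v) ^+ 2)) (nmM n.+2%:R) nm_nat.
have h1 := ler_pM (nm_ge0 _) (nm_ge0 _) ur ih.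
set D := nm (u - v) ^+ 2 in h1 *.
have D0 : 0 <= D by rewrite exprn_ge0 ?nm_ge0.
pose X := rho ^+ n.+1 * D.
have X0 : 0 <= X by rewrite mulr_ge0// exprn_ge0.
have h2 : n.+2%:R * nm (v ^+ n.+1) * D <= n.+2%:R * X.
  by rewrite -mulrA ler_wpM2l// ler_wpM2r.
have e1 (N : R) : rho * (N * rho ^+ n * D) = N * X.
  by rewrite /X [rho ^+ n.+1]exprS; ring.
have e2 : n.+2%:R = n.+1%:R + 1 :> R by rewrite -[in LHS]addn1 natrD.
have N0 : 0 <= n.+1%:R * X by rewrite mulr_ge0.
rewrite [nm ((u - v) ^+ 2)]nmX -/D (le_trans (lerD h1 h2))// e1 -mulrA -/X e2.
move: (n.+1%:R : R) N0 => N N0; lra.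
Qed.

(** The termwise antiderivative is a power series with the same rate, and
    [pow_diff2] bounds its second-order remainder by a multiple of [nm (z - p)
    ^+ 2], uniformly in the number of terms. *)
Lemma analytic_locprim f w : analytic f w -> locprim f w.
Proof.
move=> [a [q [M P]]]; have [q0 M0 aM H] := P.
pose b k : R[i] := if k is j.+1 then a j / j.+1%:R else 0.
pose M' := M / q.
have M'0 : 0 <= M' by rewrite divr_ge0// ltW.
have bM k : nm (b k) <= M' * q ^+ k.
  case: k => [|k]; first by rewrite /b nm0 expr0 mulr1.
  rewrite /b nmM nmV nm_nat /M' exprS mulrA mulfVK ?gt_eqF//.
  rewrite ler_pdivrMr ?ltr0n// (le_trans (aM k))// ler_peMr ?ler1n//.
  by rewrite mulr_ge0// exprn_ge0// ltW.
have [Phi PPhi] := ps_exists w q0 M'0 bM.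
pose rho := (4 * q)^-1.
have rho0 : 0 < rho by rewrite invr_gt0 mulr_gt0.
have rq : rho * q = 4^-1 by rewrite /rho invfM mulfVK ?gt_eqF.
have rr : rho <= (2 * q)^-1.
  by rewrite /rho lef_pV2 ?posrE ?mulr_gt0// ler_pM2r//; lra.
exists rho => //; exists Phi => p /= pw e e0.
pose K := 2 * M * q + 1.
have K0 : 0 < K by rewrite ltr_wpDl// !mulr_ge0// ltW.
exists (e / K); first by rewrite divr_gt0.
move=> z /= zw; rewrite ltr_pdivlMr// => zp.
suff S : nm (Phi z - Phi p - f p * (z - p)) <= 2 * M * q * nm (z - p) ^+ 2.
  rewrite (le_trans S)// expr2 mulrA ler_wpM2r ?nm_ge0//.
  rewrite (le_trans _ (ltW zp))// mulrC ler_wpM2l ?nm_ge0// lerDl//.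
set u := z - w; set v := p - w.
have uv : z - p = u - v by rewrite /u /v opprB addrA subrK.
have est n : nm (psum b u n.+2 - psum b v n.+2 - psum a v n.+1 * (u - v)) <=
    2 * M * q * nm (u - v) ^+ 2.
  pose T k : R[i] := a k.+1 / k.+2%:R *
    (u ^+ k.+2 - v ^+ k.+2 - k.+2%:R * v ^+ k.+1 * (u - v)).
  have Eb x : psum b x n.+2 = a 0%N * x + \sum_(k < n) a k.+1 / k.+2%:R * x ^+ k.+2.
    by rewrite /psum 2!big_ord_recl mul0r add0r /b/= divr1 expr1.
  have Ea : psum a v n.+1 = a 0%N + \sum_(k < n) a k.+1 * v ^+ k.+1.
    by rewrite /psum big_ord_recl expr0 mulr1.
  rewrite Ea !Eb (_ : _ - _ - _ = \sum_(k < n) T k); last first.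
    have -> : \sum_(k < n) T k = \sum_(k < n) a k.+1 / k.+2%:R * u ^+ k.+2 -
       \sum_(k < n) a k.+1 / k.+2%:R * v ^+ k.+2 -
       (\sum_(k < n) a k.+1 * v ^+ k.+1) * (u - v).
      rewrite mulr_suml -!sumrB; apply: eq_bigr => k _; rewrite /T; field.
      by rewrite -(natrD _ 2) pnatr_eq0.
    by ring.
  rewrite (le_trans (nm_sum _ _ _))//.
  rewrite (@le_trans _ _ (\sum_(k < n) M * q * nm (u - v) ^+ 2 * 2^-1 ^+ k))//; last first.
    rewrite -mulr_sumr half_geo.
    have h1 : 0 <= M * q * nm (u - v) ^+ 2 by rewrite !mulr_ge0 ?nm_ge0 ?(ltW q0).
    have h2 : 0 <= (2^-1 : R) ^+ n by rewrite exprn_ge0 ?invr_ge0.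
    nra.
  apply: ler_sum => k _; rewrite /T !nmM nmV nm_nat.
  have := @pow_diff2 u v rho k (ltW rho0) (ltW zw) (ltW pw).
  move=> hE.
  have hA : nm (a k.+1) / k.+2%:R <= M * q ^+ k.+1 / k.+2%:R.
    by rewrite ler_wpM2r ?invr_ge0// aM.
  have hA0 : 0 <= nm (a k.+1) / k.+2%:R by rewrite mulr_ge0 ?nm_ge0 ?invr_ge0//.
  rewrite (le_trans (ler_pM hA0 (nm_ge0 _) hA hE))//.
  have k2 : (0 : R) < k.+2%:R by rewrite ltr0n.
  rewrite [leLHS](_ : _ = M * q * nm (u - v) ^+ 2 *
     ((k.+1%:R / k.+2%:R) * (k.+1%:R * (rho * q) ^+ k))); last first.
    by rewrite exprMn exprS; ring.
  rewrite ler_wpM2l//; first by rewrite !mulr_ge0 ?nm_ge0 ?(ltW q0).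
  rewrite rq.
  have hy : 0 <= k.+1%:R * (4^-1 : R) ^+ k by rewrite mulr_ge0// exprn_ge0// invr_ge0.
  have hx : k.+1%:R / k.+2%:R <= (1 : R) by rewrite ler_pdivrMr// mul1r ler_nat.
  rewrite (le_trans (ler_piMl hy hx))//.
  have -> : 4^-1 = 2^-1 * 2^-1 :> R by field.
  rewrite exprMn mulrA ler_piMl ?exprn_ge0 ?invr_ge0//.
  rewrite exprVn ler_pdivrMr ?exprn_gt0// mul1r.
  exact: leq_succ_exp2.
rewrite uv; apply/ler_addgt0Pr => d d0.
have zr := le_trans (ltW zw) rr; have pr := le_trans (ltW pw) rr.
pose d1 := d / (nm (u - v) + 2).
have n2 : 0 < nm (u - v) + 2 by have := nm_ge0 (u - v); lra.
have d10 : 0 < d1 by rewrite divr_gt0.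
have [N1 h1] := ps_cvg PPhi zr d10.
have [N2 h2] := ps_cvg PPhi pr d10.
have [N3 h3] := ps_cvg P pr d10.
pose n := (N1 + N2 + N3)%N.
have {}h1 := h1 n.+2 ltac:(by rewrite /n -!addnA -!addnS leq_addr).
have {}h2 := h2 n.+2 ltac:(by rewrite /n -addnA -!addnS addnCA leq_addr).
have {}h3 := h3 n.+1 ltac:(by rewrite /n -!addnS (leq_trans _ (leq_addl _ _))).
rewrite -/u in h1; rewrite -/v in h2 h3.
have -> : Phi z - Phi p - f p * (u - v) =
   (psum b u n.+2 - psum b v n.+2 - psum a v n.+1 * (u - v))
   - (psum b u n.+2 - Phi z) + (psum b v n.+2 - Phi p)
   + (psum a v n.+1 - f p) * (u - v) by ring.
rewrite (le_trans (nmD _ _))// nmM.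
have h3' : nm (psum a v n.+1 - f p) * nm (u - v) <= d1 * nm (u - v).
  by rewrite ler_wpM2r ?nm_ge0.
have dd : d1 * (nm (u - v) + 2) = d by rewrite mulfVK ?gt_eqF.
have := est n.
have := nmD (psum b u n.+2 - psum b v n.+2 - psum a v n.+1 * (u - v)
   - (psum b u n.+2 - Phi z)) (psum b v n.+2 - Phi p).
have := nmB (psum b u n.+2 - psum b v n.+2 - psum a v n.+1 * (u - v))
   (psum b u n.+2 - Phi z).
lra.
Qed.

End Analytic.

(** * Poles and residues *)

Section Poles.
Context {R : realType}.
Implicit Types (x y z w p u v c : R[i]) (f g h F A Phi : R[i] -> R[i])
  (a b : nat -> R[i]) (q M e rho : R).

Lemma cvg_nmP (s : nat -> R[i]) (l : R[i]) :
  ((s : nat -> R[i]^o) @ \oo --> (l : R[i]^o)) <->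
  (forall e, 0 < e -> exists N, forall n, (N <= n)%N -> nm (s n - l) <= e).
Proof.
split=> [H e e0|H].
  move/cvgrPdist_le: H => /(_ e%:C); rewrite ltcR => /(_ e0)[N _ hN].
  exists N => n Nn; have := hN n Nn; rewrite /= normE lecR nm_dist//.
apply/cvgrPdist_le => e e0.
have eE : e = (complex.Re e)%:C by rewrite RRe_real// ger0_real// ltW.
have e'0 : 0 < complex.Re e by rewrite -ltcR -eE.
have [N hN] := H _ e'0; exists N => // n /= /hN.
by rewrite eE normE lecR nm_dist.
Qed.

Lemma near_punctured w (P : R[i] -> Prop) :
  (\forall z \near (w : R[i]^o)^', P z) <->
  (exists2 rho, 0 < rho & forall z, z != w -> nm (z - w) < rho -> P z).
Proof.
split=> [|[rho rho0 H]].
  move=> [e /= e0 H].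
  have eE : e = (complex.Re e)%:C by rewrite RRe_real// ger0_real// ltW.
  exists (complex.Re e); first by rewrite -ltcR -eE.
  move=> z zw zr; apply: H => //=.
  by rewrite eE normE ltcR nm_dist.
exists rho%:C; first by rewrite /= ltcR.
move=> z /= zw zr; apply: H => //.
by rewrite nm_dist -ltcR -normE.
Qed.

(** Some power of [z - w] times [f] extends analytically over [w]. *)
Definition meromorphic f w := exists m F rho,
  [/\ analytic F w, 0 < rho &
      forall z, z != w -> nm (z - w) < rho -> f z * (z - w) ^+ m = F z].

Lemma analytic_meromorphic f w : analytic f w -> meromorphic f w.
Proof. by move=> Af; exists 0%N, f, 1; split=> // z _ _; rewrite expr0 mulr1. Qed.

Lemma analytic_sub w : analytic (fun z => z - w) w.
Proof. by apply: analyticB; [exact: analytic_id|exact: analytic_cst]. Qed.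

Lemma meromorphicM f g w : meromorphic f w -> meromorphic g w ->
  meromorphic (fun z => f z * g z) w.
Proof.
move=> [m [F [rho [AF rho0 HF]]]] [m' [G [rho' [AG rho'0 HG]]]].
exists (m + m')%N, (fun z => F z * G z), (Num.min rho rho'); split.
- exact: analyticM.
- by rewrite lt_min rho0.
- move=> z zw; rewrite lt_min => /andP[z1 z2].
  by rewrite -HF// -HG// exprD mulrACA.
Qed.

Lemma meromorphicD f g w : meromorphic f w -> meromorphic g w ->
  meromorphic (fun z => f z + g z) w.
Proof.
move=> [m [F [rho [AF rho0 HF]]]] [m' [G [rho' [AG rho'0 HG]]]].
exists (m + m')%N, (fun z => F z * (z - w) ^+ m' + G z * (z - w) ^+ m),
  (Num.min rho rho'); split.
- apply: analyticD; apply: analyticM => //; apply: analyticX; exact: analytic_sub.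
- by rewrite lt_min rho0.
- move=> z zw; rewrite lt_min => /andP[z1 z2].
  by rewrite -HF// -HG// exprD; ring.
Qed.

Lemma meromorphic_sum (I : Type) (r : seq I) (F : I -> R[i] -> R[i]) w :
  (forall i, meromorphic (F i) w) -> meromorphic (fun z => \sum_(i <- r) F i z) w.
Proof.
move=> MF; elim: r => [|i r ih].
  rewrite (_ : (fun _ => _) = fun=> 0); last by apply/funext => z; rewrite big_nil.
  by apply: analytic_meromorphic; exact: analytic_cst.
rewrite (_ : (fun _ => _) = fun z => F i z + \sum_(j <- r) F j z).
  exact: meromorphicD.
by apply/funext => z; rewrite big_cons.
Qed.

(** [m] is the index of the first nonzero coefficient. *)
Lemma ps_order a w f q M k0 : ps a w f q M -> a k0 != 0 ->
  exists m g rho, [/\ analytic g w, g w != 0, 0 < rho &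
    forall z, nm (z - w) < rho -> f z = (z - w) ^+ m * g z /\ g z != 0].
Proof.
move=> P ak0.
have ex : exists k, a k != 0 by exists k0.
pose m := ex_minn ex.
have [am lowm] : a m != 0 /\ forall k, (k < m)%N -> a k = 0.
  rewrite /m; case: ex_minnP => k ak hk; split=> // j jk.
  by apply: contraTeq jk => /hk; rewrite -leqNgt.
have P' := ps_shift m P.
set g := (fun z => _) in P'.
have Ag : analytic g w by do 3 eexists; exact: P'.
have gw : g w != 0 by rewrite /g eqxx.
have [rho rho0 hg] := analytic_neq0 Ag gw.
have s0 u : psum a u m = 0 by apply: big1 => i _; rewrite lowm ?mul0r.
exists m, g, rho; split=> // z zr; split; last exact: hg.
rewrite /g; case: eqVneq => [->|zw].
  rewrite subrr (ps_center P) expr0n; case: eqP => [->|/eqP m0]; first by rewrite mul1r.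
  by rewrite mul0r lowm// lt0n.
by rewrite s0 subr0 mulrC mulfVK// expf_neq0// subr_eq0.
Qed.

Lemma meromorphicV f w a q M k0 : ps a w f q M -> a k0 != 0 ->
  meromorphic (fun z => (f z)^-1) w.
Proof.
move=> P /(ps_order P)[m [g [rho [Ag gw rho0 H]]]].
exists m, (fun z => (g z)^-1), rho; split=> //; first exact: analyticV.
move=> z zw zr; have [-> gz] := H z zr.
have u0 : (z - w) ^+ m != 0 by rewrite expf_neq0// subr_eq0.
by field; rewrite gz.
Qed.

(** Splitting into a finite principal part, with residue [c], and an analytic
    part: the form in which the residue theorem uses a pole. *)
Definition polar h w c := exists m b A rho,
  [/\ analytic A w, 0 < rho, c = b 0%N &
      forall z, z != w -> nm (z - w) < rho ->
        h z = \sum_(k < m.+1) b k / (z - w) ^+ k.+1 + A z].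

(** Both notions read off the same Taylor coefficients of [h z * (z - w) ^+
    m.+1]. *)
Lemma meromorphic_laurent h w : meromorphic h w ->
  exists2 c, is_residue h w c & polar h w c.
Proof.
move=> [m [F0 [rho [AF0 rho0 H0]]]].
(* One more power of [z - w] than [meromorphic] provides, because a residue
   expansion starts at order [- m.+1]. *)
pose F z := F0 z * (z - w).
have : analytic F w by apply: analyticM => //; exact: analytic_sub.
move=> [a [q [M P]]].
have H z : z != w -> nm (z - w) < rho -> h z * (z - w) ^+ m.+1 = F z.
  by move=> zw zr; rewrite exprSr mulrA H0.
have hE z : z != w -> nm (z - w) < rho -> h z = F z / (z - w) ^+ m.+1.
  by move=> zw zr; rewrite -H// mulfK// expf_neq0// subr_eq0.
have [q0 M0 _ _] := P.
exists (a m).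
  exists m, a; split=> //; apply/near_punctured.
  exists (Num.min rho (2 * q)^-1); first by rewrite lt_min rho0 invr_gt0 mulr_gt0.
  move=> z zw; rewrite lt_min => /andP[zr /ltW zq]; apply/cvg_nmP => e e0.
  have u0 : (z - w) ^+ m.+1 != 0 by rewrite expf_neq0// subr_eq0.
  have nu0 : 0 < nm ((z - w) ^+ m.+1) by rewrite nm_gt0.
  have e'0 : 0 < e * nm ((z - w) ^+ m.+1) by rewrite mulr_gt0.
  have [N hN] := ps_cvg P zq e'0; exists N => n /hN.
  rewrite /series/= big_mkord -mulr_suml hE// -mulrBl nmM nmV.
  by rewrite ler_pdivrMr.
have P' := ps_shift m.+1 P; set A := (fun z => _) in P'.
exists m, (fun k => a (m - k)%N), A, rho; split=> //.
- by do 3 eexists; exact: P'.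
- by rewrite subn0.
move=> z zw zr; rewrite hE// /A (negbTE zw).
have u0 j : (z - w) ^+ j != 0 by rewrite expf_neq0// subr_eq0.
suff -> : \sum_(k < m.+1) a (m - k)%N / (z - w) ^+ k.+1 =
    psum a (z - w) m.+1 / (z - w) ^+ m.+1 by rewrite -mulrDl [psum _ _ _ + _]addrC subrK.
rewrite /psum mulr_suml (reindex_inj rev_ord_inj)/=.
apply: eq_bigr => i _; rewrite subSS.
have im : (i <= m)%N by rewrite -ltnS.
rewrite subKn//.
have -> : (z - w) ^+ m.+1 = (z - w) ^+ i * (z - w) ^+ (m - i).+1.
  by rewrite -exprD addnS subnKC.
by rewrite invfM mulrA mulfK.
Qed.

Lemma ps_unshift a w f q M d : ps a w f q M ->
  ps (fun k => if (k < d)%N then 0 else a (k - d)%N) w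
     (fun z => f z * (z - w) ^+ d) q (M / q ^+ d).
Proof.
move=> P; have [q0 M0 aM H] := P.
have qd : 0 < q ^+ d by rewrite exprn_gt0.
apply: ps_of_cvg => // [|k|z zq e e0].
- by rewrite divr_ge0// ltW.
- case: ltnP => kd; first by rewrite nm0 mulr_ge0 ?divr_ge0 ?exprn_ge0 ?(ltW q0).
  by rewrite -{2}(subnK kd) exprD mulrACA mulVf ?gt_eqF// mulr1.
pose K := nm ((z - w) ^+ d) + 1.
have n0 := nm_ge0 ((z - w) ^+ d).
have K0 : 0 < K by rewrite /K; lra.
have e'0 : 0 < e / K by rewrite divr_gt0.
have [N hN] := ps_cvg P zq e'0.
exists (N + d)%N => n Nn.
have dn : (d <= n)%N by rewrite (leq_trans _ Nn)// leq_addl.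
have sh l : psum (fun k => if (k < d)%N then 0 else a (k - d)%N) (z - w) (d + l) =
    psum a (z - w) l * (z - w) ^+ d.
  rewrite {1}/psum big_split_ord/= big1 ?add0r.
    rewrite /psum mulr_suml; apply: eq_bigr => i _.
    by rewrite ltnNge leq_addr/= addKn -mulrA -exprD addnC.
  by move=> i _; rewrite ltn_ord mul0r.
rewrite -(subnKC dn) sh.
rewrite -mulrBl nmM.
have := hN (n - d)%N ltac:(by rewrite leq_subRL// addnC).
move=> /(ler_wpM2r n0)/le_trans; apply.
by rewrite mulrAC ler_pdivrMr// ler_wpM2l ?(ltW e0)// lerDl.
Qed.

(** Convergence at one point bounds the terms there, hence the coefficients
    geometrically, so the expansion is a power series in the quantitative
    sense. *)
Lemma is_residue_ps h w c : is_residue h w c -> exists m a q M rho,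
  [/\ ps a w (fun z => if z == w then a 0%N else h z * (z - w) ^+ m.+1) q M,
      0 < rho & c = a m].
Proof.
move=> [m [a [/near_punctured[rho rho0 H] ->]]].
have cv z : z != w -> nm (z - w) < rho -> forall e, 0 < e ->
    exists N, forall n, (N <= n)%N -> nm (psum a (z - w) n - h z * (z - w) ^+ m.+1) <= e.
  move=> zw zr e e0; have /cvg_nmP cv := H z zw zr.
  have u0 : (z - w) ^+ m.+1 != 0 by rewrite expf_neq0// subr_eq0.
  have nu0 : 0 < nm ((z - w) ^+ m.+1) by rewrite nm_gt0.
  have e'0 : 0 < e / nm ((z - w) ^+ m.+1) by rewrite divr_gt0.
  have [N hN] := cv _ e'0; exists N => n /hN.
  rewrite ler_pdivlMr// -nmM mulrBl /series/= big_mkord -mulr_suml mulfVK//.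
pose r := rho / 2.
have r0 : 0 < r by rewrite divr_gt0.
have nr : nm (w + r%:C - w) = r by rewrite addrC addKr nmR gtr0_norm.
have [N hN] := cv (w + r%:C) ltac:(by rewrite -subr_eq0 -nm_eq0 nr gt_eqF)
  ltac:(by rewrite nr /r; lra) 1 ltr01.
set u := w + r%:C - w in hN nr; set L := h _ * _ in hN.
pose q := r^-1.
have q0 : 0 < q by rewrite invr_gt0.
pose M := \sum_(k < N) nm (a k * u ^+ k) + 2.
have S0 : 0 <= \sum_(k < N) nm (a k * u ^+ k) by apply: sumr_ge0 => i _; exact: nm_ge0.
have M0 : 0 <= M by rewrite /M; lra.
have aM k : nm (a k) <= M * q ^+ k.
  rewrite /q exprVn ler_pdivlMr ?exprn_gt0// -nr -nmX -nmM.
  have [kN|Nk] := ltnP k N.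
    rewrite /M (bigD1 (Ordinal kN))//= -addrA lerDl addr_ge0//.
    by apply: sumr_ge0 => i _; exact: nm_ge0.
  have := hN k Nk; have := hN k.+1 (leqW Nk).
  rewrite /psum big_ord_recr/= => h1 h2.
  have := nmB (\sum_(i < k) a i * u ^+ i + a k * u ^+ k - L) (\sum_(i < k) a i * u ^+ i - L).
  rewrite (_ : _ - _ - _ = a k * u ^+ k); last by ring.
  rewrite /M; lra.
exists m, a, q, M, rho; split=> //.
apply: ps_of_cvg => // z zq e e0.
have [->|zw] := eqVneq z w.
  exists 1%N => -[//|n] _; rewrite /psum big_ord_recl/= expr0 mulr1 big1.
    by rewrite addr0 subrr nm0 ltW.
  by move=> i _; rewrite subrr exprS mul0r mulr0.
apply: cv => //; rewrite (le_lt_trans zq)// /q /r invfM invrK; lra.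
Qed.

(** Multiplied by the two powers of [z - w], both expansions represent the
    same function on a punctured disc; their coefficients of order [m + m']
    are the two residues. *)
Lemma is_residue_unique h w c c' : is_residue h w c -> is_residue h w c' -> c = c'.
Proof.
move=> /is_residue_ps[m [a [q [M [rho [P rho0 ->]]]]]].
move=> /is_residue_ps[m' [a' [q' [M' [rho' [P' rho'0 ->]]]]]].
have Q := ps_unshift m' P; have Q' := ps_unshift m P'.
have Q1 := @ps_widen _ _ _ _ _ _ (Num.max q q') _ Q ltac:(by rewrite le_max lexx) (lexx _).
have Q2 := @ps_widen _ _ _ _ _ _ (Num.max q q') _ Q' ltac:(by rewrite le_max lexx orbT) (lexx _).
have := ps_punctured0 (psD Q1 (psZ (-1) Q2)) rho0.
move=> /(_ _ (m + m')%N); rewrite addnK addKn !ltnNge leq_addl leq_addr/=.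
move=> D; apply/eqP; rewrite -subr_eq0 -mulN1r D//.
move=> z zw zr; rewrite (negbTE zw) -!mulrA -!exprD addSn addSn addnC.
by rewrite mulN1r subrr.
Qed.

Lemma residueE h w c : is_residue h w c -> residue h w = c.
Proof.
by move=> hc; apply: xget_unique => // c' /= /is_residue_unique; apply.
Qed.

Lemma is_residueZ k h w c : is_residue h w c -> is_residue (fun z => k * h z) w (k * c).
Proof.
move=> [m [a [/near_punctured[rho rho0 H] ->]]].
exists m, (fun j => k * a j); split; last by [].
apply/near_punctured; exists rho; first exact: rho0.
move=> z zw zr; apply/cvg_nmP => e e0.
have k0 : 0 < nm k + 1 by have := nm_ge0 k; lra.
have e'0 : 0 < e / (nm k + 1) by rewrite divr_gt0.
have /cvg_nmP/(_ _ e'0)[N hN] := H z zw zr.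
exists N => n /hN; rewrite ler_pdivlMr// => hn.
rewrite (le_trans _ hn)//.
rewrite (_ : series _ n - _ = k * (series (fun j => a j * (z - w) ^+ j / (z - w) ^+ m.+1) n - h z)).
  by rewrite nmM mulrC ler_wpM2l ?nm_ge0// lerDl.
rewrite mulrBr; congr (_ - _); rewrite /series/= mulr_sumr.
by apply: eq_bigr => i _; rewrite !mulrA.
Qed.

End Poles.

(** * The residue theorem on rectangles *)

Section Residues.
Context {R : realType}.
Implicit Types (x y z w p u v c : R[i]) (f g h F A Phi : R[i] -> R[i])
  (a b : nat -> R[i]) (e rho : R).

Definition hor h (y x0 x1 : R) v := is_int (fun t => h (t +i* y)) x0 x1 v.
Definition ver h (x y0 y1 : R) v := is_int (fun t => h (x +i* t)) y0 y1 v.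

(** Counterclockwise contour integral over the boundary of a rectangle. *)
Definition oint h (x0 x1 y0 y1 : R) v := exists vb vr vt vl,
  [/\ hor h y0 x0 x1 vb, ver h x1 y0 y1 vr, hor h y1 x0 x1 vt, ver h x0 y0 y1 vl
    & v = vb + 'i * vr - vt - 'i * vl].

Lemma oint_eq h h' (x0 x1 y0 y1 : R) v :
  (forall z, complex.Re z = x0 \/ complex.Re z = x1 \/ complex.Im z = y0 \/
    complex.Im z = y1 -> h z = h' z) ->
  oint h x0 x1 y0 y1 v -> oint h' x0 x1 y0 y1 v.
Proof.
move=> hh' [vb [vr [vt [vl [H1 H2 H3 H4 ->]]]]].
exists vb, vr, vt, vl; split=> //.
- by apply: is_int_eq H1 => t _; apply: hh' => /=; tauto.
- by apply: is_int_eq H2 => t _; apply: hh' => /=; tauto.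
- by apply: is_int_eq H3 => t _; apply: hh' => /=; tauto.
- by apply: is_int_eq H4 => t _; apply: hh' => /=; tauto.
Qed.

Lemma ointD h h' (x0 x1 y0 y1 : R) v v' :
  oint h x0 x1 y0 y1 v -> oint h' x0 x1 y0 y1 v' ->
  oint (fun z => h z + h' z) x0 x1 y0 y1 (v + v').
Proof.
move=> [vb [vr [vt [vl [H1 H2 H3 H4 ->]]]]] [wb [wr [wt [wl [G1 G2 G3 G4 ->]]]]].
exists (vb + wb), (vr + wr), (vt + wt), (vl + wl); split; try exact: is_intD.
ring.
Qed.

Lemma ointZ h c (x0 x1 y0 y1 : R) v :
  oint h x0 x1 y0 y1 v -> oint (fun z => c * h z) x0 x1 y0 y1 (c * v).
Proof.
move=> [vb [vr [vt [vl [H1 H2 H3 H4 ->]]]]].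
exists (c * vb), (c * vr), (c * vt), (c * vl); split; try exact: is_intZ.
ring.
Qed.

Lemma oint_sum n (h : nat -> R[i] -> R[i]) (x0 x1 y0 y1 : R) (v : nat -> R[i]) :
  (forall k, oint (h k) x0 x1 y0 y1 (v k)) ->
  oint (fun z => \sum_(k < n) h k z) x0 x1 y0 y1 (\sum_(k < n) v k).
Proof.
move=> H; elim: n => [|n ih].
  apply: (@oint_eq (fun=> 0)) => [z _|]; first by rewrite big_ord0.
  exists 0, 0, 0, 0; split; try exact: is_int0.
  by rewrite big_ord0; ring.
apply: (@oint_eq (fun z => \sum_(k < n) h k z + h n z)) => [z _|].
  by rewrite big_ord_recr.
by rewrite big_ord_recr/=; exact: ointD.
Qed.

Lemma prim_hor S Phi h (y x0 x1 : R) : prim S Phi h ->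
  (forall t, x0 <= t <= x1 -> S (t +i* y)) ->
  hor h y x0 x1 (Phi (x1 +i* y) - Phi (x0 +i* y)).
Proof.
move=> H hS; have E t : (0 +i* y) + t%:C * 1 = t +i* y by simpc.
exists (fun t => Phi (t +i* y)) => // t tx e e0.
have [|d d0 hd] := @prim_rprim R S Phi h (0 +i* y) 1 x0 x1 H _ t tx e e0.
  by move=> s sx; rewrite E; exact: hS.
by exists d => // s sx sd; have := hd s sx sd; rewrite !E mulr1.
Qed.

Lemma prim_ver S Phi h (x y0 y1 : R) : prim S Phi h ->
  (forall t, y0 <= t <= y1 -> S (x +i* t)) ->
  ver h x y0 y1 (- 'i * (Phi (x +i* y1) - Phi (x +i* y0))).
Proof.
move=> H hS; have E t : x%:C + t%:C * 'i = x +i* t by simpc.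
have K : rprim y0 y1 (fun t => Phi (x +i* t)) (fun t => h (x +i* t) * 'i).
  move=> t tx e e0.
  have [|d d0 hd] := @prim_rprim R S Phi h x%:C 'i y0 y1 H _ t tx e e0.
    by move=> s sx; rewrite E; exact: hS.
  by exists d => // s sx sd; have := hd s sx sd; rewrite !E.
exists (fun t => - 'i * Phi (x +i* t)); last by ring.
apply: rprim_eq (rprimZ (- 'i) K) => t _.
rewrite mulrCA; have -> : - 'i * 'i = 1 :> R[i] by simpc.
by rewrite mulr1.
Qed.

(** The increments of a primitive along the four edges cancel. *)
Lemma oint_prim S Phi h (x0 x1 y0 y1 : R) : prim S Phi h ->
  (forall t, x0 <= t <= x1 -> S (t +i* y0) /\ S (t +i* y1)) ->
  (forall t, y0 <= t <= y1 -> S (x0 +i* t) /\ S (x1 +i* t)) ->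
  oint h x0 x1 y0 y1 0.
Proof.
move=> H h1 h2; do 4 eexists; split.
- by apply: (prim_hor H) => t /h1[].
- by apply: (prim_ver H) => t /h2[].
- by apply: (prim_hor H) => t /h1[].
- by apply: (prim_ver H) => t /h2[].
have ii : 'i * 'i = -1 :> R[i] by simpc.
rewrite !mulrA mulrN ii opprK !mul1r; ring.
Qed.

Lemma prim_near_bound S Phi h p : prim S Phi h -> S p ->
  exists2 d : R, 0 < d & forall z, S z -> nm (z - p) < d ->
    nm (Phi z - Phi p) <= (nm (h p) + 1) * nm (z - p).
Proof.
move=> H Sp; have [d d0 hd] := H p Sp 1 ltr01.
exists d => // z Sz zd; have := hd z Sz zd.
have := nm_tri2 (Phi z - Phi p) (h p * (z - p)); rewrite nmM; lra.
Qed.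

Lemma primM S Phi h Psi g : prim S Phi h -> prim S Psi g ->
  prim S (fun z => Phi z * Psi z) (fun z => h z * Psi z + Phi z * g z).
Proof.
move=> HPhi HPsi p Sp e e0.
have n1 := nm_ge0 (Phi p); have n2 := nm_ge0 (Psi p).
have n3 := nm_ge0 (h p); have n4 := nm_ge0 (g p).
pose K := nm (Phi p) + nm (Psi p) + (nm (h p) + 1) * (nm (g p) + 1) + 1.
have K0 : 0 < K by rewrite /K; nra.
have e'0 : 0 < e / K by rewrite divr_gt0.
have [d1 d10 h1] := HPhi p Sp _ e'0.
have [d2 d20 h2] := HPsi p Sp _ e'0.
have [d3 d30 h3] := prim_near_bound HPhi Sp.
have [d4 d40 h4] := prim_near_bound HPsi Sp.
exists (Num.min (Num.min d1 d2) (Num.min (Num.min d3 d4) (e / K))).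
  by rewrite !lt_min d10 d20 d30 d40.
move=> z Sz; rewrite !lt_min => /andP[/andP[z1 z2] /andP[/andP[z3 z4] z5]].
have -> : Phi z * Psi z - Phi p * Psi p - (h p * Psi p + Phi p * g p) * (z - p) =
  (Phi z - Phi p - h p * (z - p)) * Psi p + Phi p * (Psi z - Psi p - g p * (z - p))
  + (Phi z - Phi p) * (Psi z - Psi p) by ring.
rewrite (le_trans (nmD _ _))// (le_trans (lerD (nmD _ _) (lexx _)))// !nmM.
have {}h1 := h1 z Sz z1; have {}h2 := h2 z Sz z2.
have {}h3 := h3 z Sz z3; have {}h4 := h4 z Sz z4.
have d0 := nm_ge0 (z - p).
have t1 := ler_wpM2r n2 h1; have t2 := ler_wpM2l n1 h2.
have t3 := ler_pM (nm_ge0 _) (nm_ge0 _) h3 h4.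
have t4 : nm (z - p) * nm (z - p) <= e / K * nm (z - p) by rewrite ler_wpM2r// ltW.
have t5 : (nm (h p) + 1) * nm (z - p) * ((nm (g p) + 1) * nm (z - p)) <=
   (nm (h p) + 1) * (nm (g p) + 1) * (e / K * nm (z - p)).
  by rewrite mulrACA ler_wpM2l// mulr_ge0//; lra.
rewrite [leRHS](_ : _ = K * (e / K * nm (z - p))); last first.
  by rewrite mulrA mulrCA divff ?gt_eqF// mulr1.
have e1 : 0 <= e / K * nm (z - p) by rewrite mulr_ge0// ltW.
rewrite {1}/K !mulrDl mul1r.
move: (e / K * nm (z - p)) t1 t2 t3 t5 e1 => E t1 t2 t3 t5 e1.
lra.
Qed.

Lemma prim_inv w : prim [set z | z != w] (fun z => (z - w)^-1)
  (fun z => - ((z - w)^-1 ^+ 2)).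
Proof.
move=> p /= pw e e0.
have b0 : p - w != 0 by rewrite subr_eq0.
have nb : 0 < nm (p - w) by rewrite nm_gt0.
pose d := Num.min (nm (p - w) / 2) (e * nm (p - w) ^+ 3 / 2).
exists d; first by rewrite lt_min !divr_gt0// mulr_gt0// exprn_gt0.
move=> z zw; rewrite lt_min => /andP[z1 z2].
have a0 : z - w != 0 by rewrite subr_eq0.
have -> : (z - w)^-1 - (p - w)^-1 - - (p - w)^-1 ^+ 2 * (z - p) =
   (z - p) ^+ 2 / ((p - w) ^+ 2 * (z - w)).
  have -> : z - p = (z - w) - (p - w) by rewrite opprB addrA subrK.
  by field; rewrite a0 b0.
rewrite nmM nmV nmM !nmX.
have na : nm (p - w) / 2 <= nm (z - w).
  have := nm_tri (p) z w; rewrite nm_dist in z1; lra.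
have na0 : 0 < nm (z - w) by rewrite nm_gt0.
rewrite ler_pdivrMr ?mulr_gt0 ?exprn_gt0//.
have d0 := nm_ge0 (z - p).
rewrite expr2 [leRHS]mulrAC ler_wpM2r//.
rewrite (le_trans (ltW z2))//.
rewrite [leLHS](_ : _ = e * (nm (p - w) ^+ 2 * (nm (p - w) / 2))); last by ring.
by rewrite ler_wpM2l ?(ltW e0)// ler_wpM2l// exprn_ge0// nm_ge0.
Qed.

Lemma prim_invX w k : prim [set z | z != w] (fun z => (z - w)^-1 ^+ k.+1)
  (fun z => - k.+1%:R * (z - w)^-1 ^+ k.+2).
Proof.
elim: k => [|k ih].
  apply: (@prim_eq R _ _ (fun z => - ((z - w)^-1 ^+ 2))) => [z _|].
    by rewrite mulN1r.
  exact: prim_inv.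
apply: (@prim_eq R _ _ (fun z => - ((z - w)^-1 ^+ 2) * (z - w)^-1 ^+ k.+1 +
  (z - w)^-1 * (- k.+1%:R * (z - w)^-1 ^+ k.+2))) => [z _|]; last first.
  have -> : (fun z => (z - w)^-1 ^+ k.+2) = (fun z => (z - w)^-1 * (z - w)^-1 ^+ k.+1).
    by apply/funext => z; rewrite exprS.
  exact: primM (@prim_inv w) ih.
rewrite [in RHS]mulrS opprD mulrDl mulN1r; congr (_ + _).
  by rewrite mulNr -exprD add2n.
by rewrite mulrCA -exprS.
Qed.

Lemma oint_invX w k (x0 x1 y0 y1 : R) :
  x0 < complex.Re w < x1 -> y0 < complex.Im w < y1 ->
  oint (fun z => (z - w)^-1 ^+ k.+2) x0 x1 y0 y1 0.
Proof.
case: w => s t /= /andP[s0 s1] /andP[t0 t1].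
have H := primZ (- k.+1%:R^-1) (@prim_invX (s +i* t) k).
apply: (@oint_eq (fun z => - (k.+1%:R)^-1 * (- k.+1%:R * (z - (s +i* t))^-1 ^+ k.+2))).
  move=> z _; rewrite mulrA mulrNN mulVf ?mul1r// pnatr_eq0//.
apply: (oint_prim H) => r _; split; apply/eqP => -[] // E1 E2; lra.
Qed.

Lemma rprim_ReIm (a b : R) (f1 f2 g1 g2 : R -> R) :
  (forall t, a <= t <= b -> is_derive t 1 f1 (g1 t)) ->
  (forall t, a <= t <= b -> is_derive t 1 f2 (g2 t)) ->
  rprim a b (fun t => f1 t +i* f2 t) (fun t => g1 t +i* g2 t).
Proof.
move=> H1 H2 t tab e e0.
have e20 : 0 < e / 2 by rewrite divr_gt0.
have [d1 d10 h1] := derive_estimate (H1 t tab) e20.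
have [d2 d20 h2] := derive_estimate (H2 t tab) e20.
exists (Num.min d1 d2); first by rewrite lt_min d10.
move=> s _; rewrite lt_min => /andP[s1 s2].
rewrite (le_trans (nm_ReIm _))//.
have := h1 s s1; have := h2 s s2.
by rewrite /= !mulr0 subr0 add0r; lra.
Qed.

Lemma is_derive_half_lnD (d s u : R) : d != 0 ->
  is_derive u 1 (fun t => ln (d ^+ 2 + (t - s) ^+ 2) / 2)
    ((u - s) / (d ^+ 2 + (u - s) ^+ 2)).
Proof.
move=> d0.
have p0 : 0 < d ^+ 2 + (u - s) ^+ 2.
  by rewrite ltr_pwDl ?sqr_ge0// lt_def sqr_ge0 sqrf_eq0 d0.
have H := is_derive1_ln p0.
have K : is_derive u 1 (fun t : R => d ^+ 2 + (t - s) ^+ 2) (2 * (u - s)).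
  by apply: is_derive_eq; rewrite /GRing.scale/=; ring.
have L := @is_derive1_comp R (@ln R) (fun t => d ^+ 2 + (t - s) ^+ 2) u _ _ H K.
have M := is_deriveM L (is_derive_cst (2^-1 : R) u 1).
apply: is_derive_eq M _.
by rewrite /GRing.scale /cst /=; field; rewrite gt_eqF.
Qed.

Lemma is_derive_atan_div (d s u : R) : d != 0 ->
  is_derive u 1 (fun t => atan ((t - s) / d)) (d / (d ^+ 2 + (u - s) ^+ 2)).
Proof.
move=> d0.
have p0 : 0 < d ^+ 2 + (u - s) ^+ 2.
  by rewrite ltr_pwDl ?sqr_ge0// lt_def sqr_ge0 sqrf_eq0 d0.
have K : is_derive u 1 (fun t : R => (t - s) / d) d^-1.
  by apply: is_derive_eq; rewrite /GRing.scale/=; ring.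
have L := @is_derive1_comp R (@atan R) (fun t => (t - s) / d) u _ _ (is_derive1_atan _) K.
apply: is_derive_eq L _; field.
by rewrite d0 gt_eqF.
Qed.

Lemma ver_inv (x y0 y1 s t : R) : x != s ->
  ver (fun z => (z - (s +i* t))^-1) x y0 y1
    ((atan ((y1 - t) / (x - s)) - atan ((y0 - t) / (x - s))) +i*
     (ln ((x - s) ^+ 2 + (y0 - t) ^+ 2) / 2 - ln ((x - s) ^+ 2 + (y1 - t) ^+ 2) / 2)).
Proof.
move=> xs; have d0 : x - s != 0 by rewrite subr_eq0.
have H := @rprim_ReIm y0 y1 _ (fun r => - (ln ((x - s) ^+ 2 + (r - t) ^+ 2) / 2))
   _ _ (fun (u : R) _ => is_derive_atan_div t u d0)
   (fun (u : R) _ => is_deriveN (is_derive_half_lnD t u d0)).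
eexists; first exact: rprim_eq H.
by simpc; congr (_ +i* _); rewrite /=; ring.
Qed.

Lemma hor_inv (y x0 x1 s t : R) : y != t ->
  hor (fun z => (z - (s +i* t))^-1) y x0 x1
    ((ln ((y - t) ^+ 2 + (x1 - s) ^+ 2) / 2 - ln ((y - t) ^+ 2 + (x0 - s) ^+ 2) / 2) +i*
     (atan ((x0 - s) / (y - t)) - atan ((x1 - s) / (y - t)))).
Proof.
move=> yt; have d0 : y - t != 0 by rewrite subr_eq0.
have H := @rprim_ReIm x0 x1 _ (fun r => - atan ((r - s) / (y - t))) _ _
   (fun (u : R) _ => is_derive_half_lnD s u d0)
   (fun (u : R) _ => is_deriveN (is_derive_atan_div s u d0)).
eexists.
  apply: rprim_eq H => u _.
  rewrite -[RHS]/(((u - s) / ((u - s) ^+ 2 + (y - t) ^+ 2)) -i*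
    ((y - t) / ((u - s) ^+ 2 + (y - t) ^+ 2))).
  by rewrite [(u - s) ^+ 2 + _]addrC.
by simpc; congr (_ +i* _); rewrite /=; ring.
Qed.

Lemma atan_inv (x : R) : 0 < x -> atan x + atan x^-1 = pi / 2.
Proof.
move=> x0; have ax0 : 0 < atan x by rewrite -(atan0 R) lt_atan.
have ax1 := atan_ltpi2 x.
have -> : atan x^-1 = pi / 2 - atan x; last by rewrite addrC subrK.
rewrite -[RHS]tanK; last by rewrite in_itv/=; apply/andP; split; lra.
congr atan; rewrite -{1}(atanK x) /tan.
have -> : pi / 2 - atan x = - (atan x - pi / 2) by rewrite opprB.
by rewrite sinN cosN sinBpihalf cosBpihalf opprK invfM invrK mulrC.
Qed.

Lemma atan_div_swap (a b : R) : 0 < a -> 0 < b -> atan (a / b) + atan (b / a) = pi / 2.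
Proof. by move=> a0 b0; rewrite -[b / a]invf_div atan_inv// divr_gt0. Qed.

(** On each edge the integral has a logarithmic and an arctangent part. The
    logarithms at the four corners cancel in pairs, and at each corner the two
    arctangents add up to [pi / 2]. *)
Lemma oint_inv w (x0 x1 y0 y1 : R) :
  x0 < complex.Re w < x1 -> y0 < complex.Im w < y1 ->
  oint (fun z => (z - w)^-1) x0 x1 y0 y1 ((2 * pi)%:C * 'i).
Proof.
case: w => s t /= /andP[s0 s1] /andP[t0 t1].
do 4 eexists; split.
- by apply: hor_inv; rewrite lt_eqF.
- by apply: ver_inv; rewrite gt_eqF.
- by apply: hor_inv; rewrite gt_eqF.
- by apply: ver_inv; rewrite lt_eqF.
have [A0 B0] : 0 < x1 - s /\ 0 < s - x0 by split; lra.
have [C0 E0] : 0 < y1 - t /\ 0 < t - y0 by split; lra.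
have sw (a b : R) : a / (y0 - t) = - (a / (t - y0)).
  by rewrite -[y0 - t]opprB invrN mulrN.
have sw2 (a : R) : a / (x0 - s) = - (a / (s - x0)).
  by rewrite -[x0 - s]opprB invrN mulrN.
have n1 : x0 - s = - (s - x0) by rewrite opprB.
have n2 : y0 - t = - (t - y0) by rewrite opprB.
have q1 := atan_div_swap A0 C0.
have q2 := atan_div_swap A0 E0.
have q3 := atan_div_swap B0 C0.
have q4 := atan_div_swap B0 E0.
rewrite n1 n2 !sqrrN !invrN !mulrN !mulNr !opprK !atanN.
simpc; congr (_ +i* _).
  rewrite ![in (y1 - t) ^+ 2 + _]addrC ![in (t - y0) ^+ 2 + _]addrC.
  ring.
lra.
Qed.

(** Induction on the poles: subtracting the principal part at [w] leaves a
    function with one pole fewer, and in the principal part only the term of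
    order [-1] has a nonzero integral. *)
Theorem oint_residues (c : R[i] -> R[i]) (Z : seq R[i]) h (x0 x1 y0 y1 : R) :
  x0 <= x1 -> y0 <= y1 -> uniq Z ->
  (forall w, w \in Z -> [/\ x0 < complex.Re w < x1, y0 < complex.Im w < y1
     & polar h w (c w)]) ->
  (forall p, rect x0 x1 y0 y1 p -> p \notin Z -> analytic h p) ->
  oint h x0 x1 y0 y1 ((2 * pi)%:C * 'i * \sum_(w <- Z) c w).
Proof.
move=> x01 y01; elim: Z h => [|w Z ih] h.
  move=> _ _ H; rewrite big_nil mulr0.
  have [Phi HPhi] := prim_rect x01 y01 (fun p pr => analytic_locprim (H p pr isT)).
  by apply: (oint_prim HPhi) => t tx; split; split => //=; lra.
rewrite cons_uniq => /andP[wZ uZ] HP HA.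
have [w1 w2 [m [b [A [rho [AA rho0 cb Hw]]]]]] := HP w (mem_head _ _).
pose pp z := \sum_(k < m.+1) b k * (z - w)^-1 ^+ k.+1.
have App p : p != w -> analytic pp p.
  move=> pw; apply: analytic_sum => k; apply: analyticM; first exact: analytic_cst.
  apply: analyticX; apply: analyticV; last by rewrite subr_eq0.
  by apply: analyticB; [exact: analytic_id|exact: analytic_cst].
have Hw' z : z != w -> nm (z - w) < rho -> h z = pp z + A z.
  by move=> zw zr; rewrite Hw//; congr (_ + _); apply: eq_bigr => k _; rewrite exprVn.
(* The removable singularity at [w] is filled with the value of the analytic
   part. *)
pose h' z := if z == w then A w else h z - pp z.
have far p : p != w -> 0 < nm (p - w) by move=> pw; rewrite nm_gt0 subr_eq0.
have away p z : nm (z - p) < nm (p - w) -> z != w.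
  by move=> zp; apply/eqP => zw; rewrite zw nm_dist ltxx in zp.
have H' : oint h' x0 x1 y0 y1 ((2 * pi)%:C * 'i * \sum_(z <- Z) c z).
  apply: ih => // [z zZ|p pr pZ].
    have [z1 z2 [m' [b' [A' [rho' [AA' rho'0 cb' Hz]]]]]] := HP z (@mem_behead _ (w :: Z) z zZ).
    have zw : z != w by apply: contraNneq wZ => <-.
    split=> //; exists m', b', (fun u => A' u - pp u), (Num.min rho' (nm (z - w))).
    split=> //; first by apply: analyticB => //; exact: App.
      by rewrite lt_min rho'0 far.
    move=> u uz; rewrite lt_min => /andP[ur uw].
    by rewrite /h' (negbTE (away _ _ uw)) Hz// addrA.
  have [->|pw] := eqVneq p w.
    apply: (@analytic_near _ A _ _ rho) => //.
    move=> z zr; rewrite /h'; case: eqVneq => [->//|zw].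
    by rewrite Hw'// addrC addKr.
  apply: (@analytic_near _ (fun z => h z - pp z) _ _ (nm (p - w))); first exact: far.
    by move=> z /away zw; rewrite /h' (negbTE zw).
  apply: analyticB; last exact: App.
  by apply: HA => //; rewrite inE negb_or pw.
have P' : oint pp x0 x1 y0 y1 ((2 * pi)%:C * 'i * c w).
  pose v k : R[i] := if k == 0%N then (2 * pi)%:C * 'i else 0.
  have -> : (2 * pi)%:C * 'i * c w = \sum_(k < m.+1) b k * v k.
    rewrite big_ord_recl big1 ?addr0; first by rewrite cb /v/= mulrC.
    by move=> i _; rewrite /v/= mulr0.
  apply: (@oint_sum m.+1 (fun k z => b k * (z - w)^-1 ^+ k.+1) x0 x1 y0 y1
    (fun k => b k * v k)) => k; apply: ointZ; rewrite /v; case: k => [|k] /=.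
    exact: oint_inv.
  exact: oint_invX.
rewrite big_cons mulrDr.
apply: oint_eq (ointD P' H') => z Hz; rewrite /h'.
case: eqVneq => [zw|_]; last by rewrite addrC subrK.
by exfalso; move: w1 w2; rewrite -zw => /andP[? ?] /andP[? ?]; case: Hz => [|[|[]]] E; move: E; lra.
Qed.

End Residues.

(** * Zeros of the Moran function *)

Section Moran.
Context {R : realType}.
Implicit Types (s z w p u : R[i]) (x c d q M e rho T : R) (a : nat -> R[i]).

Lemma nm_cpow d s : nm (cpow d s) = expR (complex.Re s * ln d).
Proof. by rewrite /cpow nm_cexp; case: s => a b; rewrite /= mulr0 subr0. Qed.

Lemma cpowD d s z : cpow d (s + z) = cpow d s * cpow d z.
Proof. by rewrite /cpow mulrDl cexpD. Qed.

Lemma cpow0 d : cpow d 0 = 1.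
Proof. by rewrite /cpow mul0r cexp0. Qed.

Lemma cpow_neq0 d s : cpow d s != 0. Proof. exact: cexp_neq0. Qed.

Lemma cpowN d s : cpow d (- s) = (cpow d s)^-1.
Proof.
apply: (mulfI (cpow_neq0 d s)).
by rewrite -cpowD subrr cpow0 divff// cpow_neq0.
Qed.

Lemma cpowM d x s : 0 < d -> 0 < x -> cpow (d * x) s = cpow d s * cpow x s.
Proof. by move=> d0 x0; rewrite /cpow lnM// rmorphD/= mulrDr cexpD. Qed.

Lemma cpowV d s : 0 < d -> cpow d^-1 s = (cpow d s)^-1.
Proof. by move=> d0; rewrite -cpowN /cpow lnV// rmorphN/= mulrN mulNr. Qed.

Lemma cpow_nat d n : 0 < d -> cpow d n%:R = (d ^+ n)%:C.
Proof.
move=> d0; elim: n => [|n ih]; first by rewrite cpow0 expr0.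
rewrite -addn1 natrD cpowD ih addn1 exprSr rmorphM/=; congr (_ * _).
by rewrite /cpow mul1r cexp_real lnK.
Qed.

Lemma analytic_cpow d w : analytic (cpow d) w.
Proof. exact: analytic_cexp. Qed.

Lemma ps_sum (I : Type) (r : seq I) (a : I -> nat -> R[i]) w (F : I -> R[i] -> R[i]) :
  (forall i, exists q M, ps (a i) w (F i) q M) ->
  exists q M, ps (fun k => \sum_(i <- r) a i k) w (fun z => \sum_(i <- r) F i z) q M.
Proof.
move=> H; elim: r => [|i r [q [M P]]].
  exists 1, 0; split=> //= [k|z _ n]; first by rewrite big_nil nm0 mul0r.
  rewrite big_nil subr0 /psum big1 ?nm0 ?mulr0 ?mul0r// => k _.
  by rewrite big_nil mul0r.
have [q' [M' P']] := H i.
have P1 := @ps_widen _ _ _ _ _ _ (Num.max q q') M P ltac:(by rewrite le_max lexx) (lexx _).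
have P2 := @ps_widen _ _ _ _ _ _ (Num.max q q') M' P' ltac:(by rewrite le_max lexx orbT) (lexx _).
have := psD P2 P1; set b := (fun k => _); set G := (fun z => _) => PG.
exists (Num.max q q'), (M' + M).
have -> : (fun k => \sum_(j <- i :: r) a j k) = b by apply/funext => k; rewrite big_cons.
by have -> : (fun z => \sum_(j <- i :: r) F j z) = G by apply/funext => z; rewrite big_cons.
Qed.

End Moran.

Section MoranZeros.
Context {R : realType}.
Implicit Types (s z w p u : R[i]) (x c d q M e rho T : R) (a : nat -> R[i]).
Variables (J : nat) (r : 'I_J -> R) (r01 : forall j, 0 < r j < 1).
Variables (D : R) (D_dim : \sum_(j < J) r j `^ D = 1).

Local Notation L j := (ln (r j)).

Lemma ln_ratio_lt0 j : L j < 0. Proof. by rewrite ln_lt0. Qed.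

(** The value of the sum of the powers at a real point, which dominates it on
    the vertical line through that point. *)
Definition rmoran x : R := \sum_(j < J) expR (x * L j).

Lemma rmoran_dim : rmoran D = 1.
Proof.
rewrite -D_dim; apply: eq_bigr => j _.
by rewrite /powR gt_eqF//; have /andP[] := r01 j.
Qed.

Lemma ratio_exists : exists j : 'I_J, True.
Proof.
case: J r D_dim => [|m] r' HD; last by exists ord0.
by move: HD; rewrite big_ord0 => /eqP; rewrite eq_sym oner_eq0.
Qed.

Lemma rmoran_le x y : x <= y -> rmoran y <= rmoran x.
Proof.
move=> xy; apply: ler_sum => j _; rewrite ler_expR.
by rewrite ler_wnM2r// ltW// ln_ratio_lt0.
Qed.

Lemma rmoran_lt x y : x < y -> rmoran y < rmoran x.
Proof.
move=> xy; have [j0 _] := ratio_exists.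
rewrite /rmoran (bigD1 j0)//= [ltRHS](bigD1 j0)//=.
apply: ltr_leD.
  by rewrite ltr_expR ltr_nM2r// ln_ratio_lt0.
apply: ler_sum => j _; rewrite ler_expR.
by rewrite ler_wnM2r ?(ltW xy)// ltW// ln_ratio_lt0.
Qed.

Lemma rmoran_ge0 x : 0 <= rmoran x.
Proof. by apply: sumr_ge0 => j _; exact: expR_ge0. Qed.

Lemma nm_sum_cpow s : nm (\sum_(j < J) cpow (r j) s) <= rmoran (complex.Re s).
Proof.
rewrite (le_trans (nm_sum _ _ _))//; apply: ler_sum => j _.
by rewrite nm_cpow.
Qed.

Lemma moran_right c s : c <= complex.Re s -> 1 - rmoran c <= nm (moran r s).
Proof.
move=> cs; have := nm_tri2 1 (\sum_(j < J) cpow (r j) s).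
have := nm_sum_cpow s; have := rmoran_le cs; rewrite nm1 /moran; lra.
Qed.

Lemma rmoran_lt1 c : D < c -> rmoran c < 1.
Proof. by move=> Dc; rewrite -rmoran_dim; exact: rmoran_lt. Qed.

Lemma expR_small (d X e : R) : 0 < d -> 0 < e -> (e * d)^-1 <= X -> expR (- (X * d)) <= e.
Proof.
move=> d0 e0 Xd; rewrite expRN -[leRHS]invrK lef_pV2 ?posrE ?expR_gt0 ?invr_gt0//.
rewrite (le_trans _ (expR_ge1Dx _))//.
have : e^-1 <= X * d; last by lra.
by rewrite -ler_pdivrMr// -invfM.
Qed.

(** Far to the left the terms with the smallest ratio dominate: together they
    have size at least [r_min ^ x], and every other term is smaller by an
    arbitrarily small factor. *)
Lemma moran_left : exists2 X, 0 < X &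
  forall s, complex.Re s <= - X -> 2^-1 <= nm (moran r s).
Proof.
have [i0 _] := ratio_exists.
have [j0 _ hj0] := @arg_minP _ _ _ i0 xpredT (fun j => L j) isT.
have J0 : 0 < (J%:R : R) by rewrite ltr0n; case: (J) i0 => [[]|].
(* With this [e] the at most [J] other terms sum up to a quarter of the
   dominant one. *)
pose e : R := (4 * J%:R)^-1.
have e0 : 0 < e by rewrite invr_gt0 mulr_gt0.
(* Beyond [- xj j] the [j]-th term is at most [e] times the dominant one, by
   [expR_small]. *)
pose xj j := if L j0 < L j then (e * (L j - L j0))^-1 else 0.
have xj0 j : 0 <= xj j.
  by rewrite /xj; case: ifP => // h; rewrite invr_ge0 mulr_ge0 ?(ltW e0)// subr_ge0 ltW.
have Lj0 := ln_ratio_lt0 j0.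
pose X := \sum_(j < J) xj j + (- L j0)^-1.
have S0 : 0 <= \sum_(j < J) xj j by apply: sumr_ge0 => j _; exact: xj0.
have iL : 0 < (- L j0)^-1 by rewrite invr_gt0 oppr_gt0.
exists X => [|s sX]; first by rewrite /X; lra.
set x := complex.Re s in sX *.
have xX j : xj j <= - x.
  have : \sum_(j < J) xj j >= xj j by rewrite (bigD1 j)//= lerDl sumr_ge0.
  rewrite /X in sX; lra.
pose E := expR (x * L j0).
have E2 : 2 <= E.
  rewrite /E (le_trans _ (expR_ge1Dx _))//.
  have : 1 <= - x * - L j0; last by rewrite mulrNN; lra.
  rewrite -ler_pdivrMr ?oppr_gt0// mul1r.
  rewrite /X in sX; lra.
pose P1 := \sum_(j < J | L j == L j0) cpow (r j) s.
pose P2 := \sum_(j < J | L j != L j0) cpow (r j) s.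
have PE : \sum_(j < J) cpow (r j) s = P1 + P2 by rewrite (bigID (fun j => L j == L j0)).
have n1 : E <= nm P1.
  have -> : P1 = (\sum_(j < J | L j == L j0) 1) * cpow (r j0) s.
    rewrite mulr_suml; apply: eq_bigr => j /eqP Lj.
    by rewrite mul1r /cpow Lj.
  rewrite nmM nm_cpow -/x -/E ler_peMl ?expR_ge0// sumr_const nm_nat ler1n.
  by apply/card_gt0P; exists j0; exact: eqxx.
have n2 : nm P2 <= E / 4.
  rewrite (le_trans (nm_sum _ _ _))//.
  rewrite (@le_trans _ _ (\sum_(j < J) E * e))//; last first.
    have eJ : e * J%:R = 4^-1 by rewrite /e; field; rewrite gt_eqF.
    by rewrite sumr_const card_ord -[leLHS]mulr_natr -mulrA eJ.
  rewrite big_mkcond; apply: ler_sum => j _; case: ifP => [Lj|_]; last first.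
    by rewrite mulr_ge0 ?expR_ge0 ?(ltW e0).
  have Ljj : L j0 < L j by rewrite lt_neqAle eq_sym Lj hj0.
  rewrite nm_cpow -/x (_ : x * L j = x * L j0 + (- ((- x) * (L j - L j0)))); last by ring.
  rewrite expRD ler_wpM2l ?expR_ge0// expR_small ?subr_gt0//.
  by have := xX j; rewrite /xj Ljj.
have t1 := nm_tri2 (P1 + P2) 1; have t2 := nm_tri2 P1 (- P2).
rewrite nmN opprK nm1 in t1 t2.
by rewrite /moran PE nm_dist; lra.
Qed.

Lemma moran_conj s : nm (moran r (conjc s)) = nm (moran r s).
Proof.
have nJ z : nm (conjc z) = nm z by case: z => a b /=; rewrite sqrrN.
rewrite -[RHS]nJ /moran rmorphB rmorph1 rmorph_sum/=.
congr (nm (_ - _)); apply: eq_bigr => j _.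
rewrite -[RHS]/(conjc (cexp (s * (L j)%:C))) -cexp_conj /cpow.
by congr (cexp _); case: s => a b; simpc.
Qed.

Lemma ps_moran w : exists q M,
  ps (fun k => (if k == 0%N then 1 else 0) -
        \sum_(j < J) cexp (w * (L j)%:C) * ((L j)%:C ^+ k / k`!%:R))
    w (moran r) q M.
Proof.
have [q [M P]] := @ps_sum R 'I_J (index_enum _)
  (fun j k => - 1 * (cexp (w * (L j)%:C) * ((L j)%:C ^+ k / k`!%:R))) w
  (fun j z => - 1 * cpow (r j) z)
  (fun j => ex_intro _ _ (ex_intro _ _ (psZ (-1) (ps_cexp (L j)%:C w)))).
have P1 := @ps_widen _ _ _ _ _ _ (Num.max 1 q) _ (ps_cst 1 w) ltac:(by rewrite le_max lexx) (lexx _).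
have P2 := @ps_widen _ _ _ _ _ _ (Num.max 1 q) _ P ltac:(by rewrite le_max lexx orbT) (lexx _).
have P3 := psD P1 P2; do 2 eexists.
set a := (fun k => _) in P3; set F := (fun z => _) in P3.
have -> : moran r = F.
  by apply/funext => z; rewrite /F /moran -mulr_sumr mulN1r.
set b := (fun k => _); suff -> : b = a by exact: P3.
by apply/funext => k; rewrite /a /b -mulr_sumr mulN1r.
Qed.

(** The coefficients of positive order are power sums of the logarithms with
    nonzero weights. If all vanished, every polynomial without constant term
    would have weighted sum zero over the logarithms; the polynomial [p] below
    vanishes at all of them except the value [L j0]. *)
Lemma moran_coef_neq0 w : exists2 k, (0 < k)%N &
  \sum_(j < J) cexp (w * (L j)%:C) * ((L j)%:C ^+ k / k`!%:R) != 0.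
Proof.
have [j0 _] := ratio_exists.
apply: contrapT => H.
have H0 k : (0 < k)%N -> \sum_(j < J) cexp (w * (L j)%:C) * (L j)%:C ^+ k = 0.
  move=> k0; apply/eqP; apply: contrapT => /negP n0; apply: H; exists k => //.
  under eq_bigr do rewrite mulrA.
  by rewrite -mulr_suml mulf_neq0// invr_eq0 pnatr_eq0 -lt0n fact_gt0.
pose p : {poly R[i]} := 'X * \prod_(j < J | L j != L j0) ('X - (L j)%:C%:P).
have : \sum_(j < J) cexp (w * (L j)%:C) * p.[(L j)%:C] = 0.
  under eq_bigr do rewrite horner_coef mulr_sumr.
  rewrite exchange_big/= big1// => k _.
  have [k0|k0] := posnP k.
    rewrite big1// => j _; rewrite k0 /p coefXM eqxx mul0r mulr0//.
  under eq_bigr do rewrite mulrCA.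
  by rewrite -mulr_sumr H0// mulr0.
rewrite (bigID (fun j => L j == L j0))/= [X in _ + X]big1 ?addr0; last first.
  move=> j Lj; rewrite /p hornerM horner_prod (bigD1 j)//= hornerXsubC subrr.
  by rewrite mul0r !mulr0.
rewrite (eq_bigr (fun=> cexp (w * (L j0)%:C) * p.[(L j0)%:C])); last first.
  by move=> j /eqP ->.
rewrite sumr_const => /eqP; rewrite mulrn_eq0 mulf_eq0 (negbTE (cexp_neq0 _))/=.
apply/negP; rewrite negb_or; apply/andP; split.
  by rewrite -lt0n; apply/card_gt0P; exists j0; exact: eqxx.
rewrite /p hornerM hornerX mulf_neq0//.
  by rewrite eq_complex/= eqxx andbT lt_eqF// ln_ratio_lt0.
rewrite horner_prod; apply/prodf_neq0 => j Lj; rewrite hornerXsubC subr_eq0.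
by rewrite eq_complex/= eqxx andbT eq_sym.
Qed.

Lemma moran_ps_neq0 w : exists a q M k, ps a w (moran r) q M /\ a k != 0.
Proof.
have [q [M P]] := ps_moran w; have [k k0 ak] := moran_coef_neq0 w.
do 3 eexists; exists k; split; first exact: P.
by rewrite /= gtn_eqF// sub0r oppr_eq0.
Qed.

Lemma analytic_moran w : analytic (moran r) w.
Proof. by have [a [q [M [_ [P _]]]]] := moran_ps_neq0 w; exists a, q, M. Qed.

Lemma meromorphic_moranV w : meromorphic (fun z => (moran r z)^-1) w.
Proof. by have [a [q [M [k [P ak]]]]] := moran_ps_neq0 w; exact: meromorphicV P ak. Qed.

Lemma moran_isolated w : exists2 rho, 0 < rho &
  forall z, z != w -> nm (z - w) < rho -> moran r z != 0.
Proof.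
have [a [q [M [k [P ak]]]]] := moran_ps_neq0 w.
have [m [g [rho [_ _ rho0 H]]]] := ps_order P ak.
exists rho => // z zw zr; have [-> gz] := H z zr.
by rewrite mulf_neq0// expf_neq0// subr_eq0.
Qed.

(** The zeros are isolated, and finiteness is preserved when rectangles are
    put together. *)
Lemma finite_zeros_rect (x0 x1 y0 y1 : R) :
  finite_set (complex_dimensions r `&` rect x0 x1 y0 y1).
Proof.
have [x01|x10] := leP x0 x1; last first.
  apply: (sub_finite_set (B := set0)) => // z [_ [/= /andP[? ?] _]]; lra.
have [y01|y10] := leP y0 y1; last first.
  apply: (sub_finite_set (B := set0)) => // z [_ [/= _ /andP[? ?]]]; lra.
pose Q (a b c d : R) := finite_set (complex_dimensions r `&` rect a b c d).
apply: (@cousin2 R Q) => //.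
- move=> a b c y y' _ ab bc _ _ yy _; rewrite /Q => H1 H2.
  have H3 := conj H1 H2; rewrite -finite_setU in H3; apply: (sub_finite_set _ H3) => // z [zd [/andP[? ?] ?]].
  by have [?|?] := leP (complex.Re z) b; [left|right]; split=> //; split => //; lra.
- move=> x x' a b c _ xx _ _ ab bc _; rewrite /Q => H1 H2.
  have H3 := conj H1 H2; rewrite -finite_setU in H3; apply: (sub_finite_set _ H3) => // z [zd [? /andP[? ?]]].
  by have [?|?] := leP (complex.Im z) b; [left|right]; split=> //; split => //; lra.
- move=> p q _ _; have [rho rho0 H] := moran_isolated (p +i* q).
  exists (rho / 2); first by rewrite divr_gt0.
  move=> a b c d ? ? ? ? ? ? ? ? ? ?; rewrite /Q.
  apply: (sub_finite_set (B := [set (p +i* q)])) => //.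
  move=> z [zd [/andP[? ?] /andP[? ?]]] /=; apply/eqP; apply: contrapT => /negP zw.
  have := H z zw; rewrite zd eqxx => /(_ _)/negP; case=> //.
  have := nm_ReIm (z - (p +i* q)).
  rewrite !raddfB /= => /le_lt_trans; apply.
  rewrite [ltRHS](splitr rho).
  by apply: ltrD; rewrite ltr_norml; apply/andP; split; lra.
Qed.

Lemma zeros_Re_le s : moran r s = 0 -> complex.Re s <= D.
Proof.
move=> s0; rewrite leNgt; apply/negP => Ds.
by have := moran_right (lexx (complex.Re s)); rewrite s0 nm0; have := rmoran_lt1 Ds; lra.
Qed.

Lemma finite_zeros_strip T : finite_set (complex_dimensions r `&` strip T).
Proof.
have [X X0 HX] := moran_left.
apply: (sub_finite_set _ (finite_zeros_rect (- X) D (- T) T)) => z [z0 zT].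
split=> //; split; last by move: zT; rewrite /strip/= ltr_norml; lra.
rewrite (zeros_Re_le z0) andbT; have [/HX|] := leP (complex.Re z) (- X); last by lra.
by rewrite z0 nm0; lra.
Qed.

End MoranZeros.

(** * Existence of admissible heights *)

Section Heights.
Context {R : realType}.
Implicit Types (s z w p u : R[i]) (x c d q M e rho T B : R).

(** Simultaneous approximation by the pigeonhole principle: among the
    multiples [m B] two have all their phases in the same cells, and their
    difference [t] nearly fixes all phases. *)
Lemma cis_pigeonhole (J : nat) (th : 'I_J -> R) (e B : R) : 0 < e -> 0 < B ->
  exists2 t, B <= t & forall j, nm (cexp ('i * (t * th j)%:C) - 1) <= e.
Proof.
move=> e0 B0.
(* Cells of width [1 / N] for the real and for the imaginary parts. *)
have [N N0 Ne] : exists2 N, (0 < N)%N & 2 / N%:R <= e.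
  exists (Num.truncn (2 / e)).+1 => //.
  have := @Num.Theory.truncnS_gt R (2 / e); rewrite ltr_pdivrMr// => /ltW H.
  by rewrite ler_pdivrMr ?ltr0n// mulrC.
have NR : 0 < (N%:R : R) by rewrite ltr0n.
pose E (m : nat) j : R[i] := cexp ('i * (m%:R * B * th j)%:C).
have reE m j : complex.Re (E m j) = cos (m%:R * B * th j).
  by rewrite /E /cexp; simpc; rewrite /= expR0 mul1r.
have imE m j : complex.Im (E m j) = sin (m%:R * B * th j).
  by rewrite /E /cexp; simpc; rewrite /= expR0 mul1r.
have trE (x : R) : -1 <= x <= 1 -> let k := Num.truncn (N%:R * (1 + x)) in
    (k < (2 * N).+1)%N /\ k%:R <= N%:R * (1 + x) < k.+1%:R.
  move=> /andP[x1 x2] k; have X0 : 0 <= N%:R * (1 + x) by rewrite mulr_ge0//; lra.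
  split; last exact: truncn_itv.
  rewrite ltnS truncn_le_nat (@le_lt_trans _ _ (2 * N)%:R)//; last by rewrite ltr_nat.
  by rewrite natrM [leRHS]mulrC ler_wpM2l//; lra.
pose tr (x : R) : 'I_(2 * N).+1 := inord (Num.truncn (N%:R * (1 + x))).
have tr_close (x y : R) : -1 <= x <= 1 -> -1 <= y <= 1 -> tr x = tr y ->
    `|x - y| <= N%:R^-1.
  move=> /trE[kx /andP[x1 x2]] /trE[ky /andP[y1 y2]] /(congr1 val).
  rewrite /tr /= !inordK// => xy; rewrite xy -natr1 in x1 x2; rewrite -natr1 in y2.
  rewrite -[leRHS]mul1r ler_pdivlMr// -[X in _ * X](ger0_norm (ltW NR)) -normrM.
  by rewrite ler_norml; apply/andP; split; lra.
pose cell (m : nat) : {ffun 'I_J -> 'I_(2 * N).+1 * 'I_(2 * N).+1} :=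
  [ffun j => (tr (complex.Re (E m j)), tr (complex.Im (E m j)))].
pose K := #|{: {ffun 'I_J -> 'I_(2 * N).+1 * 'I_(2 * N).+1}}|.
have [m [m' [mm cm]]] : exists m m' : nat, (m < m')%N /\ cell m = cell m'.
  have /injectivePn[a [b ab cab]] : ~~ injectiveb (fun m : 'I_K.+1 => cell m).
    apply/negP => /injectiveP/leq_card; rewrite card_ord -/K.
    by rewrite ltnn.
  have [ltab|ltba|/val_inj eab] := ltngtP a b.
  - by exists a, b.
  - by exists b, a.
  - by rewrite eab eqxx in ab.
exists ((m' - m)%:R * B).
  by rewrite ler_peMl ?(ltW B0)// ler1n subn_gt0.
move=> j.
have cmj := congr1 (fun f : {ffun _ -> _} => f j) cm.
rewrite !ffunE in cmj; case: cmj => cR cI.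
have bR k : -1 <= complex.Re (E k j) <= 1 by rewrite reE cos_le1 cos_geN1.
have bI k : -1 <= complex.Im (E k j) <= 1 by rewrite imE sin_le1 sin_geN1.
have {}cR := tr_close _ _ (bR m) (bR m') cR.
have {}cI := tr_close _ _ (bI m) (bI m') cI.
have nE : nm (E m j) = 1 by rewrite /E nm_cexp; simpc; rewrite /= expR0.
have -> : cexp ('i * ((m' - m)%:R * B * th j)%:C) - 1 = (E m' j - E m j) / E m j.
  rewrite mulrBl divff; last by rewrite cexp_neq0.
  congr (_ - 1); apply: (mulIf (cexp_neq0 ('i * (m%:R * B * th j)%:C))).
  rewrite -/(E m j) mulfVK; last by rewrite cexp_neq0.
  rewrite /E -cexpD -mulrDr -rmorphD/=; congr (cexp (_ * _%:C)).
  by rewrite natrB ?(ltnW mm)//; ring.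
rewrite nmM nmV nE invr1 mulr1 nm_dist (le_trans (nm_ReIm _))//.
rewrite [complex.Re _]raddfB [complex.Im _]raddfB (le_trans _ Ne)//.
rewrite (_ : 2 / N%:R = N%:R^-1 + N%:R^-1); first exact: lerD.
by rewrite mulrDl mul1r.
Qed.

Lemma avoid_finite (s : seq R) : exists2 y : R, 0 < y < 1 & y \notin s.
Proof.
suff [y y01 hy] : exists2 y : R, 0 < y < 1 & forall a, a \in s -> 0 < a -> y < a.
  exists y => //; apply/negP => /hy; have /andP[y0 _] := y01.
  by move=> /(_ y0); rewrite ltxx.
elim: s => [|a s [y /andP[y0 y1] hy]]; first by exists 2^-1 => //; apply/andP; split; lra.
have [a0|a0] := ltP 0 a.
  exists (Num.min y (a / 2)).
    by rewrite lt_min y0 divr_gt0//= gt_min y1.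
  move=> b; rewrite inE => /orP[/eqP->|bs] b0; first by rewrite gt_min; apply/orP; right; lra.
  by rewrite gt_min hy.
exists y; first by rewrite y0.
by move=> b; rewrite inE => /orP[/eqP->|bs] b0; [lra|exact: hy].
Qed.

Variables (J : nat) (r : 'I_J -> R) (r01 : forall j, 0 < r j < 1).
Variables (D : R) (D_dim : \sum_(j < J) r j `^ D = 1).

(** Only finitely many zeros have imaginary part in [0, 1] and real part in
    the range not covered by [moran_left] and [moran_right]; a height that
    avoids them gives a positive minimum over that compact range. *)
Lemma exists_zero_free_line : exists y0 : R, exists2 m : R, 0 < m &
  forall x : R, m <= nm (moran r (x +i* y0)).
Proof.
have [X X0 HX] := moran_left r01 D_dim.
pose c := D + 1.
have c1 : rmoran r c < 1 by apply: (rmoran_lt1 r01 D_dim); rewrite /c; lra.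
have /finite_seqP[Z HZ] := finite_zeros_rect r01 D_dim (- X) c 0 1.
have [y /andP[y0 y1] yZ] := avoid_finite (map (@complex.Im R) Z).
exists y.
have nz (x : R) : - X <= x <= c -> moran r (x +i* y) != 0.
  move=> xX; apply: contra yZ => /eqP zx; apply/mapP; exists (x +i* y) => //.
  have : (complex_dimensions r `&` rect (- X) c 0 1) (x +i* y).
    by split=> //; split=> //=; lra.
  by rewrite HZ.
have [m m0 Hm] : exists2 m : R, 0 < m &
    forall x, - X <= x <= c -> m <= nm (moran r (x +i* y)).
  have [Xc|cX] := leP (- X) c; last by exists 1 => // x /andP[? ?]; lra.
  pose Q (a b : R) := exists2 m : R, 0 < m & forall x, a <= x <= b -> m <= nm (moran r (x +i* y)).
  apply: (@cousin R Q) => // [a b d _ ab bd _ [m m0 Hm] [m' m'0 Hm']|p pX].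
    exists (Num.min m m'); first by rewrite lt_min m0.
    move=> x /andP[ax xd]; rewrite ge_min.
    have [xb|bx] := leP x b; first by rewrite Hm// ax.
    by rewrite Hm' ?orbT// xd (ltW bx).
  have [rho rho0 [K K0 HK]] := analytic_lip (analytic_moran r01 D_dim (p +i* y)).
  set v := nm (moran r (p +i* y)).
  have v0 : 0 < v by rewrite nm_gt0 nz.
  exists (Num.min rho (v / (2 * K))).
    by rewrite lt_min rho0 divr_gt0// mulr_gt0.
  move=> a b _ ap pb _; rewrite lt_min => /andP[ba1 ba2].
  exists (v / 2); first by rewrite divr_gt0.
  move=> x /andP[ax xb].
  have E : nm (x +i* y - (p +i* y)) = `|x - p|.
    by rewrite -nmR; congr nm; simpc.
  have xp : `|x - p| <= b - a by rewrite ler_norml; apply/andP; split; lra.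
  have := HK (x +i* y); rewrite E => /(_ (le_lt_trans xp ba1)).
  have : K * `|x - p| <= v / 2.
    rewrite (le_trans (ler_wpM2l (ltW K0) (le_trans xp (ltW ba2))))//.
    by rewrite [leLHS](_ : _ = v / 2) //; field; rewrite gt_eqF.
  have := nm_tri2 (moran r (p +i* y)) (moran r (x +i* y)).
  rewrite nm_dist -/v; lra.
exists (Num.min m (Num.min (2^-1) (1 - rmoran r c))).
  by rewrite !lt_min m0 invr_gt0 ltr0n/=; lra.
move=> x; rewrite !ge_min.
have [xX|Xx] := leP x (- X); first by rewrite (HX (x +i* y))// orbT.
have [cx|xc] := leP c x; first by rewrite (@moran_right _ _ _ r01 c (x +i* y))// !orbT.
by rewrite Hm//; apply/andP; split; lra.
Qed.

(** Moving the zero-free line up by an almost period [t k] of all the [r_j ^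
    (i t)] changes [moran] by at most half its lower bound where the real part
    exceeds [- X]; elsewhere the half-plane bounds apply. *)
Lemma exists_admissible_heights : exists tau, admissible_heights r tau.
Proof.
have [y0 [m m0 Hm]] := exists_zero_free_line.
have [X X0 HX] := moran_left r01 D_dim.
pose c := D + 1.
have c1 : rmoran r c < 1 by apply: (rmoran_lt1 r01 D_dim); rewrite /c; lra.
(* The powers have total size at most [P] when the real part exceeds [- X],
   so phases within [m / (2 P)] change [moran] by at most [m / 2]. *)
pose P := rmoran r (- X) + 1.
have P0 : 0 < P by have := rmoran_ge0 r (- X); rewrite /P; lra.
have e0 : 0 < m / 2 / P by rewrite !divr_gt0.
have /choice[t ht] : forall k : nat, exists t : R, k.+1%:R <= t /\
    forall j, nm (cexp ('i * (t * ln (r j))%:C) - 1) <= m / 2 / P.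
  move=> k; have [t kt H] := @cis_pigeonhole J (fun j => ln (r j)) _ k.+1%:R e0 ltac:(by rewrite ltr0n).
  by exists t.
exists (fun k => y0 + t k); split.
  apply/cvgryPge => A; exists (Num.truncn (A - y0)).+1 => // k /= Ak.
  have [kt _] := ht k.
  have h1 := @Num.Theory.truncnS_gt R (A - y0).
  have : (Num.truncn (A - y0)).+1%:R <= k.+1%:R :> R by rewrite ler_nat ltnW.
  lra.
exists (Num.min (m / 2) (Num.min (2^-1) (1 - rmoran r c))).
  by rewrite !lt_min divr_gt0// invr_gt0 ltr0n/=; lra.
move=> k x; rewrite normE lecR !ge_min.
have [xX|Xx] := leP x (- X); first by rewrite (HX (x +i* _))// orbT.
have [cx|xc] := leP c x; first by rewrite (@moran_right _ _ _ r01 c (x +i* _))// !orbT.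
apply/orP; left.
have [_ hj] := ht k.
have E : moran r (x +i* y0) - moran r (x +i* (y0 + t k)) =
    \sum_(j < J) cpow (r j) (x +i* y0) * (cexp ('i * (t k * ln (r j))%:C) - 1).
  rewrite /moran opprB addrC addrA subrK -sumrB; apply: eq_bigr => j _.
  rewrite mulrBr mulr1; congr (_ - _).
  rewrite /cpow -cexpD (_ : (x +i* (y0 + t k)) * (ln (r j))%:C =
    (x +i* y0) * (ln (r j))%:C + 'i * (t k * ln (r j))%:C)//.
  by simpc; congr (_ +i* _); ring.
have : nm (moran r (x +i* y0) - moran r (x +i* (y0 + t k))) <= m / 2.
  rewrite E (le_trans (nm_sum _ _ _))//.
  rewrite (@le_trans _ _ (\sum_(j < J) expR (x * ln (r j)) * (m / 2 / P)))//.
    by apply: ler_sum => j _; rewrite nmM nm_cpow ler_wpM2l ?expR_ge0.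
  rewrite -mulr_suml -/(rmoran r x).
  have : rmoran r x <= P by have := rmoran_le r01 (ltW Xx); rewrite /P; lra.
  move=> /(ler_wpM2r (ltW e0))/le_trans; apply.
  by rewrite mulrC mulfVK ?gt_eqF.
have := nm_tri2 (moran r (x +i* y0)) (moran r (x +i* (y0 + t k))).
have := Hm x; lra.
Qed.

End Heights.

(** * Moving a vertical line of integration *)

Section Shift.
Context {R : realType}.
Implicit Types (s z w p u v S : R[i]) (h E B : R[i] -> R[i]) (x c q M K e rho T X : R).

Lemma polar_simple E B h w rho : analytic E w -> analytic B w -> 0 < rho ->
  (forall z, z != w -> nm (z - w) < rho -> h z = E z / (z - w) + B z) ->
  polar h w (E w).
Proof.
move=> [a [q [M P]]] AB rho0 H.
have P' := ps_shift 1 P; set A := (fun z => _) in P'.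
have AA : analytic A w by do 3 eexists; exact: P'.
exists 0%N, (fun=> E w), (fun z => A z + B z), rho; split=> //.
  exact: analyticD.
move=> z zw zr; rewrite big_ord1 expr1 H// addrA; congr (_ + _).
rewrite /A (negbTE zw) expr1 /psum big_ord1 expr0 mulr1 (ps_center P).
by rewrite -mulrDl [a 0%N + _]addrC subrK.
Qed.

(** The majorant [K / (t^2 + T^2)] has the antiderivative [K atan (t / T) /
    T], so the bound does not depend on the length of the edge. *)
Lemma horizontal_bound h (y x0 x1 : R) v K T : 0 < T -> 0 <= K -> x0 <= x1 ->
  `|y| = T -> hor h y x0 x1 v ->
  (forall t, x0 <= t <= x1 -> nm (h (t +i* y)) <= K / nm (t +i* y) ^+ 2) ->
  nm v <= K * pi / T.
Proof.
move=> T0 K0 x01 yT Hv Hb.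
have := @is_int_bound R _ _ _ v (fun t => K * (atan ((t - 0) / T) / T))
  (fun t => K * ((T / (T ^+ 2 + (t - 0) ^+ 2)) / T)) x01 Hv.
move=> H; apply: (le_trans (H _ _)) => [t tx|t tx|].
- have H1 := is_derive_atan_div 0 t (lt0r_neq0 T0).
  have H2 := is_deriveM H1 (is_derive_cst (T^-1 : R) t 1).
  have H3 := is_deriveM (is_derive_cst (K : R) t 1) H2.
  apply: is_derive_eq H3 _.
  by rewrite /GRing.scale /cst /=; ring.
- rewrite (le_trans (Hb t tx))// ler_wpM2l//.
  rewrite mulrAC divff ?gt_eqF// mul1r subr0 /= sqr_sqrtr ?addr_ge0 ?sqr_ge0//.
  by rewrite -yT -normrX ger0_norm ?sqr_ge0// addrC.
rewrite -mulrBr -mulrA ler_wpM2l// -mulrBl ler_pM2r ?invr_gt0//.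
have := atan_ltpi2 ((x1 - 0) / T); have := atan_gtNpi2 ((x0 - 0) / T); lra.
Qed.

Lemma inv_sqr_le K s (t : R) : 0 <= K -> 0 < t -> t <= nm s -> K / nm s ^+ 2 <= K / t ^+ 2.
Proof.
move=> K0 t0 ts; rewrite ler_wpM2l// lef_pV2 ?posrE ?exprn_gt0//; last exact: lt_le_trans ts.
by apply: lerXn2r; rewrite ?nnegrE ?(ltW t0)// (le_trans (ltW t0)).
Qed.

Lemma vertical_bound h (x : R) v K T : 0 < T -> 0 <= K -> 2 * T <= `|x| ->
  ver h x (- T) T v ->
  (forall t, - T <= t <= T -> nm (h (x +i* t)) <= K / nm (x +i* t) ^+ 2) ->
  nm v <= K / T.
Proof.
move=> T0 K0 xT Hv Hb.
have := @is_int_bound_const R _ _ _ v (K / (2 * T) ^+ 2) _ Hv.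
have TT : - T <= T by lra.
move=> /(_ TT)H; rewrite (le_trans (H _))//.
  move=> t tT; rewrite (le_trans (Hb t tT))// inv_sqr_le// ?mulr_gt0//.
  by rewrite (le_trans xT)//; exact: (nm_Re (x +i* t)).
rewrite [leLHS](_ : _ = K / T / 2); last by field; rewrite gt_eqF.
by rewrite ler_pdivrMr// ler_peMr ?divr_ge0 ?(ltW T0)//; lra.
Qed.

(** The residue theorem on a rectangle of height [2 T]: decay like [1 / |s|^2]
    makes the horizontal edges of order [1 / T]. *)
Lemma strip_shift (c : R[i] -> R[i]) (Z : seq R[i]) h (x0 x1 K T : R) :
  0 < T -> 0 <= K -> x0 <= x1 -> uniq Z ->
  (forall w, w \in Z -> [/\ x0 < complex.Re w < x1, `|complex.Im w| < T
     & polar h w (c w)]) ->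
  (forall p, x0 <= complex.Re p <= x1 -> `|complex.Im p| <= T -> p \notin Z ->
     analytic h p) ->
  (forall s, x0 <= complex.Re s <= x1 -> `|complex.Im s| = T ->
     nm (h s) <= K / nm s ^+ 2) ->
  exists vr vl, [/\ ver h x1 (- T) T vr, ver h x0 (- T) T vl &
    nm (vr - vl - (2 * pi)%:C * \sum_(w <- Z) c w) <= 2 * (K * pi / T)].
Proof.
move=> T0 K0 x01 uZ HP HA HB; have TT : - T <= T by lra.
have [||vb [vr [vt [vl [H1 H2 H3 H4 E]]]]] := @oint_residues R c Z h x0 x1 (- T) T x01 TT uZ.
- by move=> w /HP[? + ?]; rewrite ltr_norml => ?.
- by move=> p [pr pi'] pZ; apply: HA => //; rewrite ler_norml.
exists vr, vl; split=> //.
have b1 : nm vb <= K * pi / T.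
  apply: horizontal_bound H1 _ => // [|t tx]; first by rewrite normrN gtr0_norm.
  by apply: HB => //=; rewrite normrN gtr0_norm.
have b2 : nm vt <= K * pi / T.
  apply: horizontal_bound H3 _ => // [|t tx]; first by rewrite gtr0_norm.
  by apply: HB => //=; rewrite gtr0_norm.
set S := \sum_(w <- Z) c w in E *.
have -> : vr - vl - (2 * pi)%:C * S = - 'i * (vt - vb).
  have -> : vt = vb + 'i * vr - 'i * vl - (2 * pi)%:C * 'i * S by rewrite E; ring.
  have ii : 'i * 'i = -1 :> R[i] by simpc.
  rewrite (_ : - 'i * _ = - ('i * 'i) * (vr - vl - (2 * pi)%:C * S)); last by ring.
  by rewrite ii opprK mul1r.
rewrite nmM nmN nmi mul1r (le_trans (nmB _ _))//; lra.
Qed.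

(** The far vertical edge is put at distance at least [2 T], where it
    contributes at most [K / T]. *)
Lemma shift_left (c : R[i] -> R[i]) (Z : seq R[i]) h (x1 X K T : R) :
  0 < T -> 0 <= K -> uniq Z ->
  (forall w, w \in Z -> [/\ - X < complex.Re w < x1, `|complex.Im w| < T
     & polar h w (c w)]) ->
  (forall p, complex.Re p <= x1 -> `|complex.Im p| <= T -> p \notin Z ->
     analytic h p) ->
  (forall s, complex.Re s <= x1 -> `|complex.Im s| = T ->
     nm (h s) <= K / nm s ^+ 2) ->
  (forall s, complex.Re s <= - X -> nm (h s) <= K / nm s ^+ 2) ->
  exists2 v, ver h x1 (- T) T v &
    nm (v - (2 * pi)%:C * \sum_(w <- Z) c w) <= K * (2 * pi + 1) / T.
Proof.
move=> T0 K0 uZ HP HA HB HL.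
pose Y := Num.max X (Num.max (2 * T) (- x1)).
have [YX YT Yx] : [/\ X <= Y, 2 * T <= Y & - x1 <= Y].
  by split; rewrite /Y !le_max lexx ?orbT.
have [||||vr [vl [H1 H2 H3]]] := @strip_shift c Z h (- Y) x1 K T T0 K0 _ uZ.
- by lra.
- by move=> w /HP[/andP[? ?] ? ?]; split=> //; apply/andP; split; lra.
- by move=> p /andP[_ ?]; exact: HA.
- by move=> s /andP[_ ?]; exact: HB.
exists vr => //.
have b : nm vl <= K / T.
  apply: vertical_bound H2 _ => //; first by rewrite normrN ger0_norm; lra.
  by move=> t _; apply: HL => /=; lra.
have -> : vr - (2 * pi)%:C * \sum_(w <- Z) c w =
  (vr - vl - (2 * pi)%:C * \sum_(w <- Z) c w) + vl by ring.
by rewrite (le_trans (nmD _ _))//; lra.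
Qed.

Lemma shift_right (c : R[i] -> R[i]) (Z : seq R[i]) h (x0 X K T : R) :
  0 < T -> 0 <= K -> uniq Z ->
  (forall w, w \in Z -> [/\ x0 < complex.Re w < X, `|complex.Im w| < T
     & polar h w (c w)]) ->
  (forall p, x0 <= complex.Re p -> `|complex.Im p| <= T -> p \notin Z ->
     analytic h p) ->
  (forall s, x0 <= complex.Re s -> `|complex.Im s| = T ->
     nm (h s) <= K / nm s ^+ 2) ->
  (forall s, X <= complex.Re s -> nm (h s) <= K / nm s ^+ 2) ->
  exists2 v, ver h x0 (- T) T v &
    nm (v - (2 * pi)%:C * - \sum_(w <- Z) c w) <= K * (2 * pi + 1) / T.
Proof.
move=> T0 K0 uZ HP HA HB HL.
pose Y := Num.max X (Num.max (2 * T) x0).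
have [YX YT Yx] : [/\ X <= Y, 2 * T <= Y & x0 <= Y].
  by split; rewrite /Y !le_max lexx ?orbT.
have [||||vr [vl [H1 H2 H3]]] := @strip_shift c Z h x0 Y K T T0 K0 _ uZ.
- by lra.
- by move=> w /HP[/andP[? ?] ? ?]; split=> //; apply/andP; split; lra.
- by move=> p /andP[? _]; exact: HA.
- by move=> s /andP[? _]; exact: HB.
exists vl => //.
have b : nm vr <= K / T.
  apply: vertical_bound H1 _ => //; first by rewrite ger0_norm; lra.
  by move=> t _; apply: HL => /=; lra.
have -> : vl - (2 * pi)%:C * - \sum_(w <- Z) c w =
  vr - (vr - vl - (2 * pi)%:C * \sum_(w <- Z) c w) by ring.
by rewrite (le_trans (nmB _ _))//; lra.
Qed.

End Shift.

(** * The numerator of the zeta function *)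

Section SprayZeta.
Context {R : realType}.
Implicit Types (s z w p u v : R[i]) (h E B M : R[i] -> R[i]) (x c q K e T X F : R).

Lemma natC_Re i : complex.Re (i%:R : R[i]) = i%:R.
Proof. by rewrite -(rmorph_nat (real_complex R)). Qed.

Lemma natC_Im i : complex.Im (i%:R : R[i]) = 0.
Proof. by rewrite -(rmorph_nat (real_complex R)). Qed.

Lemma ReB z w : complex.Re (z - w) = complex.Re z - complex.Re w.
Proof. by case: z w => [? ?] [? ?]. Qed.

Lemma ImB z w : complex.Im (z - w) = complex.Im z - complex.Im w.
Proof. by case: z w => [? ?] [? ?]. Qed.

(** The integral of [h (c + i t)] over all real [t] is [2 pi F], with an error
    inversely proportional to the height of truncation. *)
Definition vertical_limit c h F := exists K, forall T, 1 <= T ->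
  exists2 v, ver h c (- T) T v & nm (v - (2 * pi * F)%:C) <= K / T.

Lemma vertical_limit_eq c h h' F :
  (forall t : R, h (c +i* t) = h' (c +i* t)) ->
  vertical_limit c h F -> vertical_limit c h' F.
Proof.
move=> hh' [K H]; exists K => T T1; have [v Hv vK] := H T T1.
by exists v => //; apply: is_int_eq Hv => t _.
Qed.

Lemma vertical_limitD c h h' F F' : vertical_limit c h F -> vertical_limit c h' F' ->
  vertical_limit c (fun z => h z + h' z) (F + F').
Proof.
move=> [K H] [K' H']; exists (K + K') => T T1.
have [v Hv vK] := H T T1; have [v' Hv' vK'] := H' T T1.
exists (v + v'); first exact: is_intD.
have -> : v + v' - (2 * pi * (F + F'))%:C =
  (v - (2 * pi * F)%:C) + (v' - (2 * pi * F')%:C) by rewrite mulrDr rmorphD/=; ring.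
by rewrite (le_trans (nmD _ _))// [leRHS]mulrDl lerD.
Qed.

Lemma vertical_limit_sum (I : Type) (l : seq I) c (h : I -> R[i] -> R[i]) (F : I -> R) :
  (forall i, vertical_limit c (h i) (F i)) ->
  vertical_limit c (fun z => \sum_(i <- l) h i z) (\sum_(i <- l) F i).
Proof.
move=> H; elim: l => [|i l ih].
  exists 0 => T T1; exists 0; last by rewrite big_nil mulr0 subr0 nm0 mul0r.
  by apply: is_int_eq (is_int0 _ _) => t _; rewrite big_nil.
rewrite big_cons; apply: vertical_limit_eq (vertical_limitD (H i) ih) => t.
by rewrite big_cons.
Qed.

Variables (n : nat) (kappa : nat -> R) (g : R) (g0 : 0 < g).
Hypothesis balance : \sum_(i < n.+1) kappa i / g ^+ i = 0.

Definition zeta_num s : R[i] :=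
  \sum_(i < n.+1) (kappa i)%:C * (cpow g (s - i%:R) / (s - i%:R)).

Definition off_nodes s := forall i : 'I_n.+1, 1 <= nm (s - i%:R).

Lemma off_nodes_Im s : 1 <= `|complex.Im s| -> off_nodes s.
Proof.
move=> s1 i; rewrite (le_trans s1)//.
by have := nm_Im (s - i%:R); rewrite ImB natC_Im subr0.
Qed.

Lemma off_nodes_left s : complex.Re s <= -1 -> off_nodes s.
Proof.
move=> s1 i; have := nm_Re (s - i%:R); rewrite ReB natC_Re.
have i0 : (0 : R) <= i%:R by [].
by rewrite ler0_norm; lra.
Qed.

Lemma off_nodes_right s : n%:R + 1 <= complex.Re s -> off_nodes s.
Proof.
move=> s1 i; have := nm_Re (s - i%:R); rewrite ReB natC_Re.
have i_n : (i%:R : R) <= n%:R by rewrite ler_nat -ltnS.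
by rewrite ger0_norm; lra.
Qed.

Lemma cpow_subn s i : cpow g (s - i%:R) = cpow g s * (g ^+ i)^-1%:C.
Proof. by rewrite cpowD cpowN cpow_nat// fmorphV. Qed.

(** The balance condition cancels the leading [1 / s] terms: [1 / (s - i)] can
    be replaced by [1 / (s - i) - 1 / s = i / (s (s - i))]. *)
Lemma zeta_num_bound : exists2 K, 0 <= K & forall s, off_nodes s ->
  nm (zeta_num s) <= K * expR (complex.Re s * ln g) / nm s ^+ 2.
Proof.
pose K := \sum_(i < n.+1) `|kappa i / g ^+ i| * (n%:R * (1 + n%:R)).
have K0 : 0 <= K by apply: sumr_ge0 => i _; rewrite !mulr_ge0.
exists K => // s off.
have s1 : 1 <= nm s by have := off ord0; rewrite subr0.
have s0 : s != 0 by rewrite -nm_gt0; lra.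
have ns0 : 0 < nm s by lra.
have -> : zeta_num s = cpow g s *
    \sum_(i < n.+1) (kappa i / g ^+ i)%:C * (i%:R / (s * (s - i%:R))).
  have -> : \sum_(i < n.+1) (kappa i / g ^+ i)%:C * (i%:R / (s * (s - i%:R))) =
      \sum_(i < n.+1) (kappa i / g ^+ i)%:C / (s - i%:R).
    apply/eqP; rewrite -subr_eq0 -sumrB.
    rewrite (eq_bigr (fun i : 'I_n.+1 => - s^-1 * (kappa i / g ^+ i)%:C)); last first.
      move=> i _; have si : s - i%:R != 0 by rewrite -nm_gt0 (lt_le_trans _ (off i)).
      by move: (kappa i / g ^+ i)%:C => a; field; rewrite si s0.
    by rewrite -mulr_sumr -rmorph_sum balance mulr0.
  rewrite mulr_sumr; apply: eq_bigr => i _.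
  by rewrite cpow_subn rmorphM/=; ring.
rewrite nmM nm_cpow [K * _]mulrC -mulrA ler_wpM2l ?expR_ge0//.
rewrite (le_trans (nm_sum _ _ _))// /K mulr_suml; apply: ler_sum => i _.
rewrite nmM nmR -[leRHS]mulrA ler_wpM2l// nmM nmV nmM nm_nat.
have si := off i.
(* The distance of [s] to the node is at least 1, so [nm s <= nm (s - i) + n]
   is at most [1 + n] times this distance. *)
have ni : nm s <= (1 + n%:R) * nm (s - i%:R).
  have := nmD (s - i%:R) i%:R; rewrite subrK nm_nat.
  have : (i%:R : R) <= n%:R by rewrite ler_nat -ltnS.
  have : (0 : R) <= n%:R by [].
  nra.
have nsi : 0 < nm (s - i%:R) by lra.
have iN : (i%:R : R) <= n%:R by rewrite ler_nat -ltnS.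
have E2 : (nm s * nm (s - i%:R))^-1 <= (1 + n%:R) / nm s ^+ 2.
  rewrite invfM expr2 invfM mulrCA ler_wpM2l ?invr_ge0 ?(ltW ns0)//.
  by rewrite -[leLHS]mul1r ler_pdivrMr// mulrAC ler_pdivlMr// mul1r.
rewrite -[leRHS]mulrA; apply: ler_pM => //.
by rewrite invr_ge0 mulr_ge0 ?(ltW ns0) ?(ltW nsi).
Qed.

Lemma analytic_cpow_sub x w p : analytic (fun z => cpow x (z - w)) p.
Proof.
apply: (@analytic_ext _ (fun z => cpow x z * cpow x (- w))).
  by move=> z; rewrite -cpowD.
by apply: analyticM; [exact: analytic_cpow|exact: analytic_cst].
Qed.

Lemma analytic_cpow_opp x p : analytic (fun z => cpow x (- z)) p.
Proof.
apply: (@analytic_ext _ (fun z => cexp (z * (- ln x)%:C))).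
  by move=> z; rewrite /cpow rmorphN/= mulrN mulNr.
exact: analytic_cexp.
Qed.

Lemma analytic_node i p : p != i%:R ->
  analytic (fun z => (kappa i)%:C * (cpow g (z - i%:R) / (z - i%:R))) p.
Proof.
move=> pi'; apply: analyticM; first exact: analytic_cst.
apply: analyticM; first exact: analytic_cpow_sub.
apply: analyticV; last by rewrite subr_eq0.
by apply: analyticB; [exact: analytic_id|exact: analytic_cst].
Qed.

Lemma analytic_zeta_num p : (forall i : 'I_n.+1, p != i%:R) -> analytic zeta_num p.
Proof. by move=> H; apply: analytic_sum => i; exact: analytic_node. Qed.

Lemma meromorphic_zeta_num p : meromorphic zeta_num p.
Proof.
apply: meromorphic_sum => i.
have [->|pi'] := eqVneq p i%:R; last by apply: analytic_meromorphic; exact: analytic_node.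
apply: meromorphicM; first by apply: analytic_meromorphic; exact: analytic_cst.
apply: meromorphicM; first by apply: analytic_meromorphic; exact: analytic_cpow_sub.
exists 1%N, (fun=> 1), 1; split=> //; first exact: analytic_cst.
by move=> z zi _; rewrite expr1 mulVf// subr_eq0.
Qed.

Lemma polar_zeta_num M (i : 'I_n.+1) : analytic M i%:R ->
  polar (fun z => zeta_num z * M z) i%:R ((kappa i)%:C * M i%:R).
Proof.
move=> AM.
pose E z := (kappa i)%:C * cpow g (z - i%:R) * M z.
pose B z := (\sum_(j < n.+1 | j != i)
  (kappa j)%:C * (cpow g (z - j%:R) / (z - j%:R))) * M z.
have -> : (kappa i)%:C * M i%:R = E i%:R by rewrite /E subrr cpow0 mulr1.
apply: (@polar_simple R E B _ _ 1) => //.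
- apply: analyticM => //; apply: analyticM; first exact: analytic_cst.
  exact: analytic_cpow_sub.
- apply: analyticM => //.
  apply: (@analytic_ext _ (fun z => \sum_(j < n.+1) if j != i then
    (kappa j)%:C * (cpow g (z - j%:R) / (z - j%:R)) else 0)).
    by move=> z; rewrite -big_mkcond.
  apply: analytic_sum => j; case: eqVneq => ji; first exact: analytic_cst.
  by apply: analytic_node; rewrite eqr_nat eq_sym.
- move=> z zi _; rewrite /zeta_num (bigD1 i)//= mulrDl -/(B z); congr (_ + _).
  by rewrite /E; ring.
Qed.

Lemma zeta_num_decay_left x c : 0 < x -> x <= g -> exists2 K, 0 <= K &
  forall s, complex.Re s <= c -> off_nodes s ->
    nm (zeta_num s * cpow x (- s)) <= K / nm s ^+ 2.
Proof.
move=> x0 xg; have [K K0 HK] := zeta_num_bound.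
exists (K * expR (c * (ln g - ln x))); first by rewrite mulr_ge0 ?expR_ge0.
move=> s sc off; rewrite nmM cpowN nmV nm_cpow -expRN.
rewrite (le_trans (ler_wpM2r (expR_ge0 _) (HK s off)))//.
rewrite mulrAC ler_wpM2r ?invr_ge0 ?exprn_ge0 ?nm_ge0//.
rewrite -mulrA -expRD ler_wpM2l// ler_expR -mulrBr ler_wpM2r// subr_ge0.
by rewrite ler_ln.
Qed.

Lemma zeta_num_decay_right x c : 0 < x -> g <= x -> exists2 K, 0 <= K &
  forall s, c <= complex.Re s -> off_nodes s ->
    nm (zeta_num s * cpow x (- s)) <= K / nm s ^+ 2.
Proof.
move=> x0 xg; have [K K0 HK] := zeta_num_bound.
exists (K * expR (c * (ln g - ln x))); first by rewrite mulr_ge0 ?expR_ge0.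
move=> s sc off; rewrite nmM cpowN nmV nm_cpow -expRN.
rewrite (le_trans (ler_wpM2r (expR_ge0 _) (HK s off)))//.
rewrite mulrAC ler_wpM2r ?invr_ge0 ?exprn_ge0 ?nm_ge0//.
rewrite -mulrA -expRD ler_wpM2l// ler_expR -mulrBr ler_wnM2r// subr_le0.
by rewrite ler_ln.
Qed.

(** Since [x <= g] the integrand decays to the left, and the line crosses the
    poles [0, ..., n - 1] of the numerator. *)
Lemma vertical_limit_num x c : 0 < x -> x <= g -> n%:R - 1 < c -> c < n%:R ->
  vertical_limit c (fun s => zeta_num s * cpow x (- s))
    (\sum_(i < n) kappa i / x ^+ i).
Proof.
move=> x0 xg c1 c2; have [K K0 HK] := zeta_num_decay_left c x0 xg.
exists (K * (2 * pi + 1)) => T T1.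
pose Z : seq R[i] := [seq i%:R | i <- iota 0 n].
pose res w : R[i] := (kappa (Num.truncn (complex.Re w)))%:C *
  cpow x (- (Num.truncn (complex.Re w))%:R).
have resE i : res i%:R = (kappa i / x ^+ i)%:C.
  by rewrite /res natC_Re Num.Theory.natrK cpowN cpow_nat// rmorphM/= fmorphV.
have uZ : uniq Z.
  by rewrite map_inj_uniq ?iota_uniq// => i j /eqP; rewrite eqr_nat => /eqP.
have T0 : 0 < T by lra.
have SZ : \sum_(w <- Z) res w = (\sum_(i < n) kappa i / x ^+ i)%:C.
  rewrite big_map rmorph_sum -(big_mkord xpredT (fun i => (kappa i / x ^+ i)%:C)).
  by rewrite /index_iota subn0; apply: eq_bigr => i _; rewrite resE.
have [||||v Hv vK] := @shift_left R res Z
  (fun s => zeta_num s * cpow x (- s)) c 1 K T T0 K0 uZ.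
- move=> w wZ; have [i iI ->] := elimT (@mapP nat R[i] (fun i => i%:R) (iota 0 n) w) wZ.
  have i_n : (i < n)%N by move: iI; rewrite mem_iota.
  rewrite natC_Re natC_Im normr0; split=> //.
    have : (i.+1%:R : R) <= n%:R by rewrite ler_nat.
    have : (0 : R) <= i%:R by [].
    by rewrite -natr1 => ? ?; apply/andP; split; lra.
  have i_n1 : (i < n.+1)%N by rewrite ltnW.
  rewrite /res natC_Re Num.Theory.natrK.
  exact: (@polar_zeta_num (fun s => cpow x (- s)) (Ordinal i_n1) (analytic_cpow_opp x _)).
- move=> p pc _ pZ; apply: analyticM; last exact: analytic_cpow_opp.
  apply: analytic_zeta_num => i; apply: contraNneq pZ => pE.
  rewrite pE; apply/map_f; rewrite mem_iota add0n/= ltn_neqAle -ltnS ltn_ord andbT.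
  by apply/eqP => iE; move: pc; rewrite pE natC_Re iE; lra.
- by move=> s sc sT; apply: HK => //; apply: off_nodes_Im; rewrite sT.
- move=> s s1; apply: HK; last exact: off_nodes_left.
  have : (0 : R) <= n%:R by [].
  lra.
by exists v => //; rewrite rmorphM/= -SZ.
Qed.

End SprayZeta.

(** * The renewal equation and the sum of residues *)

Section SprayFormula.
Context {R : realType}.
Implicit Types (s z w p u v : R[i]) (h E B M : R[i] -> R[i]) (x c q K e T X F : R).
Variables (n : nat) (kappa : nat -> R) (g : R) (g0 : 0 < g).
Hypothesis balance : \sum_(i < n.+1) kappa i / g ^+ i = 0.
Variables (J : nat) (r : 'I_J -> R) (r01 : forall j, 0 < r j < 1).
Variables (D : R) (D_dim : \sum_(j < J) r j `^ D = 1).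
Hypothesis D_bounds : n%:R - 1 < D < n%:R.

Lemma moran_nat : moran r n%:R = (1 - \sum_(j < J) r j ^+ n)%:C.
Proof.
rewrite /moran rmorphB rmorph_sum/=; congr (_ - _); apply: eq_bigr => j _.
by rewrite cpow_nat//; have /andP[] := r01 j.
Qed.

Lemma ratio_sum_lt1 : \sum_(j < J) r j ^+ n < 1.
Proof.
have /andP[_ Dn] := D_bounds; have := rmoran_lt1 r01 D_dim Dn.
rewrite /rmoran (eq_bigr (fun j => r j ^+ n))// => j _.
by rewrite mulrC expRM_natr lnK//; have /andP[] := r01 j.
Qed.

(** The zeta function times [x ^ (- s)], grouped so that the numerator is one
    factor. *)
Definition spray_term x s := zeta_num n kappa g s * (cpow x (- s) / moran r s).

Lemma spray_termE x s : spray_term x s = spray_zeta r n kappa g s * cpow x (- s).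
Proof. by rewrite /spray_term /spray_zeta mulrA [RHS]mulrAC. Qed.

Lemma analytic_kernel x p : moran r p != 0 ->
  analytic (fun s => cpow x (- s) / moran r s) p.
Proof.
move=> p0; apply: analyticM; first exact: analytic_cpow_opp.
by apply: analyticV => //; apply: (analytic_moran r01 D_dim).
Qed.

Lemma analytic_spray_term x p : (forall i : 'I_n.+1, p != i%:R) -> moran r p != 0 ->
  analytic (spray_term x) p.
Proof. by move=> pi' p0; apply: analyticM; [exact: analytic_zeta_num|exact: analytic_kernel]. Qed.

Lemma meromorphic_spray_term x p : meromorphic (spray_term x) p.
Proof.
apply: meromorphicM; first exact: meromorphic_zeta_num.
apply: meromorphicM; first by apply: analytic_meromorphic; exact: analytic_cpow_opp.
exact: (meromorphic_moranV r01 D_dim p).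
Qed.

Lemma moran_right_neq0 c p : D < c -> c <= complex.Re p -> moran r p != 0.
Proof.
move=> Dc cp; rewrite -nm_gt0 (lt_le_trans _ (moran_right r01 cp))//.
by rewrite subr_gt0 (rmoran_lt1 r01 D_dim).
Qed.

(** Since [x > g] the integrand decays to the right, where [n] is the only
    pole. *)
Lemma vertical_limit_right x c : g < x -> D < c -> c < n%:R ->
  vertical_limit c (spray_term x)
    (- kappa n / x ^+ n / (1 - \sum_(j < J) r j ^+ n)).
Proof.
move=> gx Dc cn; have x0 : 0 < x := lt_trans g0 gx.
have rc : 0 < 1 - rmoran r c by rewrite subr_gt0 (rmoran_lt1 r01 D_dim).
have [K K0 HK] := zeta_num_decay_right g0 balance c x0 (ltW gx).
pose K1 := K / (1 - rmoran r c).
have K10 : 0 <= K1 by rewrite divr_ge0// ltW.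
exists (K1 * (2 * pi + 1)) => T T1.
have T0 : 0 < T by lra.
pose res w : R[i] := (kappa n / x ^+ n / (1 - \sum_(j < J) r j ^+ n))%:C.
have HB s : c <= complex.Re s -> off_nodes n s ->
    nm (spray_term x s) <= K1 / nm s ^+ 2.
  move=> cs off; rewrite /spray_term mulrA nmM nmV /K1.
  rewrite [leRHS]mulrAC.
  have ms := moran_right r01 cs.
  apply: ler_pM; rewrite ?nm_ge0 ?invr_ge0 ?nm_ge0 ?HK//.
  by rewrite lef_pV2 ?posrE// (lt_le_trans rc).
have [||||v Hv vK] := @shift_right R res [:: n%:R] (spray_term x) c (n%:R + 1) K1 T T0 K10 isT.
- move=> w; rewrite inE => /eqP ->; rewrite natC_Re natC_Im normr0; split=> //.
    by apply/andP; split; lra.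
  have mn : moran r n%:R != 0 by apply: (moran_right_neq0 Dc); rewrite natC_Re ltW.
  have := @polar_zeta_num R n kappa g _ ord_max (analytic_kernel x mn).
  rewrite /= cpowN cpow_nat// moran_nat /res !rmorphM/= !fmorphV.
  by rewrite mulrA; apply.
- move=> p cp _; rewrite inE => pn.
  apply: analytic_spray_term; last exact: (moran_right_neq0 Dc cp).
  move=> i; have := ltn_ord i; rewrite ltnS leq_eqVlt => /orP[/eqP->//|i_n].
  apply/eqP => pE; move: cp; rewrite pE natC_Re.
  have : (i.+1%:R : R) <= n%:R by rewrite ler_nat.
  have /andP[D1 _] := D_bounds.
  by rewrite -natr1; lra.
- by move=> s cs sT; apply: HB => //; apply: off_nodes_Im; rewrite sT.
- move=> s sn; apply: HB; last exact: off_nodes_right.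
  lra.
exists v => //; rewrite rmorphM/=; move: vK; rewrite big_seq1 /res -rmorphN.
by rewrite !mulNr.
Qed.

Variable f : R -> R.
Hypothesis f_large : forall x, g < x ->
  f x = - kappa n / x ^+ n / (1 - \sum_(j < J) r j ^+ n).
Hypothesis f_small : forall x, 0 < x -> x <= g ->
  f x = \sum_(i < n) kappa i / x ^+ i + \sum_(j < J) f (x / r j).

(** Induction on the number [m] of divisions by the largest ratio that bring
    [x] above [g]. On the line, multiplying out the denominator turns the term
    at [x] into the numerator term plus the terms at the [x / r_j], which is
    the equation satisfied by [f]. *)
Lemma vertical_limit_spray x c : 0 < x -> D < c -> c < n%:R ->
  vertical_limit c (spray_term x) (f x).
Proof.
move=> x0 Dc cn.
have [i0 _] := ratio_exists D_dim.
have [j0 _ hj0] := @arg_maxP _ _ _ i0 xpredT r isT.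
have /andP[rm0 rm1] := r01 j0; set rm := r j0 in rm0 rm1 hj0.
suff H m : forall x, 0 < x -> g * rm ^+ m < x -> vertical_limit c (spray_term x) (f x).
  have : (fun m => g * rm ^+ m) @ \oo --> g * 0.
    apply: cvgM; first exact: cvg_cst.
    by apply: cvg_expr; rewrite ger0_norm// ltW.
  rewrite mulr0 => /cvgrPdist_lt/(_ x x0)[m _ /(_ m (leqnn _))].
  rewrite /= sub0r normrN ger0_norm; first exact: H.
  by rewrite mulr_ge0 ?exprn_ge0// ltW.
elim: m => [|m ih] {x0}x x0 gx.
  rewrite expr0 mulr1 in gx; rewrite f_large//; exact: vertical_limit_right.
have [xg|gx'] := leP x g; last by rewrite f_large//; exact: vertical_limit_right.
rewrite f_small//.
have /andP[D1 _] := D_bounds.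
have HN := vertical_limit_num g0 balance x0 xg (lt_trans D1 Dc) cn.
have HS : vertical_limit c (fun s => \sum_(j < J) spray_term (x / r j) s)
    (\sum_(j < J) f (x / r j)).
  apply: vertical_limit_sum => j; have /andP[rj0 _] := r01 j.
  apply: ih; first by rewrite divr_gt0.
  rewrite ltr_pdivlMr//; apply: le_lt_trans gx.
  rewrite exprSr mulrA ler_wpM2l//; last exact: hj0.
  by rewrite mulr_ge0 ?exprn_ge0// ltW.
apply: vertical_limit_eq (vertical_limitD HN HS) => t.
set s := c +i* t.
have ms : moran r s != 0 by apply: (moran_right_neq0 Dc).
rewrite (eq_bigr (fun j => zeta_num n kappa g s * (cpow x (- s) / moran r s) * cpow (r j) s)).
  rewrite -mulr_sumr /spray_term.
  have -> : \sum_(j < J) cpow (r j) s = 1 - moran r s by rewrite /moran opprB addrC subrK.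
  by field.
move=> j _; have /andP[rj0 _] := r01 j.
rewrite /spray_term cpowM ?invr_gt0// cpowV// [cpow (r j) (- s)]cpowN invrK.
by ring.
Qed.

Lemma finite_tube_poles T : finite_set (tube_poles r n `&` strip T).
Proof.
rewrite /tube_poles setIUl finite_setU; split; first exact: (finite_zeros_strip r01 D_dim T).
apply: sub_finite_set (@subIsetl _ _ _) _.
by apply: finite_image; exact: finite_II.
Qed.

(** The vertical integral at a fixed abscissa [c] is known by
    [vertical_limit_spray]; moving it to the left between the heights [- tau
    k] and [tau k] collects exactly the residues in the strip. Comparing the
    two values gives the partial sum up to [K3 / tau k]. *)
Lemma strip_sum_spray tau x : admissible_heights r tau -> 0 < x -> x <= g ->
  strip_sum tau (tube_poles r n) (residue (spray_term x)) (f x)%:C.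
Proof.
move=> [tau_cvg [d d0 Hd]] x0 xg; split; first by move=> k; exact: finite_tube_poles.
have /andP[D1 Dn] := D_bounds.
pose c := (D + n%:R) / 2.
have [Dc cn] : D < c /\ c < n%:R by rewrite /c; split; lra.
have [K1 HV] := vertical_limit_spray x0 Dc cn.
have [X0 X00 HX] := moran_left r01 D_dim.
have [K K0 HK] := zeta_num_decay_left g0 balance c x0 xg.
pose m := Num.min d (2^-1).
have m0 : 0 < m by rewrite lt_min d0 invr_gt0 ltr0n.
have [md m2] : m <= d /\ m <= 2^-1 by rewrite /m !ge_min !lexx orbT.
pose K2 := K / m.
have K20 : 0 <= K2 by rewrite divr_ge0// ltW.
have HB s : complex.Re s <= c -> off_nodes n s -> m <= nm (moran r s) ->
    nm (spray_term x s) <= K2 / nm s ^+ 2.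
  move=> cs off ms; rewrite /spray_term mulrA nmM nmV /K2 [leRHS]mulrAC.
  apply: ler_pM; rewrite ?nm_ge0 ?invr_ge0 ?nm_ge0 ?HK//.
  by rewrite lef_pV2 ?posrE// (lt_le_trans m0).
pose X := Num.max X0 1.
have [X0X X1] : X0 <= X /\ 1 <= X by rewrite /X !le_max !lexx orbT.
(* Conjugation carries the lower bound to the lower edge. *)
have Hd' k s : `|complex.Im s| = tau k -> d <= nm (moran r s).
  case: s => a b /=; have [b0|b0] := leP 0 b.
    by rewrite ger0_norm// => ->; have := Hd k a; rewrite normE lecR.
  rewrite (ler0_norm (ltW b0)) => bk; rewrite -moran_conj /= bk.
  by have := Hd k a; rewrite normE lecR.
pose K3 := (`|K1| + K2 * (2 * pi + 1)).
have K30 : 0 <= K3 by rewrite addr_ge0// mulr_ge0// addr_ge0// mulr_ge0// pi_ge0.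
have est k : 1 <= tau k ->
    nm ((\sum_(w \in tube_poles r n `&` strip (tau k)) residue (spray_term x) w : R[i])
      - (f x)%:C) <= K3 / tau k.
  move=> T1; have T0 : 0 < tau k by lra.
  rewrite fsbig_finite/=; last exact: finite_tube_poles.
  set Z := finmap.enum_fset _.
  have inZ w : (w \in Z) = (w \in tube_poles r n `&` strip (tau k)).
    by rewrite /Z in_fset_set//; exact: finite_tube_poles.
  have uZ : uniq Z by exact: finmap.fset_uniq.
  have [||||v Hv vK] := @shift_left R (residue (spray_term x)) Z (spray_term x) c X K2 (tau k) T0 K20 uZ.
  - move=> w; rewrite inZ inE => -[wp wT].
    have [cw rw Pw] := meromorphic_laurent (meromorphic_spray_term x w).
    rewrite (residueE rw); split=> //.
    case: wp => [wz|[i /= i_n <-]].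
      have wD := zeros_Re_le r01 D_dim wz.
      apply/andP; split; last by lra.
      rewrite ltNge; apply/negP => wX.
      have : complex.Re w <= - X0 by lra.
      by move=> /HX; rewrite wz nm0; lra.
    rewrite natC_Re.
    have : (i.+1%:R : R) <= n%:R by rewrite ler_nat.
    have : (0 : R) <= i%:R by [].
    by rewrite -natr1 => ? ?; apply/andP; split; lra.
  - move=> p pc pT pZ.
    have [pT'|pT'] : `|complex.Im p| = tau k \/ `|complex.Im p| < tau k.
      by move: pT; rewrite le_eqVlt => /orP[/eqP|]; [left|right].
      apply: analytic_spray_term; last by rewrite -nm_gt0 (lt_le_trans d0)// (Hd' k).
      by move=> i; apply/eqP => pE; move: pT'; rewrite pE natC_Im normr0; lra.
    have pP : ~ tube_poles r n p.
      by move=> tp; move: pZ; rewrite inZ notin_setE; apply; split.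
    apply: analytic_spray_term; last by apply/eqP => pz; apply: pP; left.
    move=> i; apply/eqP => pE; apply: pP; right; exists i => //=.
    rewrite ltn_neqAle -ltnS ltn_ord andbT; apply/eqP => iE.
    by move: pc; rewrite pE natC_Re iE; lra.
  - move=> s sc sT; apply: HB => //; first by apply: off_nodes_Im; rewrite sT.
    by rewrite (le_trans md)// (Hd' k).
  - move=> s sX; apply: HB; first by have : (0 : R) <= n%:R by []; lra.
      by apply: off_nodes_left; lra.
    by rewrite (le_trans m2)// HX//; lra.
  have [v' Hv' vK'] := HV _ T1.
  have TT : - tau k <= tau k by lra.
  have vv := is_int_unique TT Hv Hv'; rewrite -vv in vK'.
  set S := \sum_(w <- Z) _ in vK *.
  have pi1 : 1 <= 2 * pi :> R by have := pihalf_ge1 R; lra.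
  have -> : S - (f x)%:C = ((2 * pi)%:C * (S - (f x)%:C)) / (2 * pi)%:C.
    rewrite [_ * (S - _)]mulrC mulfK// -nm_gt0 nmR gtr0_norm; lra.
  have npi : nm ((2 * pi)%:C : R[i]) = 2 * pi by rewrite nmR ger0_norm//; lra.
  rewrite nmM nmV npi ler_pdivrMr; last by lra.
  have -> : (2 * pi)%:C * (S - (f x)%:C) =
     (v - (2 * pi * f x)%:C) - (v - (2 * pi)%:C * S) by rewrite rmorphM/=; ring.
  rewrite (le_trans (nmB _ _))// (le_trans (lerD vK' vK))// /K3.
  have h1 : K1 / tau k <= `|K1| / tau k by rewrite ler_wpM2r ?invr_ge0 ?(ltW T0)// ler_norm.
  have h2 : 0 <= K3 / tau k by rewrite divr_ge0// ltW.
  rewrite (le_trans (lerD h1 (lexx _)))// -mulrDl -/K3 ler_peMr//.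
apply/cvg_nmP => e e0.
move/cvgryPge: tau_cvg => /(_ (Num.max 1 (K3 / e)))[N _ HN].
exists N => k /HN; rewrite /= ge_max => /andP[T1 Te].
rewrite (le_trans (est k T1))// ler_pdivrMr; last by lra.
by move: Te; rewrite ler_pdivrMr// mulrC.
Qed.

End SprayFormula.

(** * Volume as an outer measure *)

Section Volume.
Context {R : realType} {n : nat}.
Local Notation V := 'rV[R]_n.+1.
Implicit Types (x y : V) (A U : set V) (a b : nat -> V).
Local Open Scope ereal_scope.

Definition cover_sum a b : \bar R := \sum_(0 <= k <oo) (box_volume (a k) (b k))%:E.

Lemma box_volume_ge0 (a b : V) : (forall i, a ord0 i <= b ord0 i)%R -> (0 <= box_volume a b)%R.
Proof. by move=> ab; apply: prodr_ge0 => i _; rewrite subr_ge0. Qed.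

Lemma cover_sum_ge0 A a b : box_cover A a b -> 0 <= cover_sum a b.
Proof. by move=> [ab _]; apply: nneseries_ge0 => k _ _; rewrite lee_fin box_volume_ge0. Qed.

Lemma volume_le A a b : box_cover A a b -> volume A <= cover_sum a b.
Proof. by move=> ab; apply: ereal_inf_lbound; exists a, b. Qed.

Lemma le_volume A v : (forall a b, box_cover A a b -> v <= cover_sum a b) -> v <= volume A.
Proof. by move=> H; apply: le_ereal_inf_tmp => _ [a [b [ab ->]]]; exact: H. Qed.

Lemma volume_ge0 A : 0 <= volume A.
Proof. by apply: le_volume => a b; exact: cover_sum_ge0. Qed.

Lemma volume_approx A (e : R) : volume A < +oo -> (0 < e)%R ->
  exists a b, box_cover A a b /\ cover_sum a b <= volume A + e%:E.
Proof.
move=> Aoo e0.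
have Afin : volume A \is a fin_num by rewrite ge0_fin_numE// volume_ge0.
have [_ [a [b [ab ->]]] H] := lb_ereal_inf_adherent e0 Afin.
by exists a, b; split=> //; exact: ltW.
Qed.

Lemma volume0 : volume (set0 : set V) = 0.
Proof.
apply/eqP; rewrite eq_le volume_ge0 andbT.
apply: (@le_trans _ _ (cover_sum (fun=> 0%R) (fun=> 0%R))).
  by apply: volume_le; split.
rewrite /cover_sum eseries0// => k _ _.
by rewrite /box_volume big_ord_recl subrr mul0r.
Qed.

Lemma volume_mono : {homo (@volume R n.+1) : A B / A `<=` B >-> A <= B}.
Proof.
move=> A B AB; apply: le_volume => a b [ab cB]; apply: volume_le.
by split=> //; exact: subset_trans cB.
Qed.

Lemma volume_sigma_subadditive : sigma_subadditive (@volume R n.+1).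
Proof.
move=> F; have [[i Foo]|Ffin] := pselect (exists i, volume (F i) = +oo).
  rewrite (eseries_pinfty _ _ Foo) ?leey// => k _.
  by rewrite -ltNye (lt_le_trans _ (volume_ge0 _)).
apply/lee_addgt0Pr => e e0.
rewrite (le_trans _ (epsilon_trick _ _ (ltW e0)))//; last by move=> k; exact: volume_ge0.
have /choice[G HG] : forall k, exists ab : (nat -> V) * (nat -> V),
    box_cover (F k) ab.1 ab.2 /\
    cover_sum ab.1 ab.2 <= volume (F k) + (e / (2 ^ k.+1)%:R)%:E.
  move=> k; have [||a [b H]] := @volume_approx (F k) (e / (2 ^ k.+1)%:R)%R.
  - by rewrite ltey; apply/eqP => Foo; apply: Ffin; exists k.
  - by rewrite divr_gt0// ltr0n expn_gt0.
  - by exists (a, b).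
have /card_esym/pcard_eqP/bijPex[f bf] := card_nat2.
pose a m := (G (f m).1).1 (f m).2; pose b m := (G (f m).1).2 (f m).2.
have GE0 k j : 0 <= (box_volume ((G k).1 j) ((G k).2 j))%:E.
  by rewrite lee_fin box_volume_ge0//; exact: (HG k).1.1.
apply: (@le_trans _ _ (cover_sum a b)).
  apply: volume_le; split=> [m i|x [k _ Fx]]; first exact: (HG (f m).1).1.1.
  have [j _ xj] := (HG k).1.2 x Fx.
  have [_ _ sf] := bf; have [//|m _ fm] := sf (k, j).
  by exists m => //; rewrite /a /b fm.
rewrite /cover_sum nneseries_esumT; last by move=> m; exact: GE0.
rewrite -(@reindex_esum R nat (nat * nat)%type setT setT f
  (fun k => (box_volume ((G k.1).1 k.2) ((G k.1).2 k.2))%:E) bf).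
have -> : [set: nat * nat] = setT `*`` (fun=> setT) by apply/seteqP; split.
rewrite -(@esum_esum R nat nat setT (fun=> setT)
  (fun k j => (box_volume ((G k).1 j) ((G k).2 j))%:E))//.
rewrite [leRHS]nneseries_esumT; last first.
  by move=> k; rewrite adde_ge0 ?volume_ge0// lee_fin divr_ge0// ltW.
apply: le_esum => k _; rewrite -nneseries_esumT//.
exact: (HG k).2.
Qed.

HB.instance Definition _ := isOuterMeasure.Build R V (@volume R n.+1)
  volume0 volume_ge0 volume_mono volume_sigma_subadditive.

(** A homothety maps covers by boxes to covers by boxes and multiplies each
    box volume by [t ^+ n.+1]. *)
Lemma volume_homothety_le (t : R) (v : V) A : (0 < t)%R ->
  volume ((fun x => t *: x + v)%R @` A) <= (t ^+ n.+1)%:E * volume A.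
Proof.
move=> t0; have tn0 : (0 < t ^+ n.+1)%R by rewrite exprn_gt0.
rewrite -lee_pdivrMl//; apply: le_volume => a b [ab cA].
rewrite lee_pdivrMl//.
apply: (@le_trans _ _ (cover_sum (fun k => t *: a k + v)%R (fun k => t *: b k + v)%R)).
  apply: volume_le; split=> [k i|_ [x Ax <-]].
    by rewrite !mxE lerD2r ler_pM2l.
  have [k _ xk] := cA x Ax; exists k => // i; have := xk i.
  by rewrite !mxE !ltrD2r !ltr_pM2l.
rewrite /cover_sum -nneseriesZl; last first.
  by move=> k _; rewrite lee_fin box_volume_ge0.
apply: lee_nneseries => [k _ _|k _].
  by rewrite lee_fin box_volume_ge0// => i; rewrite !mxE lerD2r ler_pM2l.
rewrite -EFinM lee_fin /box_volume.
have -> : (t ^+ n.+1 = \prod_(i < n.+1) t)%R by rewrite prodr_const card_ord.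
rewrite -big_split/=.
rewrite le_eqVlt; apply/orP; left; apply/eqP/eq_bigr => i _.
by rewrite !mxE; ring.
Qed.

Lemma volume_homothety (t : R) (v : V) A : (0 < t)%R ->
  volume ((fun x => t *: x + v)%R @` A) = (t ^+ n.+1)%:E * volume A.
Proof.
move=> t0; apply/eqP; rewrite eq_le volume_homothety_le//=.
have tn0 : (0 < t ^+ n.+1)%R by rewrite exprn_gt0.
rewrite -lee_pdivlMl//.
have E : A = (fun x => t^-1 *: x + (- (t^-1 *: v)))%R @` ((fun x => t *: x + v)%R @` A).
  rewrite image_comp -[LHS]image_id.
  apply: eq_imagel => x _ /=; rewrite scalerDr scalerA mulVf ?gt_eqF// scale1r.
  by rewrite addrK.
by rewrite {1}E -exprVn; apply: volume_homothety_le; rewrite invr_gt0.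
Qed.

Definition half_space (i : 'I_n.+1) (t : R) : set V := [set x | (x ord0 i < t)%R].

Definition upd (a : V) (i : 'I_n.+1) (u : R) : V :=
  (\row_j (if j == i then u else a ord0 j))%R.

Lemma box_volume_upd (a b : V) i (u w : R) :
  box_volume (upd a i u) (upd b i w) =
  ((w - u) * \prod_(j < n.+1 | j != i) (b ord0 j - a ord0 j))%R.
Proof.
rewrite /box_volume (bigD1 i)//= !mxE eqxx; congr (_ * _)%R.
by apply: eq_bigr => j ji; rewrite !mxE (negbTE ji).
Qed.

Lemma upd_id (a : V) i : upd a i (a ord0 i) = a.
Proof. by apply/rowP => j; rewrite mxE; case: eqVneq => [->|]. Qed.

(** A cover is cut by the hyperplane. Boxes are open, so the part of a box
    beyond the hyperplane has to be enlarged by a thin slab; the slab of the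
    [k]-th box is given volume at most [e / 2 ^ k.+1]. *)
Lemma caratheodory_half_space i t : (@volume R n.+1).-caratheodory (half_space i t).
Proof.
apply: le_caratheodory_measurable => X.
apply: le_volume => a b [ab cX].
apply/lee_addgt0Pr => e e0.
pose W k := (\prod_(j < n.+1 | j != i) (b k ord0 j - a k ord0 j))%R.
have W0 k : (0 <= W k)%R by apply: prodr_ge0 => j _; rewrite subr_ge0.
(* The hyperplane cuts the [i]-th side of the [k]-th box at [c k], and the
   second part starts at [m k], slightly before. The [+ 1] in [d k] allows
   for boxes with a face of area zero. *)
pose c k := Num.max (a k ord0 i) (Num.min (b k ord0 i) t).
pose d k := (e / (2 ^ k.+1)%:R / (W k + 1))%R.
have W1 k : (0 < W k + 1)%R by rewrite ltr_wpDl.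
have e2 k : (0 < e / (2 ^ k.+1)%:R)%R by rewrite divr_gt0// ltr0n expn_gt0.
have d0 k : (0 < d k)%R by rewrite divr_gt0.
pose m k := Num.max (a k ord0 i) (c k - d k)%R.
have ac k : (a k ord0 i <= c k)%R by rewrite /c le_max lexx.
have cb k : (c k <= b k ord0 i)%R by rewrite /c ge_max ab ge_min lexx.
have am k : (a k ord0 i <= m k)%R by rewrite /m le_max lexx.
have mb k : (m k <= b k ord0 i)%R.
  by rewrite /m ge_max ab/= (le_trans _ (cb k))// gerBl ltW.
have C1 : box_cover (X `&` half_space i t) a (fun k => upd (b k) i (c k)).
  split=> [k j|x [Xx xt]]; first by rewrite mxE; case: eqVneq => [->|].
  have [k _ xk] := cX x Xx; exists k => // j; rewrite mxE.
  case: eqVneq => [->|_]; last exact: xk.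
  have /andP[-> xb] := xk i; rewrite /c lt_max lt_min xb.
  by rewrite /half_space/= in xt; rewrite xt orbT.
have C2 : box_cover (X `&` ~` half_space i t) (fun k => upd (a k) i (m k)) b.
  split=> [k j|x [Xx /negP xt]]; first by rewrite mxE; case: eqVneq => [->|].
  rewrite -leNgt in xt.
  have [k _ xk] := cX x Xx; exists k => // j; rewrite mxE.
  case: eqVneq => [->|_]; last exact: xk.
  have /andP[ax xb] := xk i; rewrite xb andbT /m gt_max ax/=.
  have tb : (t < b k ord0 i)%R := le_lt_trans xt xb.
  rewrite ltrBlDr (@le_lt_trans _ _ (x ord0 i))// ?ltrDl//.
  by rewrite /c ge_max (ltW ax)/= ge_min xt orbT.
rewrite (le_trans (leeD (volume_le C1) (volume_le C2)))//.
rewrite /cover_sum -nneseriesD; last 2 first.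
- by move=> k _ _; rewrite lee_fin box_volume_ge0//; case: C1.
- by move=> k _ _; rewrite lee_fin box_volume_ge0//; case: C2.
rewrite (le_trans _ (epsilon_trick _ _ (ltW e0)))//; last first.
  by move=> k; rewrite lee_fin box_volume_ge0.
apply: lee_nneseries => [k _ _|k _].
  by rewrite adde_ge0// lee_fin box_volume_ge0//; [case: C1|case: C2].
rewrite -!EFinD lee_fin.
have -> : box_volume (a k) (upd (b k) i (c k)) = ((c k - a k ord0 i) * W k)%R.
  by rewrite -{1}(upd_id (a k) i) box_volume_upd.
have -> : box_volume (upd (a k) i (m k)) (b k) = ((b k ord0 i - m k) * W k)%R.
  by rewrite -{1}(upd_id (b k) i) box_volume_upd.
have -> : box_volume (a k) (b k) = ((b k ord0 i - a k ord0 i) * W k)%R.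
  by rewrite -{1}(upd_id (b k) i) -{1}(upd_id (a k) i) box_volume_upd.
have dW : (d k * W k <= e / (2 ^ k.+1)%:R)%R.
  by rewrite /d mulrAC ler_pdivrMr// ler_wpM2l ?(ltW (e2 k))// lerDl.
have : (c k - d k <= m k)%R by rewrite /m le_max lexx orbT.
move=> /(fun h => ler_wpM2r (W0 k) h).
lra.
Qed.

End Volume.

(** * Euclidean distance and similarities *)

Section Euclidean.
Context {R : realType} {n : nat}.
Local Notation V := 'rV[R]_n.
Local Notation edist := Defs.edist.
Implicit Types (x y z u v w : V) (A U : set V) (e : R).

Definition dot u v : R := \sum_(i < n) u ord0 i * v ord0 i.

Lemma dotC u v : dot u v = dot v u.
Proof. by apply: eq_bigr => i _; rewrite mulrC. Qed.

Lemma dotDl u v w : dot (u + v) w = dot u w + dot v w.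
Proof. by rewrite -big_split; apply: eq_bigr => i _; rewrite mxE mulrDl. Qed.

Lemma dotZl (t : R) u v : dot (t *: u) v = t * dot u v.
Proof. by rewrite mulr_sumr; apply: eq_bigr => i _; rewrite mxE mulrA. Qed.

Lemma dotNl u v : dot (- u) v = - dot u v.
Proof. by rewrite -scaleN1r dotZl mulN1r. Qed.

Lemma dotBl u v w : dot (u - v) w = dot u w - dot v w.
Proof. by rewrite dotDl dotNl. Qed.

Lemma dot_sq_ge0 u : 0 <= dot u u.
Proof. by apply: sumr_ge0 => i _; rewrite -expr2 sqr_ge0. Qed.

Lemma dot_sq_eq0 u : dot u u = 0 -> u = 0.
Proof.
move=> /psumr_eq0P H; apply/rowP => i; rewrite mxE; apply/eqP.
by rewrite -sqrf_eq0 expr2 H// => j _; rewrite -expr2 sqr_ge0.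
Qed.

Lemma edistE x y : edist x y = Num.sqrt (dot (x - y) (x - y)).
Proof. by congr Num.sqrt; apply: eq_bigr => i _; rewrite !mxE expr2. Qed.

Lemma edist_ge0 x y : 0 <= edist x y. Proof. exact: sqrtr_ge0. Qed.

Lemma edist_sqr x y : edist x y ^+ 2 = dot (x - y) (x - y).
Proof. by rewrite edistE sqr_sqrtr// dot_sq_ge0. Qed.

Lemma edist_sym x y : edist x y = edist y x.
Proof. by rewrite !edistE -opprB dotNl dotC dotNl opprK. Qed.

Lemma edist_xx x : edist x x = 0.
Proof. by rewrite edistE subrr -(scale0r (0 : V)) dotZl mul0r sqrtr0. Qed.

Lemma edist_eq0 x y : edist x y = 0 -> x = y.
Proof.
move=> xy0; apply/eqP; rewrite -subr_eq0; apply/eqP/dot_sq_eq0.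
by rewrite -edist_sqr xy0 expr0n.
Qed.

Lemma cauchy_schwarz u v : dot u v <= Num.sqrt (dot u u) * Num.sqrt (dot v v).
Proof.
set a := Num.sqrt (dot u u); set b := Num.sqrt (dot v v).
have a2 : a ^+ 2 = dot u u by rewrite sqr_sqrtr// dot_sq_ge0.
have b2 : b ^+ 2 = dot v v by rewrite sqr_sqrtr// dot_sq_ge0.
have a0 : 0 <= a by exact: sqrtr_ge0.
have b0 : 0 <= b by exact: sqrtr_ge0.
have H : 0 <= 2 * (a * b) * (a * b - dot u v).
  have := dot_sq_ge0 (b *: u - a *: v).
  rewrite !(dotBl, dotZl) [dot u _]dotC [dot v _]dotC !(dotBl, dotZl).
  by rewrite -a2 -b2 [dot v u]dotC; lra.
have [ab0|ab0] := eqVneq (a * b) 0.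
  rewrite ab0; move/eqP: ab0; rewrite mulf_eq0 => /orP[] /eqP z0.
    have -> : u = 0 by apply: dot_sq_eq0; rewrite -a2 z0 expr0n.
    by rewrite -(scale0r (0 : V)) dotZl mul0r.
  have -> : v = 0 by apply: dot_sq_eq0; rewrite -b2 z0 expr0n.
  by rewrite -(scale0r (0 : V)) dotC dotZl mul0r.
have p0 : 0 < 2 * (a * b) by rewrite mulr_gt0// lt_def ab0 mulr_ge0.
by rewrite pmulr_rge0// subr_ge0 in H.
Qed.

Lemma dot_sqrD u v : dot (u + v) (u + v) = dot u u + 2 * dot u v + dot v v.
Proof.
by rewrite dotDl [dot u _]dotC [dot v _]dotC !dotDl [dot v u]dotC; ring.
Qed.

Lemma dot_sqrB u v : dot (u - v) (u - v) = dot u u - 2 * dot u v + dot v v.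
Proof. by rewrite dot_sqrD dotNl [dot v (- v)]dotC [dot u (- v)]dotC !dotNl [dot v u]dotC; ring. Qed.

Lemma edist_triangle x y z : edist x z <= edist x y + edist y z.
Proof.
rewrite -(@ler_pXn2r _ 2)// ?nnegrE ?addr_ge0 ?edist_ge0//.
rewrite edist_sqr; have -> : x - z = (x - y) + (y - z) by rewrite addrA subrK.
set u := x - y; set v := y - z.
rewrite dot_sqrD.
have := cauchy_schwarz u v; rewrite -!edistE => H.
by rewrite sqrrD !edist_sqr -/u -/v; lra.
Qed.

Lemma edist_coord x y (i : 'I_n) : `|x ord0 i - y ord0 i| <= edist x y.
Proof.
rewrite -sqrtr_sqr /edist ler_wsqrtr// (bigD1 i)//= lerDl.
by apply: sumr_ge0 => j _; rewrite sqr_ge0.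
Qed.

Lemma edist_le x y e : 0 <= e -> (forall i, `|x ord0 i - y ord0 i| <= e) ->
  edist x y <= n%:R * e.
Proof.
move=> e0 H; rewrite -(@ler_pXn2r _ 2)// ?nnegrE ?mulr_ge0 ?edist_ge0//.
rewrite /edist sqr_sqrtr; last by apply: sumr_ge0 => j _; rewrite sqr_ge0.
rewrite (@le_trans _ _ (\sum_(i < n) e ^+ 2))//.
  apply: ler_sum => i _; rewrite -[leLHS](ger0_norm (sqr_ge0 _)) normrX.
  by apply: lerXn2r; rewrite ?nnegrE//; exact: H.
rewrite sumr_const card_ord -[leLHS]mulr_natl [leRHS]exprMn.
apply: ler_wpM2r; first exact: sqr_ge0.
by rewrite -natrX ler_nat -mulnn; case: (n) => // m; rewrite leq_pmulr.
Qed.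

Lemma nbhs_edist x A : nbhs x A <-> exists2 e, 0 < e & forall y, edist x y < e -> A y.
Proof.
split.
  move=> /nbhs_ballP[e /= e0 H]; exists e => // y xy; apply: H; split=> // i j.
  by rewrite (ord1 i) /ball/= (le_lt_trans (edist_coord x y j)).
move=> [e e0 H]; apply/nbhs_ballP; exists (e / (n%:R + 1)) => /=.
  by rewrite divr_gt0// ltr_wpDl.
move=> y [_ xy]; apply: H.
have d0 : 0 < e / (n%:R + 1) :> R by rewrite divr_gt0// ltr_wpDl.
rewrite (le_lt_trans (@edist_le x y _ (ltW d0) _))//.
  by move=> i; have := xy ord0 i; rewrite /ball/= => /ltW.
have n1 : 0 < n%:R + 1 :> R by rewrite ltr_wpDl.
by rewrite mulrCA gtr_pMr// ltr_pdivrMr// mul1r ltrDl.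
Qed.

Lemma open_edist U : open U <->
  forall x, U x -> exists2 e, 0 < e & forall y, edist x y < e -> U y.
Proof.
rewrite openE; split=> H x Ux; first by apply/nbhs_edist; exact: H.
by apply/nbhs_edist; exact: H.
Qed.

Lemma open_eball x e : open [set y | edist x y < e].
Proof.
apply/open_edist => y /= xy; exists (e - edist x y); first by rewrite subr_gt0.
by move=> z yz /=; rewrite (le_lt_trans (edist_triangle x y z))//; lra.
Qed.

Section Similarity.
Variables (lam : R) (phi : V -> V) (lam0 : 0 < lam) (phiS : similarity lam phi).

Let psi x := phi x - phi 0.

(** Polarization: the displacement [psi] multiplies distances, hence inner
    products. *)
Lemma sim_dot x y : dot (psi x) (psi y) = lam ^+ 2 * dot x y.
Proof.
have sq u v : dot (phi u - phi v) (phi u - phi v) = lam ^+ 2 * dot (u - v) (u - v).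
  by rewrite -!edist_sqr phiS exprMn.
have pol u v : 2 * dot u v = dot u u + dot v v - dot (u - v) (u - v).
  by rewrite dotBl [dot u (u - v)]dotC [dot v (u - v)]dotC !dotBl [dot v u]dotC; ring.
have two : (2 : R) != 0 by [].
apply: (mulfI two); rewrite mulrCA !pol.
have -> : psi x - psi y = phi x - phi y by rewrite /psi opprB addrA subrK.
by rewrite !sq !subr0; ring.
Qed.

Let mat : 'M[R]_n := \matrix_(i, j) (psi (delta_mx 0 i)) ord0 j.

Lemma dot_delta x (i : 'I_n) : dot x (delta_mx 0 i) = x ord0 i.
Proof.
rewrite /dot (bigD1 i)//= mxE !eqxx mulr1 big1 ?addr0// => j ji.
by rewrite mxE (negbTE ji) andbF mulr0.
Qed.

Lemma mul_mat x : x *m mat = \sum_(i < n) x ord0 i *: psi (delta_mx 0 i).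
Proof.
apply/rowP => j; rewrite mxE summxE; apply: eq_bigr => i _.
by rewrite !mxE.
Qed.

Lemma dot_suml (I : Type) (r : seq I) (F : I -> V) v :
  dot (\sum_(i <- r) F i) v = \sum_(i <- r) dot (F i) v.
Proof.
elim: r => [|i r ih]; rewrite ?big_nil ?big_cons ?dotDl ?ih//.
by rewrite -(scale0r (0 : V)) dotZl mul0r.
Qed.

(** A map that multiplies inner products is linear: the squared length of the
    difference between [psi x] and the combination of the images of the basis
    expands to zero. *)
Lemma sim_linear x : psi x = x *m mat.
Proof.
apply/eqP; rewrite -subr_eq0; apply/eqP/dot_sq_eq0.
have h1 y : dot (psi y) (x *m mat) = lam ^+ 2 * dot y x.
  rewrite dotC mul_mat dot_suml [dot y x]dotC mulr_sumr; apply: eq_bigr => i _.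
  rewrite dotZl sim_dot [dot _ y]dotC dot_delta; ring.
have h2 : dot (x *m mat) (x *m mat) = lam ^+ 2 * dot x x.
  rewrite {1}mul_mat dot_suml mulr_sumr; apply: eq_bigr => i _.
  by rewrite dotZl h1 [dot _ x]dotC dot_delta; ring.
by rewrite dot_sqrB h2 h1 sim_dot; ring.
Qed.

Lemma sim_affine (t : R) x v : phi (t *: x + v) = t *: phi x + (phi v - t *: phi 0).
Proof.
have E y : phi y = psi y + phi 0 by rewrite /psi subrK.
rewrite (E (t *: x + v)) (E x) (E v) !sim_linear mulmxDl -scalemxAl scalerDr.
by rewrite -!addrA; congr (_ + _); rewrite [RHS]addrC -!addrA addNr addr0.
Qed.

Lemma sim_mat_mul : mat *m mat^T = (lam ^+ 2)%:M.
Proof.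
apply/matrixP => i j; rewrite !mxE.
transitivity (dot (psi (delta_mx 0 i)) (psi (delta_mx 0 j))).
  by apply: eq_bigr => k _; rewrite !mxE.
by rewrite sim_dot dot_delta mxE eqxx/= mulr_natr eq_sym.
Qed.

Lemma sim_inj : injective phi.
Proof.
move=> x y xy; apply: edist_eq0.
have := phiS x y; rewrite xy edist_xx => /esym/eqP.
by rewrite mulf_eq0 gt_eqF//= => /eqP.
Qed.

(** The matrix of the linear part times its transpose is scalar, hence
    invertible. *)
Lemma sim_inverse : exists2 ups : V -> V, cancel phi ups /\ cancel ups phi &
  similarity lam^-1 ups.
Proof.
pose M' := lam ^- 2 *: mat^T.
have MM : mat *m M' = 1%:M.
  rewrite -scalemxAr sim_mat_mul scale_scalar_mx mulVf// expf_neq0// gt_eqF//.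
have MM' := mulmx1C MM.
pose ups y := (y - phi 0) *m M'.
have K : cancel phi ups.
  move=> x; rewrite /ups -/(psi x) sim_linear -mulmxA MM mulmx1//.
have K' : cancel ups phi.
  move=> y; rewrite -[LHS](subrK (phi 0)) -/(psi _) sim_linear /ups -mulmxA MM' mulmx1.
  by rewrite subrK.
exists ups => // x y; rewrite -{2}(K' x) -{2}(K' y) phiS mulrA mulVf ?mul1r// gt_eqF//.
Qed.

End Similarity.
End Euclidean.

(** * Dyadic cubes and measurability of open sets *)

(** An outer measure is a measure on its Caratheodory sets, hence continuous
    from below. *)
Lemma caratheodory_measure_cvg (R : realType) (T : pointedType)
  (mu : {outer_measure set T -> \bar R}) (F : nat -> set T) :
  (forall k, mu.-caratheodory (F k)) -> (forall k, F k `<=` F k.+1) ->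
  mu (F k) @[k --> \oo] --> mu (\bigcup_k F k).
Proof.
move=> mF sF.
apply: (@nondecreasing_cvg_mu _ (caratheodory_type mu) R
  (mu : set (caratheodory_type mu) -> \bar R) F) => //.
  exact: caratheodory_measurable_bigcup.
by apply/nondecreasing_seqP => k; rewrite subsetEset.
Qed.

Section Dyadic.
Context {R : realType} {n : nat}.
Local Notation V := 'rV[R]_n.+1.
Local Notation edist := Defs.edist.
Local Notation mu := (@volume R n.+1).
Implicit Types (x y v : V) (A B U : set V) (F : nat -> set V).

Lemma caratheodory_bigcup_sum F : (forall k, mu.-caratheodory (F k)) ->
  trivIset setT F -> mu (\bigcup_k F k) = (\sum_(0 <= k <oo) mu (F k))%E.
Proof.
move=> mF tF; apply/esym/cvg_lim => //.
apply: (caratheodory_measure_sigma_additive (mu := mu)) => //.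
exact: caratheodory_measurable_bigcup.
Qed.

Lemma caratheodory_cvg F : (forall k, mu.-caratheodory (F k)) ->
  (forall k, F k `<=` F k.+1) -> mu (F k) @[k --> \oo] --> mu (\bigcup_k F k).
Proof.
move=> mF sF.
exact: (caratheodory_measure_cvg (mu := mu)).
Qed.

Definition scale (k : nat) : R := 2^-1 ^+ k.

Lemma scale_gt0 k : 0 < scale k. Proof. by rewrite exprn_gt0// invr_gt0. Qed.

(** Half-open cubes of side [2 ^- k]: those of a given level partition the
    space. *)
Definition cube k (z : {ffun 'I_n.+1 -> int}) : set V :=
  [set x | forall i, (z i)%:~R * scale k <= x ord0 i < (z i + 1)%:~R * scale k].

Definition cube_index k x : {ffun 'I_n.+1 -> int} :=
  [ffun i => Num.floor (x ord0 i / scale k)].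

Lemma cubeP k z x : cube k z x <-> cube_index k x = z.
Proof.
have s0 := scale_gt0 k; split.
  move=> xz; apply/ffunP => i; rewrite ffunE; apply: Num.Theory.floor_def.
  by rewrite ler_pdivlMr// ltr_pdivrMr//; exact: xz.
move=> <- i; rewrite ffunE -ler_pdivlMr// -ltr_pdivrMr//.
exact: Num.Theory.floor_itv.
Qed.

Lemma cube_self k x : cube k (cube_index k x) x. Proof. exact/cubeP. Qed.

Definition inner_cubes U k : set V := [set x | cube k (cube_index k x) `<=` U].

Lemma inner_cubes_sub U k : inner_cubes U k `<=` U.
Proof. by move=> x; apply; exact: cube_self. Qed.

Lemma inner_cubes_mono U k : inner_cubes U k `<=` inner_cubes U k.+1.
Proof.
move=> x xU y /cubeP yx; apply: xU; apply/cubeP; apply/ffunP => i.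
have /ffunP/(_ i) := yx; rewrite !ffunE => E.
have half (a b : R) : Num.floor (2 * a) = Num.floor (2 * b) -> Num.floor a <= Num.floor b.
  move=> ab; rewrite leNgt; apply/negP => h.
  have /andP[a1 _] := Num.Theory.floor_itv a.
  have /andP[_ b2] := Num.Theory.floor_itv b.
  have hR : ((Num.floor b + 1)%:~R : R) <= (Num.floor a)%:~R by rewrite ler_int lezD1.
  have : (Num.floor (2 * b) < 2 * (Num.floor b + 1))%R.
    by rewrite Num.Theory.floor_lt_int rmorphM/= ltr_pM2l.
  rewrite -ab ltNge; case/negP.
  by rewrite Num.Theory.floor_ge_int rmorphM/= ler_pM2l// (le_trans hR).
have E2 z : z / scale k.+1 = 2 * (z / scale k).
  by rewrite /scale exprS invfM invrK mulrCA mulrA.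
rewrite !E2 in E.
by apply/eqP; rewrite eq_le !half.
Qed.

Lemma inner_cubes_cover U : open U -> \bigcup_k inner_cubes U k = U.
Proof.
move=> /open_edist oU; apply/seteqP; split=> [x [k _]|x Ux].
  exact: inner_cubes_sub.
have [e e0 He] := oU x Ux.
have [|k hk] := @half_small R (e / (n.+1%:R + 1)); first by rewrite divr_gt0// ltr_wpDl.
exists k => // y yc; apply: He.
have s0 := scale_gt0 k.
have xc := cube_self k x.
rewrite (le_lt_trans (@edist_le R n.+1 x y (scale k) (ltW s0) _))//.
  move=> i; have := xc i; have := yc i; rewrite intrD mulrDl mul1r.
  move=> /andP[? ?] /andP[? ?]; rewrite ler_norml; apply/andP; split; lra.
have N1 : 0 < n.+1%:R + 1 :> R by rewrite ltr_wpDl.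
have := hk k (leqnn _); rewrite -/(scale k) ler_pdivlMr// mulrDr mulr1.
by rewrite [n.+1%:R * _]mulrC; lra.
Qed.

(** The cubes of level [k] inside [U], enumerated without repetition; the
    indices that do not code such a cube give the empty set. *)
Definition cube_seq U k (m : nat) : set V :=
  if pickle_inv m is Some z then
    if `[< cube k z `<=` U >] then cube k z else set0 else set0.

Lemma inner_cubesE U k : inner_cubes U k = \bigcup_m cube_seq U k m.
Proof.
apply/seteqP; split=> [x xU|x [m _]].
  exists (pickle (cube_index k x)) => //.
  by rewrite /cube_seq pickleK_inv; case: asboolP => // _; exact: cube_self.
rewrite /cube_seq; case: pickle_inv => // z; case: asboolP => // zU xz.
by move: (xz) => /cubeP; rewrite /inner_cubes/= => ->.
Qed.

Lemma trivIset_cube_seq U k : trivIset setT (cube_seq U k).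
Proof.
apply/trivIsetP => i j _ _ ij; apply/seteqP; split=> // x [].
rewrite /cube_seq; case Ei : (pickle_inv i) => [z|//]; case: asboolP => // _ xz.
case Ej : (pickle_inv j) => [z'|//]; case: asboolP => // _ xz'.
move/cubeP : xz => Ez; move/cubeP : xz' => Ez'.
have := @pickle_invK {ffun 'I_n.+1 -> int} i; rewrite Ei /= => pi'.
have := @pickle_invK {ffun 'I_n.+1 -> int} j; rewrite Ej /= => pj.
by rewrite -pi' -pj -Ez -Ez' eqxx in ij.
Qed.

(** A class closed under complements and countable unions that contains the
    coordinate half-spaces contains the dyadic cubes and the open sets. This
    is used both for the Caratheodory sets and for the sets with Caratheodory
    image under a similarity. *)
Section SigmaAlgebra.
Variable M : set V -> Prop.
Hypothesis MC : forall A, M A -> M (~` A).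
Hypothesis MU : forall F, (forall k, M (F k)) -> M (\bigcup_k F k).
Hypothesis MH : forall i t, M (half_space i t).

Lemma sigma_set0 : M set0.
Proof.
have -> : set0 = ~` \bigcup_(k : nat) (if k == 0%N then half_space ord0 0 else ~` half_space ord0 0) :> set V.
  apply/seteqP; split=> // x /= H; apply: H.
  by case: (pselect (half_space ord0 0 x)) => hx; [exists 0%N|exists 1%N].
by apply: MC; apply: MU => k; case: ifP => _; [exact: MH|exact/MC/MH].
Qed.

Lemma sigma_setI A B : M A -> M B -> M (A `&` B).
Proof.
move=> MA MB.
have -> : A `&` B = ~` \bigcup_(k : nat) (if k == 0%N then ~` A else ~` B).
  apply/seteqP; split=> [x [Ax Bx] [[|k] _] //|x /= H].
  by split; apply: contrapT => h; apply: H; [exists 0%N|exists 1%N].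
by apply: MC; apply: MU => k; case: ifP => _; exact: MC.
Qed.

Lemma sigma_cube k z : M (cube k z).
Proof.
pose C i := half_space i ((z i + 1)%:~R * scale k) `&` ~` half_space i ((z i)%:~R * scale k).
have -> : cube k z = ~` \bigcup_(m : nat) (~` C (inord m)).
  apply/seteqP; split=> [x xz [m _]|x /= H i].
    apply; have /andP[z1 z2] := xz (inord m); split=> //=.
    by apply/negP; rewrite -leNgt.
  have [x1 /negP x2] : C i x.
    by apply: contrapT => h; apply: H; exists i => //; rewrite inord_val.
  by rewrite -leNgt in x2; rewrite x2 x1.
apply: MC; apply: MU => m; apply: MC; apply: sigma_setI; first exact: MH.
exact/MC/MH.
Qed.

Lemma sigma_cube_seq U k m : M (cube_seq U k m).
Proof.
rewrite /cube_seq; case: pickle_inv => [z|]; last exact: sigma_set0.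
by case: ifP => _; [exact: sigma_cube|exact: sigma_set0].
Qed.

Lemma sigma_open U : open U -> M U.
Proof.
move=> /inner_cubes_cover <-; apply: MU => k; rewrite inner_cubesE.
by apply: MU => m; exact: sigma_cube_seq.
Qed.

End SigmaAlgebra.

Lemma caratheodory_open U : open U -> mu.-caratheodory U.
Proof.
apply: sigma_open => [A|F|i t].
- exact: caratheodory_measurable_setC.
- exact: caratheodory_measurable_bigcup.
- exact: caratheodory_half_space.
Qed.

Lemma volume_bounded A c (rho : R) : (forall x, A x -> edist c x < rho) ->
  (mu A < +oo)%E.
Proof.
move=> H; have [r0|r0] := ltP 0 rho; last first.
  rewrite (_ : A = set0) ?volume0//; apply/seteqP; split=> // x /H.
  by have := edist_ge0 c x; lra.
pose a (k : nat) : V := if k == 0%N then \row_j (c ord0 j - rho) else 0.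
pose b (k : nat) : V := if k == 0%N then \row_j (c ord0 j + rho) else 0.
apply: (@le_lt_trans _ _ (cover_sum a b)).
  apply: volume_le; split=> [k i|x Ax].
    by rewrite /a /b; case: eqP => // _; rewrite !mxE; lra.
  exists 0%N => // i; rewrite /a /b/= !mxE.
  have := le_lt_trans (edist_coord c x i) (H x Ax); rewrite ltr_norml; lra.
rewrite /cover_sum (nneseries_split _ 1); last first.
  move=> k _; rewrite lee_fin box_volume_ge0// => i.
  by rewrite /a /b; case: eqP => // _; rewrite !mxE; lra.
rewrite [X in (_ + X)%E]eseries0 ?adde0.
  by rewrite big_nat1 ltry.
move=> k k1 _; rewrite /a /b gtn_eqF//.
by rewrite /box_volume big_ord_recl subrr mul0r.
Qed.

End Dyadic.

(** * Volume of a similar image *)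

Section SimilarImages.
Context {R : realType} {n : nat}.
Local Notation V := 'rV[R]_n.
Local Notation edist := Defs.edist.
Implicit Types (x y v : V) (A U : set V) (lam t e : R) (phi : V -> V).

Lemma similarity_id : similarity 1 (id : V -> V).
Proof. by move=> x y; rewrite mul1r. Qed.

Lemma similarity_homothety t v : 0 < t -> similarity t (fun x => t *: x + v).
Proof.
move=> t0 x y; rewrite !edistE.
have -> : t *: x + v - (t *: y + v) = t *: (x - y).
  by rewrite opprD addrACA subrr addr0 scalerBr.
rewrite dotZl dotC dotZl mulrA -expr2 sqrtrM ?sqr_ge0// sqrtr_sqr.
by rewrite gtr0_norm.
Qed.

Lemma sim_image lam phi : 0 < lam -> similarity lam phi ->
  exists2 ups, similarity lam^-1 ups & forall A, phi @` A = ups @^-1` A.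
Proof.
move=> lam0 phiS; have [ups [K K'] upsS] := sim_inverse lam0 phiS.
exists ups => // B; apply/seteqP; split=> [_ [x Bx <-]|y By] /=; first by rewrite K.
by exists (ups y).
Qed.

Lemma sim_ball lam phi x e : 0 < lam -> similarity lam phi ->
  phi @` [set y | edist x y < e] = [set y | edist (phi x) y < lam * e].
Proof.
move=> lam0 phiS; have [ups [_ K'] _] := sim_inverse lam0 phiS.
apply/seteqP; split=> [_ [y xy <-]|y /= xy] /=; first by rewrite phiS ltr_pM2l.
by exists (ups y) => //=; rewrite -(ltr_pM2l lam0) -phiS K'.
Qed.

Lemma trivIset_sim_image lam phi (F : nat -> set V) : 0 < lam ->
  similarity lam phi -> trivIset setT F -> trivIset setT (fun k => phi @` F k).
Proof.
move=> lam0 phiS tF i j _ _ [_ [[x Fx <-] [y Fy /(sim_inj lam0 phiS) yx]]].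
by apply: tF => //; exists x; split=> //; rewrite -yx.
Qed.

Lemma open_sim_image lam phi U : 0 < lam -> similarity lam phi -> open U ->
  open (phi @` U).
Proof.
move=> lam0 phiS /open_edist oU; have [ups upsS ->] := sim_image lam0 phiS.
apply/open_edist => x /= /oU[e e0 He]; exists (lam * e); first exact: mulr_gt0.
by move=> y xy /=; apply: He; rewrite upsS mulrC ltr_pdivrMr// mulrC.
Qed.

End SimilarImages.

Section SimilarVolume.
Context {R : realType} {n : nat}.
Local Notation V := 'rV[R]_n.+1.
Local Notation edist := Defs.edist.
Local Notation mu := (@volume R n.+1).
Local Notation Q := (@cube R n 0 [ffun=> 0]).
Local Notation B := [set y : V | edist 0 y < 1].
Implicit Types (x y v : V) (A U : set V) (lam : R) (phi : V -> V).

Lemma volume_eball x (e : R) : 0 < e ->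
  mu [set y | edist x y < e] = ((e ^+ n.+1)%:E * mu B)%E.
Proof.
move=> e0; rewrite -(volume_homothety x B e0).
rewrite (sim_ball _ _ e0 (similarity_homothety x e0)).
by rewrite scaler0 add0r mulr1.
Qed.

Lemma unit_cube_ball : Q `<=` [set y | edist 0 y < n.+2%:R].
Proof.
move=> x xQ /=; apply: (@le_lt_trans _ _ (n.+1%:R * 1)); last by rewrite mulr1 ltr_nat.
apply: edist_le => // i.
have := xQ i; rewrite mxE ffunE /scale expr0 !mulr1 add0r sub0r normrN.
by move=> /andP[x0 x1]; rewrite ger0_norm// ltW.
Qed.

Lemma cube_homothety k z :
  cube k z = (fun x => scale k *: x + scale k *: \row_i (z i)%:~R) @` Q.
Proof.
have s0 := @scale_gt0 R k.
apply/seteqP; split=> [x xz|_ [x xz <-] i].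
  exists ((scale k)^-1 *: x - \row_i (z i)%:~R).
    move=> i; have := xz i; rewrite !mxE ffunE /scale expr0 mulr1 add0r mulr1 -/(scale k).
    move=> /andP[x0 x1]; rewrite subr_ge0 ltrBlDr ler_pdivlMl// ltr_pdivrMl//.
    by rewrite intrD in x1; rewrite mulrC x0/=; lra.
  by rewrite scalerBr scalerA mulfV ?gt_eqF// scale1r subrK.
have := xz i; rewrite ffunE /scale expr0 !mulr1 add0r -/(scale k) => /andP[x0 x1].
rewrite !mxE intrD; have := mulr_ge0 (ltW s0) x0.
have : scale k * x ord0 i < scale k * 1 by rewrite ltr_pM2l.
by move=> h1 h2; apply/andP; split; lra.
Qed.

(** The volume of the [m]-th cube, or of its image under a similarity,
    relative to that of the unit cube, or of its image. *)
Definition cube_weight U k (m : nat) : R :=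
  if pickle_inv m is Some z then
    if `[< cube k z `<=` U >] then scale k ^+ n.+1 else 0 else 0.

Definition inner_weight U k : \bar R :=
  (\sum_(0 <= m <oo) (cube_weight U k m)%:E)%E.

Section OneSimilarity.
Variables (lam : R) (phi : V -> V) (lam0 : 0 < lam) (phiS : similarity lam phi).

(** A similarity is affine, so it maps a homothetic copy of the unit cube to a
    homothetic copy of the image of the unit cube. *)
Lemma volume_image_cube_seq U k m :
  mu (phi @` cube_seq U k m) = ((cube_weight U k m)%:E * mu (phi @` Q))%E.
Proof.
rewrite /cube_seq /cube_weight; case: pickle_inv => [z|]; last by rewrite image_set0 volume0 mul0e.
case: ifP => _; last by rewrite image_set0 volume0 mul0e.
rewrite cube_homothety image_comp.
rewrite -(volume_homothety (phi (scale k *: \row_i (z i)%:~R) - scale k *: phi 0) (phi @` Q) (@scale_gt0 R k)).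
rewrite image_comp; congr (mu _); apply: eq_imagel => x _ /=.
exact: (sim_affine phiS).
Qed.

Lemma caratheodory_image_cube_seq U k m :
  mu.-caratheodory (phi @` cube_seq U k m).
Proof.
have [ups upsS E] := sim_image lam0 phiS.
pose M A := mu.-caratheodory (ups @^-1` A).
rewrite E; apply: (@sigma_cube_seq R n M) => [A|F mF|i t]; rewrite /M.
- by rewrite preimage_setC; exact: caratheodory_measurable_setC.
- by rewrite preimage_bigcup; exact: caratheodory_measurable_bigcup.
- rewrite -E; apply: caratheodory_open; apply: (open_sim_image lam0 phiS).
  apply/open_edist => x /= xt; exists (t - x ord0 i); first by rewrite subr_gt0.
  move=> y /(le_lt_trans (edist_coord x y i)); rewrite ltr_norml /half_space/=; lra.
Qed.

Lemma volume_image_inner_cubes U k :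
  mu (phi @` inner_cubes U k) = (mu (phi @` Q) * inner_weight U k)%E.
Proof.
rewrite inner_cubesE image_bigcup caratheodory_bigcup_sum; last 2 first.
- by move=> m; exact: caratheodory_image_cube_seq.
- exact: (trivIset_sim_image lam0 phiS (@trivIset_cube_seq _ _ U k)).
rewrite (eq_eseriesr (fun m _ => volume_image_cube_seq U k m)).
have fQ : mu (phi @` Q) \is a fin_num.
  rewrite ge0_fin_numE ?volume_ge0//.
  apply: (@volume_bounded R n _ (phi 0) (lam * n.+2%:R)) => _ [x xQ <-].
  by rewrite phiS ltr_pM2l//; exact: unit_cube_ball.
rewrite -(fineK fQ) /inner_weight -nneseriesZl; last first.
  move=> m _; rewrite lee_fin /cube_weight; case: pickle_inv => // z; case: ifP => // _.
  by rewrite exprn_ge0// ltW// scale_gt0.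
by apply: eq_eseriesr => m _; rewrite muleC.
Qed.

Lemma volume_image_cvg U : open U ->
  (mu (phi @` Q) * inner_weight U k)%E @[k --> \oo] --> mu (phi @` U).
Proof.
move=> oU.
rewrite -{2}(inner_cubes_cover oU) image_bigcup.
under eq_fun do rewrite -volume_image_inner_cubes.
apply: caratheodory_cvg => k; last first.
  by apply: image_subset; exact: inner_cubes_mono.
rewrite inner_cubesE image_bigcup; apply: caratheodory_measurable_bigcup => m.
exact: caratheodory_image_cube_seq.
Qed.

End OneSimilarity.

(** The volumes of [U] and of its image are limits of the same weights times
    the volume of the unit cube, or of its image; so it suffices to know the
    ratio for one open set of positive volume. For the unit ball it is [lam ^+
    n.+1], since the image is a ball of radius [lam]. *)
Lemma volume_similarity lam phi U : 0 < lam -> similarity lam phi -> open U ->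
  mu (phi @` U) = ((lam ^+ n.+1)%:E * mu U)%E.
Proof.
move=> lam0 phiS oU.
have Bfin : mu B \is a fin_num.
  by rewrite ge0_fin_numE ?volume_ge0//; apply: (@volume_bounded R n _ 0 1).
have idQ : id @` Q = Q by rewrite image_id.
have phiQ : mu (phi @` Q) = ((lam ^+ n.+1)%:E * mu Q)%E.
  have phiB : mu (phi @` B) = ((lam ^+ n.+1)%:E * mu B)%E.
    by rewrite (sim_ball _ _ lam0 phiS) mulr1 volume_eball.
  have Qfin : mu Q \is a fin_num.
    rewrite ge0_fin_numE ?volume_ge0//.
    exact: (volume_bounded unit_cube_ball).
  have pQfin : mu (phi @` Q) \is a fin_num.
    rewrite ge0_fin_numE ?volume_ge0//.
    apply: (@volume_bounded R n _ (phi 0) (lam * n.+2%:R)) => _ [x xQ <-].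
    by rewrite phiS ltr_pM2l//; exact: unit_cube_ball.
  (* If the unit ball were null, so would be every ball, the unit cube and
     its image. *)
  have [B0|B0] := eqVneq (mu B) 0%E.
    have -> : mu Q = 0%E.
      apply/eqP; rewrite eq_le volume_ge0 andbT.
      by rewrite (le_trans (volume_mono unit_cube_ball))// volume_eball// B0 mule0.
    apply/eqP; rewrite mule0 eq_le volume_ge0 andbT.
    rewrite (le_trans (volume_mono (image_subset phi unit_cube_ball)))//.
    by rewrite (sim_ball _ _ lam0 phiS) volume_eball ?mulr_gt0// B0 mule0.
  have := volume_image_cvg lam0 phiS (@open_eball R n.+1 0 1).
  have := volume_image_cvg ltr01 (similarity_id (n := n.+1)) (@open_eball R n.+1 0 1).
  rewrite idQ image_id => /(cvgeZl pQfin) c1 /(cvgeZl Qfin) c2.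
  have : (mu (phi @` Q) * mu B = mu Q * mu (phi @` B))%E.
    have E : (fun k => mu (phi @` Q) * (mu Q * inner_weight B k))%E =
        (fun k => mu Q * (mu (phi @` Q) * inner_weight B k))%E.
      by apply/funext => k; rewrite muleCA.
    by rewrite E in c1; rewrite -(cvg_lim _ c1)// -(cvg_lim _ c2).
  rewrite phiB muleCA muleA -{1}(fineK pQfin) -{1}(fineK Qfin) -(fineK Bfin) -!EFinM.
  move=> [/mulIf E]; rewrite -(fineK pQfin) -(fineK Qfin) -EFinM E//.
  by apply: contra_neq B0 => B0; rewrite -(fineK Bfin) B0.
have c1 := volume_image_cvg lam0 phiS oU.
have := volume_image_cvg ltr01 (similarity_id (n := n.+1)) oU.
rewrite idQ image_id => /(@cvgeZl _ _ _ _ _ (lam ^+ n.+1)%:E isT) c2.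
have E : (fun k => mu (phi @` Q) * inner_weight U k)%E =
    (fun k => (lam ^+ n.+1)%:E * (mu Q * inner_weight U k))%E.
  by apply/funext => k; rewrite phiQ muleA.
by rewrite E in c1; rewrite -(cvg_lim _ c1)// -(cvg_lim _ c2).
Qed.

End SimilarVolume.

(** * Inner tubes *)

Section Tubes.
Context {R : realType} {n : nat}.
Local Notation V := 'rV[R]_n.
Local Notation edist := Defs.edist.
Implicit Types (x y z : V) (U G : set V) (eps lam : R) (phi : V -> V).

(** Otherwise membership in [U] would be locally constant along the segment
    from [x] to [y], hence constant. *)
Lemma segment_bdry U x y : open U -> U x -> ~ U y ->
  exists2 z, (closure U z /\ ~ U z) & edist x z <= edist x y.
Proof.
move=> oU Ux Uy; apply: contrapT => Hno.
pose p (t : R) := t *: (y - x) + x.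
have dp s t : edist (p s) (p t) = `|s - t| * edist x y.
  rewrite !edistE /p.
  have -> : s *: (y - x) + x - (t *: (y - x) + x) = (t - s) *: (x - y).
    by rewrite opprD addrACA subrr addr0 -scalerBl -[y - x]opprB scalerN -scaleNr opprB.
  by rewrite dotZl dotC dotZl mulrA -expr2 sqrtrM ?sqr_ge0// sqrtr_sqr distrC.
have p0 : p 0 = x by rewrite /p scale0r add0r.
have p1 : p 1 = y by rewrite /p scale1r subrK.
suff : U (p 0) <-> U (p 1) by rewrite p0 p1 => -[/(_ Ux)].
apply: (@cousin R (fun s t => U (p s) <-> U (p t)) 0 1) => // [s t u _ _ _ _ -> //|t t01].
have D0 : 0 < edist x y + 1 by rewrite ltr_wpDl ?edist_ge0.
suff [e e0 He] : exists2 e, 0 < e & forall z, edist (p t) z < e -> U z <-> U (p t).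
  exists (e / (edist x y + 1)) => [|s u s0 st tu u1 su]; first by rewrite divr_gt0.
  have near w : s <= w <= u -> edist (p t) (p w) < e.
    move=> sw; rewrite dp; apply: (@le_lt_trans _ _ ((u - s) * (edist x y + 1))).
      by apply: ler_pM; rewrite ?edist_ge0// ?lerDl// ler_norml; lra.
    by rewrite -ltr_pdivlMr.
  by rewrite !He//; apply: near; lra.
have [Ut|Ut] := pselect (U (p t)).
  by have [e e0 He] := (open_edist U).1 oU _ Ut; exists e => // z /He Uz; split.
have nc : ~ closure U (p t).
  move=> cUt; apply: Hno; exists (p t) => //; rewrite -{1}p0 dp sub0r normrN.
  by rewrite ger0_norm; [rewrite ler_piMl ?edist_ge0//|]; lra.
have [e e0 He] : exists2 e, 0 < e & forall z, edist (p t) z < e -> ~ U z.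
  apply/nbhs_edist; apply: contrapT => h; apply: nc => B nB; apply: contrapT => hB.
  apply: h; apply: filterS nB => z Bz Uz; apply: hB; by exists z.
by exists e => // z /He Uz; split.
Qed.

(** The distance to the boundary can be replaced by the distance to the
    complement, a form that is convenient for unions and images. *)
Lemma inner_tubeE U eps : open U ->
  inner_tube U eps = [set x | U x /\ exists2 y, ~ U y & edist x y < eps].
Proof.
move=> oU; rewrite /inner_tube /bdry (interior_id U).1//.
apply/seteqP; split=> x [Ux].
  move=> /ereal_inf_lt[_ [z [_ Uz] <-]]; rewrite lte_fin => xz; split=> //.
  by exists z.
move=> [y Uy xy]; split=> //; have [z zU xz] := segment_bdry oU Ux Uy.
apply: (@le_lt_trans _ _ (edist x z)%:E); last by rewrite lte_fin (le_lt_trans xz).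
by apply: ereal_inf_lbound; exists z.
Qed.

Lemma open_inner_tube U eps : open U -> open (inner_tube U eps).
Proof.
move=> oU; rewrite inner_tubeE//; apply/open_edist => x [Ux [y Uy xy]].
have [e e0 He] := (open_edist U).1 oU x Ux.
exists (Num.min e (eps - edist x y)); first by rewrite lt_min e0 subr_gt0.
move=> z; rewrite lt_min => /andP[xz1 xz2]; split; first exact: He.
exists y => //; rewrite (le_lt_trans (edist_triangle z x y))// edist_sym; lra.
Qed.

(** A boundary point of one component lies outside all the components, since
    the others are open and disjoint from it. *)
Lemma inner_tube_bigcup (F : nat -> set V) eps : (forall k, open (F k)) ->
  trivIset setT F ->
  inner_tube (\bigcup_k F k) eps = \bigcup_k inner_tube (F k) eps.
Proof.
move=> oF tF; rewrite inner_tubeE; last exact: bigcup_open.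
apply/seteqP; split=> x.
  move=> [[k _ Fx] [y Fy xy]]; exists k => //; rewrite inner_tubeE//.
  by split=> //; exists y => // Fky; apply: Fy; exists k.
move=> [k _]; rewrite inner_tubeE// => -[Fx [y Fy xy]].
split; first by exists k.
have [z [cz Fz] xz] := segment_bdry (oF k) Fx Fy.
exists z; last exact: le_lt_trans xz xy.
move=> [j _ Fjz]; have [w [Fkw Fjw]] := cz _ (open_nbhs_nbhs (conj (oF j) Fjz)).
by apply: Fz; rewrite -(tF j k I I)//; exists w.
Qed.

Lemma inner_tube_similarity lam phi G eps : 0 < lam -> similarity lam phi ->
  open G -> inner_tube (phi @` G) eps = phi @` inner_tube G (eps / lam).
Proof.
move=> lam0 phiS oG; rewrite inner_tubeE; last exact: open_sim_image phiS oG.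
rewrite inner_tubeE//; have [ups [K K'] _] := sim_inverse lam0 phiS.
apply/seteqP; split=> [_ [[x Gx <-] [y Gy xy]]|_ [x [Gx [y Gy xy]] <-]].
  exists x => //; split=> //; exists (ups y).
    by move=> Guy; apply: Gy; exists (ups y).
  by rewrite ltr_pdivlMr// mulrC -phiS K'.
split; first by exists x.
exists (phi y); first by move=> [z Gz /(sim_inj lam0 phiS) zy]; apply: Gy; rewrite -zy.
by rewrite phiS mulrC -ltr_pdivlMr.
Qed.

Lemma inner_tube_mono U : {homo inner_tube U : e e' / e <= e' >-> e `<=` e'}.
Proof.
move=> e e' ee' x [Ux xe]; split=> //.
by apply: (lt_le_trans xe); rewrite lee_fin.
Qed.

End Tubes.

Section SprayTube.
Context {R : realType} {n J : nat}.
Local Notation V := 'rV[R]_n.+1.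
Variables (r : 'I_J -> R) (G : set V) (Gs : nat -> set V).
Hypotheses (r_gt0 : forall j, 0 < r j) (G_open : open G).

Definition word_ratio (w : seq 'I_J) : R := \prod_(j <- w) r j.

Lemma word_ratio_gt0 w : 0 < word_ratio w.
Proof. by rewrite /word_ratio; apply: prodr_gt0. Qed.

(** The tube of the spray is the disjoint union of scaled tubes of the
    generator, one for each word. *)
Lemma tube_volume_spray eps : self_similar_spray r G Gs ->
  tube_volume (\bigcup_k Gs k) eps =
  (\esum_(w in [set: seq 'I_J])
     ((word_ratio w ^+ n.+1)%:E * tube_volume G (eps / word_ratio w)))%E.
Proof.
move=> [lam [[w bw lamE] tGs sGs]].
have lam0 k : 0 < lam k by rewrite lamE; exact: word_ratio_gt0.
have oGs k : open (Gs k).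
  by have [phi phiS ->] := sGs k; exact: (open_sim_image (lam0 k) phiS).
rewrite /tube_volume inner_tube_bigcup//.
rewrite caratheodory_bigcup_sum; last 2 first.
- by move=> k; apply: caratheodory_open; exact: open_inner_tube.
- move=> i j _ _ [x [[Gi _] [Gj _]]]; apply: tGs => //; by exists x.
have bwT : set_bij [set: nat] [set: seq (ordinal J)] w by rewrite setTT_bijective.
rewrite (@reindex_esum R nat (seq 'I_J) setT setT w _ bwT).
rewrite nneseries_esumT; last by move=> k; exact: volume_ge0.
apply: eq_esum => k _; have [phi phiS ->] := sGs k.
rewrite (inner_tube_similarity _ (lam0 k) phiS)//.
rewrite (volume_similarity (lam0 k) phiS)//; last exact: open_inner_tube.
by rewrite lamE.
Qed.

End SprayTube.

(** * Sums over words *)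

Section WordSums.
Context {R : realType} {J : nat}.
Local Notation word := (seq 'I_J).
Implicit Types (a : word -> \bar R) (w : word).
Local Open Scope ereal_scope.

Lemma esumZ (T : choiceType) (c : R) (F : T -> \bar R) : (0 < c)%R ->
  (forall i, 0 <= F i) ->
  \esum_(i in [set: T]) (c%:E * F i) = c%:E * \esum_(i in [set: T]) F i.
Proof.
have le (d : R) (H : T -> \bar R) : (0 < d)%R -> (forall i, 0 <= H i) ->
    \esum_(i in [set: T]) (d%:E * H i) <= d%:E * \esum_(i in [set: T]) H i.
  move=> d0 H0; apply: ge_ereal_sup => _ [X XT <-].
  rewrite -ge0_mule_fsumr// lee_wpmul2l ?lee_fin ?(ltW d0)//.
  by apply: esum_ge; exists X.
move=> c0 F0; apply/eqP; rewrite eq_le le//=.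
rewrite -lee_pdivlMl//.
have -> : \esum_(i in [set: T]) F i =
    \esum_(i in [set: T]) (c^-1%:E * (c%:E * F i)).
  by apply: eq_esum => i _; rewrite muleA -EFinM mulVf ?gt_eqF// mul1e.
by apply: le => [|i]; rewrite ?invr_gt0// mule_ge0// lee_fin ltW.
Qed.

(** A nonempty word is a letter followed by a word. *)
Lemma esum_words a : (forall w, 0 <= a w) ->
  \esum_(w in [set: word]) a w =
  a [::] + \sum_(j < J) \esum_(w in [set: word]) a (j :: w).
Proof.
move=> a0; rewrite (esumID [set [::]])//; congr (_ + _).
  by rewrite setTI esum_set1.
have bc : set_bij [set: 'I_J * word] (setT `&` ~` [set [::]]) (fun jw => jw.1 :: jw.2).
  split; first by [].
    by move=> [j w] [j' w'] _ _ /= [jE wE]; rewrite jE wE.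
  by move=> [|j w] [_ /= h] //; exists (j, w).
rewrite (@reindex_esum R _ _ setT (setT `&` ~` [set [::]]) (fun jw => jw.1 :: jw.2) a bc).
have -> : [set: 'I_J * word] = setT `*`` (fun=> setT) by apply/seteqP; split.
rewrite -(@esum_esum R 'I_J word setT (fun=> setT) (fun j w => a (j :: w)))//.
rewrite esum_fset; [|exact: finite_finset|by move=> j _; exact: esum_ge0].
rewrite [RHS]fsbig_seq ?index_enum_uniq//; apply: eq_fsbigl.
by apply/seteqP; split=> // j _ /=; rewrite mem_index_enum.
Qed.

Variables (r : 'I_J -> R) (r_gt0 : forall j, (0 < r j)%R) (N : nat).
Hypothesis ratio_lt1 : (\sum_(j < J) r j ^+ N < 1)%R.

Lemma word_ratio_cons j w : word_ratio r (j :: w) = (r j * word_ratio r w)%R.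
Proof. by rewrite /word_ratio big_cons. Qed.

Lemma word_ratio_nil : word_ratio r [::] = 1%R.
Proof. by rewrite /word_ratio big_nil. Qed.

Definition word_sum (v : R -> \bar R) (x : R) : \bar R :=
  \esum_(w in [set: word]) ((word_ratio r w ^+ N)%:E * v (x / word_ratio r w)%R).

Lemma word_sum_rec v x : (forall y, 0 <= v y) ->
  word_sum v x = v x + \sum_(j < J) (r j ^+ N)%:E * word_sum v (x / r j)%R.
Proof.
move=> v0; rewrite /word_sum esum_words; last first.
  by move=> w; rewrite mule_ge0// lee_fin exprn_ge0// ltW// word_ratio_gt0.
rewrite word_ratio_nil expr1n mul1e divr1; congr (_ + _); apply: eq_bigr => j _.
rewrite -esumZ ?exprn_gt0//; last first.
  by move=> w; rewrite mule_ge0// lee_fin exprn_ge0// ltW// word_ratio_gt0.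
by apply: eq_esum => w _; rewrite word_ratio_cons exprMn EFinM -muleA invfM mulrA.
Qed.

(** By induction on [m], the words of length less than [m] contribute at most
    the claimed value, so the sum [T] is finite; it then solves [T = 1 + P *
    T]. *)
Lemma word_sum_cst :
  \esum_(w in [set: word]) (word_ratio r w ^+ N)%:E =
  ((1 - \sum_(j < J) r j ^+ N)^-1)%:E.
Proof.
set P := (\sum_(j < J) r j ^+ N)%R.
have P1 : (0 < 1 - P)%R by rewrite subr_gt0.
have wr0 w : 0 <= (word_ratio r w ^+ N)%:E.
  by rewrite lee_fin exprn_ge0// ltW// word_ratio_gt0.
pose S m := \esum_(w in [set: word])
  (if (size w < m)%N then (word_ratio r w ^+ N)%:E else 0).
have S0 m w : 0 <= if (size w < m)%N then (word_ratio r w ^+ N)%:E else 0.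
  by case: ifP.
have Sle m : S m <= (1 - P)^-1%:E.
  elim: m => [|m ih].
    by rewrite /S esum1// lee_fin invr_ge0 ltW.
  rewrite /S esum_words//= word_ratio_nil expr1n.
  apply: (@le_trans _ _ (1 + \sum_(j < J) (r j ^+ N)%:E * (1 - P)^-1%:E)).
    rewrite leeD2l//; apply: lee_sum => j _.
    apply: (@le_trans _ _ ((r j ^+ N)%:E * S m)); last first.
      by rewrite lee_wpmul2l// lee_fin exprn_ge0// ltW.
    rewrite -esumZ ?exprn_gt0//; apply: le_esum => w _.
    rewrite ltnS; case: ifP => _; last by rewrite mule0.
    by rewrite word_ratio_cons exprMn EFinM.
  under eq_bigr do rewrite -EFinM.
  rewrite sumEFin -mulr_suml -/P -EFinD lee_fin.
  by rewrite le_eqVlt; apply/orP; left; apply/eqP; field; lra.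
set T := \esum_(_ in _) _.
have Tle : T <= (1 - P)^-1%:E.
  apply: ge_ereal_sup => _ [X [finX _] <-].
  have [m Xm] : exists m, forall w, X w -> (size w < m)%N.
    exists (\max_(w <- finmap.enum_fset (fset_set X)) size w).+1 => w Xw.
    have wX : w \in finmap.enum_fset (fset_set X) by apply: (etrans (in_fset_set finX w)); exact: mem_set.
    by rewrite ltnS; exact: (leq_bigmax_seq w wX).
  apply: le_trans (Sle m); apply: esum_ge; exists X => //.
  rewrite le_eqVlt; apply/orP; left; apply/eqP.
  by apply: eq_fsbigr => w; rewrite inE => /Xm ->.
have T0 : 0 <= T by exact: esum_ge0.
have Tfin : T \is a fin_num.
  by rewrite ge0_fin_numE// (le_lt_trans Tle)// ltry.
have : T = 1 + \sum_(j < J) (r j ^+ N)%:E * T.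
  rewrite {1}/T esum_words// word_ratio_nil expr1n; congr (_ + _).
  apply: eq_bigr => j _; rewrite -esumZ ?exprn_gt0//.
  by apply: eq_esum => w _; rewrite word_ratio_cons exprMn EFinM.
rewrite -(fineK Tfin).
under eq_bigr do rewrite -EFinM.
rewrite sumEFin -mulr_suml -/P -EFinD => -[E].
congr (_%:E); apply: (mulIf (lt0r_neq0 P1)); rewrite mulVf ?gt_eqF//; lra.
Qed.

(** Dividing by the ratio of a word only increases [x], so [v] has its final
    value [M] in every term. *)
Lemma word_sum_large v (g M x : R) : (forall y, (g <= y)%R -> v y = M%:E) ->
  (0 <= M)%R -> (forall j, (r j < 1)%R) -> (0 < x)%R -> (g <= x)%R ->
  word_sum v x = (M / (1 - \sum_(j < J) r j ^+ N))%:E.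
Proof.
move=> vM M0 r1 x0 gx; have wr1 w : (word_ratio r w <= 1)%R.
  elim: w => [|j w ih]; first by rewrite word_ratio_nil.
  by rewrite word_ratio_cons mulr_ile1// ?(ltW (r1 j)) ?(ltW (r_gt0 j))// ltW// word_ratio_gt0.
have E w : v (x / word_ratio r w)%R = M%:E.
  apply: vM; rewrite (le_trans gx)// ler_pdivlMr ?word_ratio_gt0//.
  by rewrite ler_piMr// ltW.
rewrite /word_sum; under eq_esum do rewrite E.
move: M0; rewrite le_eqVlt => /orP[/eqP <-|M0].
  by rewrite mul0r esum1// => w _; rewrite mule0.
under eq_esum do rewrite muleC.
rewrite esumZ//; first by rewrite word_sum_cst EFinM.
by move=> w; rewrite lee_fin exprn_ge0// ltW// word_ratio_gt0.
Qed.

Lemma word_sum_fin v (M x : R) : (forall y, 0 <= v y) ->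
  (forall y, v y <= M%:E) -> word_sum v x \is a fin_num.
Proof.
move=> v0 vM.
have w0 w : (0 <= word_ratio r w ^+ N)%R by rewrite exprn_ge0// ltW// word_ratio_gt0.
have M1 : (0 < M + 1)%R.
  by have := le_trans (v0 0%R) (vM 0%R); rewrite lee_fin; lra.
rewrite ge0_fin_numE; last by apply: esum_ge0 => w _; rewrite mule_ge0 ?lee_fin.
apply: (@le_lt_trans _ _ (\esum_(w in [set: word]) ((M + 1)%:E * (word_ratio r w ^+ N)%:E))).
  apply: le_esum => w _; rewrite muleC lee_wpmul2r ?lee_fin//.
  by rewrite (le_trans (vM _))// lee_fin; lra.
by rewrite esumZ//; rewrite word_sum_cst -EFinM ltry.
Qed.

End WordSums.

(** * The tube polynomial at the inradius *)

Section Balance.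
Context {R : realType} {n : nat}.
Local Notation V := 'rV[R]_n.+1.
Variables (G : set V) (G_open : open G) (G_finite : (volume G < +oo)%E).
Variables (g : R) (g_gt0 : 0 < g) (kappa : nat -> R).
Hypothesis G_monophase : monophase G g kappa.

Lemma volume_fin : volume G \is a fin_num.
Proof. by rewrite ge0_fin_numE// volume_ge0. Qed.

Lemma tube_volume_ge0 (e : R) : (0 <= tube_volume G e)%E.
Proof. exact: volume_ge0. Qed.

Lemma tube_volume_le (e : R) : (tube_volume G e <= (fine (volume G))%:E)%E.
Proof. by rewrite fineK ?volume_fin//; apply: volume_mono => x []. Qed.

(** The tube of width [g] is the increasing union of narrower tubes, and
    volume is continuous from below; so the polynomial is still valid at [eps
    = g], where the tube fills [G]. *)
Lemma monophase_at_inradius :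
  \sum_(i < n.+1) kappa i * g ^+ (n.+1 - i) = fine (volume G).
Proof.
pose e (k : nat) : R := g * (1 - 2^-1 ^+ k.+1).
have half1 k : 0 < (2^-1 : R) ^+ k.+1 < 1.
  rewrite exprn_gt0 ?invr_gt0//= exprn_ilt1// invf_lt1//.
  by rewrite ltr1n.
have e_itv k : 0 < e k < g.
  have /andP[h0 h1] := half1 k; rewrite /e mulr_gt0 ?subr_gt0//=.
  by rewrite gtr_pMr// gtrBl.
have e_mono k : e k <= e k.+1.
  rewrite /e ler_pM2l// lerB// [leLHS]exprS ler_piMl ?exprn_ge0 ?invr_ge0//.
  by rewrite invf_le1 ?ler1n.
have e_cvg : e k @[k --> \oo] --> g.
  rewrite -[X in _ --> X]mulr1; apply: cvgMl_tmp.
  rewrite -[X in _ --> X](subr0 1); apply: cvgB; first exact: cvg_cst.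
  have : (fun k => 2^-1 ^+ k : R) @ \oo --> 0.
    by apply: cvg_expr; rewrite ger0_norm ?invr_ge0// invf_lt1// ltr1n.
  by rewrite -cvg_shiftS.
have TU : \bigcup_k inner_tube G (e k) = inner_tube G g.
  apply/seteqP; split=> x.
    by move=> [k _]; apply: inner_tube_mono; have /andP[_ /ltW] := e_itv k.
  rewrite inner_tubeE// => -[Gx [y Gy xy]].
  have [|N HN] := @half_small R (1 - Defs.edist x y / g).
    by rewrite subr_gt0 ltr_pdivrMr// mul1r.
  exists N.+1 => //; rewrite inner_tubeE//; split=> //; exists y => //.
  have : 2^-1 ^+ N.+2 < 2^-1 ^+ N.+1 :> R.
    by rewrite [ltLHS]exprS gtr_pMl ?exprn_gt0 ?invr_gt0// invf_lt1// ltr1n.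
  have := HN N.+1 (leqnSn _) => h1 h2.
  rewrite /e -ltr_pdivrMl// mulrC; lra.
have c1 : volume (inner_tube G (e k)) @[k --> \oo] --> volume (inner_tube G g).
  rewrite -TU; apply: caratheodory_cvg => k.
    by apply: caratheodory_open; exact: open_inner_tube.
  exact: inner_tube_mono.
pose p : {poly R} := \sum_(i < n.+1) kappa i *: 'X^(n.+1 - i).
have pE x : p.[x] = \sum_(i < n.+1) kappa i * x ^+ (n.+1 - i).
  by rewrite /p horner_sum; apply: eq_bigr => i _; rewrite hornerZ hornerXn.
have c2 : (p.[e k])%:E @[k --> \oo] --> (p.[g])%:E.
  apply: cvg_EFin; first exact: nearW.
  by apply: (cvg_comp _ _ e_cvg); exact: continuous_horner.
rewrite -pE.
have E : (fun k => volume (inner_tube G (e k))) = (fun k => (p.[e k])%:E).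
  apply/funext => k; have := G_monophase.1 _ (e_itv k).
  by rewrite -pE.
have := G_monophase.2 g (lexx _); rewrite /tube_volume => Eg.
rewrite E Eg in c1.
by rewrite -(cvg_lim _ c1)// (cvg_lim _ c2).
Qed.

End Balance.

(** * The tube formula *)

Lemma strip_sum_scale (R : realType) (tau : nat -> R) (A : set R[i])
    (F H : R[i] -> R[i]) (c S : R[i]) :
  (forall w, H w = c * F w) -> strip_sum tau A F S -> strip_sum tau A H (c * S).
Proof.
move=> HE [fA cS]; split=> //.
have -> : (fun k => \sum_(w \in A `&` strip (tau k)) H w) =
    (fun k => c * \sum_(w \in A `&` strip (tau k)) F w).
  apply/funext => k; rewrite mulr_fsumr.
  by apply: eq_fsbigr => w _; exact: HE.
move/cvg_nmP: cS => cS; apply/cvg_nmP => e e0.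
have c1 : 0 < nm c + 1 by rewrite ltr_wpDl ?nm_ge0.
have [|N hN] := cS (e / (nm c + 1)); first by rewrite divr_gt0.
exists N => k /hN; rewrite ler_pdivlMr// -mulrBr nmM mulrC => h.
by rewrite (le_trans _ h)// ler_wpM2r ?nm_ge0// lerDl.
Qed.

Theorem mainTheorem1 (R : realType) (n : nat) (n_ge1 : (1 <= n)%N)
    (G : set 'rV[R]_n) (G_neq0 : G !=set0) (G_open : open G)
    (G_finite : (volume G < +oo)%E)
    (g : R) (g_gt0 : 0 < g) (g_inradius : inradius G = g%:E)
    (kappa : nat -> R) (G_monophase : monophase G g kappa)
    (kappa_n : kappa n = - fine (volume G))
    (J : nat) (r : 'I_J -> R) (r_ratio : forall j, 0 < r j < 1)
    (D : R) (D_dim : \sum_(j < J) r j `^ D = 1)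
    (D_bounds : n%:R - 1 < D < n%:R)
    (Gs : nat -> set 'rV[R]_n) (Gs_spray : self_similar_spray r G Gs) :
  (exists tau : nat -> R, admissible_heights r tau) /\
  forall tau : nat -> R, admissible_heights r tau ->
  forall eps : R, 0 < eps < g ->
    let V := tube_volume (\bigcup_k Gs k) eps in
    [/\ V \is a fin_num,
        strip_sum tau (tube_poles r n)
          (fun w => residue
             (fun s => spray_zeta r n kappa g s * cpow eps (- s)) w)
          (fine V / eps ^+ n)%:C &
        strip_sum tau (tube_poles r n)
          (fun w => residue
             (fun s => cpow eps (n%:R - s) * spray_zeta r n kappa g s) w)
          (fine V)%:C].
Proof.
split; first exact: (exists_admissible_heights r_ratio D_dim).
move=> tau tau_adm eps /andP[eps0 epsg].
case: n => [//|n] in n_ge1 G G_neq0 G_open G_finite g_inradius G_monophase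
  kappa_n D_bounds Gs Gs_spray *.
move=> V.
have r0 j : 0 < r j by have /andP[] := r_ratio j.
have r1 j : r j < 1 by have /andP[] := r_ratio j.
have P1 := ratio_sum_lt1 r_ratio D_dim D_bounds.
pose M := fine (volume G).
have M0 : 0 <= M by rewrite fine_ge0// volume_ge0.
have vM := tube_volume_le G_finite.
have v0 := tube_volume_ge0 G.
pose W := word_sum r n.+1 (tube_volume G).
have Wfin x : W x \is a fin_num by exact: (word_sum_fin r0 P1 x v0 vM).
have VE : V = W eps by exact: (tube_volume_spray r0 G_open eps Gs_spray).
have poly_g := monophase_at_inradius G_open g_gt0 G_monophase.
(* The cancellation behind the decay of the numerator is the tube polynomial
   at [g] divided by [g ^+ n.+1]. *)
have balance : \sum_(i < n.+2) kappa i / g ^+ i = 0.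
  have gn : g ^+ n.+1 != 0 by rewrite expf_neq0// gt_eqF.
  apply: (mulfI gn); rewrite mulr0 big_ord_recr/= mulrDr mulrCA mulfV// mulr1.
  rewrite kappa_n -poly_g mulr_sumr; apply/eqP; rewrite subr_eq0; apply/eqP.
  apply: eq_bigr => i _; rewrite mulrCA; congr (_ * _).
  by rewrite expfB.
(* The function to which the renewal equation applies. *)
pose f x := fine (W x) / x ^+ n.+1.
have f_large x : g < x ->
    f x = - kappa n.+1 / x ^+ n.+1 / (1 - \sum_(j < J) r j ^+ n.+1).
  move=> gx; rewrite /f /W (@word_sum_large _ _ _ r0 _ P1 _ g M)//; first last.
  - exact: ltW.
  - exact: lt_trans gx.
  - by move=> y gy; rewrite G_monophase.2// fineK// volume_fin.
  by rewrite kappa_n opprK /= mulrAC.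
have f_small x : 0 < x -> x <= g ->
    f x = \sum_(i < n.+1) kappa i / x ^+ i + \sum_(j < J) f (x / r j).
  move=> x0 xg; have xn : x ^+ n.+1 != 0 by rewrite expf_neq0// gt_eqF.
  have vx : tube_volume G x = (\sum_(i < n.+1) kappa i * x ^+ (n.+1 - i))%:E.
    move: xg; rewrite le_eqVlt => /orP[/eqP ->|xg].
      by rewrite poly_g G_monophase.2// fineK// volume_fin.
    by apply: G_monophase.1; rewrite x0 xg.
  have WE : fine (W x) = \sum_(i < n.+1) kappa i * x ^+ (n.+1 - i) +
      \sum_(j < J) r j ^+ n.+1 * fine (W (x / r j)).
    rewrite /W word_sum_rec// vx -/W.
    rewrite (eq_bigr (fun j => (r j ^+ n.+1 * fine (W (x / r j)))%:E)) => [|j _].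
      by rewrite sumEFin -EFinD.
    by rewrite EFinM fineK.
  rewrite /f WE mulrDl !mulr_suml; congr (_ + _); apply: eq_bigr => i _.
    by rewrite -mulrA; congr (_ * _); rewrite expfB// mulrAC mulfV// mul1r.
  by rewrite expr_div_n invf_div mulrAC mulrC.
have S1 := strip_sum_spray g_gt0 balance r_ratio D_dim D_bounds f_large f_small
  tau_adm eps0 (ltW epsg).
have termE : (fun s => spray_zeta r n.+1 kappa g s * cpow eps (- s)) =
    spray_term n.+1 kappa g r eps by apply/funext => s; rewrite spray_termE.
split; first by rewrite VE.
  by rewrite termE VE.
have -> : (fine V)%:C = (eps ^+ n.+1)%:C * (f eps)%:C.
  by rewrite -rmorphM/= /f VE mulrCA mulfV ?mulr1// expf_neq0// gt_eqF.
apply: strip_sum_scale S1 => w.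
have -> : (fun s => cpow eps (n.+1%:R - s) * spray_zeta r n.+1 kappa g s) =
    (fun s => (eps ^+ n.+1)%:C * spray_term n.+1 kappa g r eps s).
  apply/funext => s; rewrite spray_termE cpowD cpow_nat//.
  by rewrite -mulrA [cpow _ _ * _]mulrC.
have [c res_c _] := meromorphic_laurent (meromorphic_spray_term n.+1 kappa g r_ratio D_dim eps w).
by rewrite (residueE res_c) (residueE (is_residueZ _ res_c)).
Qed.
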